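(* Let $A$ be a Young function satisfying both the $\Delta_2$ condition and the $\nabla_2$ condition. Let $(T_n)_{n\ge1}$ be a nondecreasing sequence of positive numbers with $T_n\to\infty$ and $T_n=o(n^{1/34})$ as $n\to\infty$, and let $\chi_n=\chi_{(-T_n,T_n)}$. Then $$\lim_{n\to\infty}\int_{\mathbb{R}}A\bigl(\lambda|\chi_nS_n(f\chi_n)-f|\bigr)=0\quad\text{for every } f\in L^A(\mathbb{R})\text{ and every }\lambda>0.$$
   Context: Hermite sums. For $k=0,1,\dots$ the Hermite function is $h_k(x)=(-1)^k\gamma_k e^{x^2/2}\frac{d^k}{dx^k}e^{-x^2}$, $x\in\mathbb{R}$, with $\gamma_k=\pi^{-1/4}2^{-k/2}(k!)^{-1/2}$. For a suitable function $f$ on $\mathbb{R}$, $S_nf=\sum_{k=0}^n c_kh_k$ with $c_k=\int_{\mathbb{R}}fh_k$. A Young function is a function $A:[0,\infty)\to[0,\infty]$ that is left-continuous, convex, satisfies $A(0)=0$ and is not constant in $(0,\infty)$. It satisfies $\Delta_2$ if there is $C>0$ such that $A(2t)\le CA(t)$ for all $t>0$; it satisfies $\nabla_2$ if there is $c>0$ such that $A(t)\le\frac{1}{2c}A(ct)$ for all $t>0$. Further, $L^A(\mathbb{R})=\{f:\mathbb{R}\to\mathbb{R}\text{ measurable}:\int_{\mathbb{R}}A(c|f|)<\infty\text{ for some }c>0\}$. *)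

(* Defs.v *)
From HB Require Import structures.
From mathcomp Require Import all_boot all_order all_algebra.
From mathcomp Require Import all_classical all_reals all_analysis.

Set Implicit Arguments.
Unset Strict Implicit.
Unset Printing Implicit Defensive.

Import Order.TTheory GRing.Theory Num.Theory.
Import numFieldTopology.Exports numFieldNormedType.Exports.

Local Open Scope classical_set_scope.
Local Open Scope ring_scope.

(* The real line with the sigma-algebra of Lebesgue measurable sets, which is
   strictly larger than the Borel sigma-algebra that the library puts on R. *)
Definition lebesgueR (R : realType) :=
  caratheodory_type ((wlength (idfun : R -> R))^*%mu).

Notation leb R := (@completed_lebesgue_measure R).

Definition lebesgue_measurable_fun (R : realType) (f : R -> R) :=
  measurable_fun [set: lebesgueR R] (f : lebesgueR R -> R).

(* A function [0, +oo[ -> [0, +oo] is encoded as a function R -> \bar R whose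
   values at negative arguments are irrelevant. *)
Record young_function (R : realType) (A : R -> \bar R) : Prop := {
  young_ge0 : forall t : R, 0 <= t -> (0%E <= A t)%E ;
  young0 : A 0 = 0%E ;
  young_left_continuous : forall t : R, 0 < t -> A s @[s --> t^'-] --> A t ;
  young_convex : forall s t p : R, 0 <= s -> 0 <= t -> 0 <= p <= 1 ->
    (A (p * s + (1 - p) * t)%R <= p%:E * A s + (1 - p)%:E * A t)%E ;
  young_nonconstant : exists s t : R, [/\ 0 < s, 0 < t & A s <> A t] }.

Definition Delta2 (R : realType) (A : R -> \bar R) : Prop :=
  exists2 C : R, 0 < C & forall t : R, 0 < t -> (A (2 * t)%R <= C%:E * A t)%E.

Definition nabla2 (R : realType) (A : R -> \bar R) : Prop :=
  exists2 c : R, 0 < c &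
    forall t : R, 0 < t -> (A t <= ((2 * c)^-1)%:E * A (c * t)%R)%E.

Definition orlicz_space (R : realType) (A : R -> \bar R) : set (R -> R) :=
  [set f | lebesgue_measurable_fun f /\
    exists2 c : R, 0 < c & (\int[leb R]_x A (c * `|f x|)%R < +oo)%E].

Definition hermite_gamma (R : realType) (k : nat) : R :=
  pi `^ (- 4^-1) * 2 `^ (- (k%:R / 2)) * (k`!)%:R `^ (- 2^-1).

Definition hermite (R : realType) (k : nat) (x : R) : R :=
  (-1) ^+ k * hermite_gamma R k * expR (x ^+ 2 / 2) *
  derive1n k (fun y : R => expR (- y ^+ 2)) x.

Definition hermite_coef (R : realType) (f : R -> R) (k : nat) : R :=
  \int[leb R]_x (f x * hermite k x).

Definition hermite_sum (R : realType) (n : nat) (f : R -> R) (x : R) : R :=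
  \sum_(0 <= k < n.+1) hermite_coef f k * hermite k x.

Definition chi (R : realType) (t : R) : R -> R := \1_(`]- t, t[).

(* Main.v *)
From HB Require Import structures.
Require Import Defs.
From mathcomp Require Import all_boot all_order all_algebra.
From mathcomp Require Import all_classical all_reals all_analysis.
From mathcomp Require Import measurable_realfun.
From mathcomp Require Import zify ring lra.

Set Implicit Arguments.
Unset Strict Implicit.
Unset Printing Implicit Defensive.

Import Order.TTheory GRing.Theory Num.Theory.
Import numFieldTopology.Exports numFieldNormedType.Exports.

Local Open Scope classical_set_scope.
Local Open Scope ring_scope.

(** The operators [f |-> chi_n S_n (f chi_n)] turn out to be bounded in the
    modular of [A], uniformly in [n], and they converge on bounded functions of
    bounded support. Such functions are dense for the modular because of
    [Delta_2], and the theorem follows by splitting [f].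

    Uniform boundedness. The Christoffel-Darboux formula writes the kernel of
    [S_n] as [(u (x) v (y) - v (x) u (y)) / (x - y)], where [u] and [v] are
    multiples of [h_(n+1)] and [h_n] that stay below [2] on [x ^ 2 <= n]
    ([cd_scale_bound]); this rests on the quantity of Sonin, which decreases
    away from the origin, and on the Wallis size of [h_k (0)]. Since
    [T_n ^ 2 <= n] for large [n], the truncated sum is a difference of two
    Hilbert transforms with bounded factors inside and outside. Only the weak
    type (1, 1) of the Hilbert transform is needed, and after [f] has been
    replaced by atoms on a fine grid it is Boole's lemma: the set where
    [sum_j m_j / (x - t_j)] exceeds [l] is a union of intervals whose total
    length Vieta's formula evaluates as [sum_j m_j / l]. This gives
    [ksum_weak11]. Bessel's inequality is the strong type (2, 2).
    Interpolation between the two ([marcinkiewicz]) covers every growth that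
    lies strictly between [t] and [t ^ 2], in particular the exponents
    [q / (q - 1)] with [q] large; by self-adjointness the sums are then bounded
    in [L ^ q] for all large [q] ([ksum_strong]). The conditions [Delta_2] and
    [nabla_2] place the growth of [A] strictly between [t] and some [t ^ q], so
    that a second interpolation, between the weak type (1, 1) and [L ^ q],
    bounds the modular of [A] ([ksum_modular_bound]).

    Convergence. The Hermite functions are complete ([hermite_cvg_bounded]), so
    the sums of a bounded function of bounded support converge in mean square.
    The bounds in [L ^ (q / (q - 1))] and [L ^ q], whose powers dominate [A]
    near [0] and near infinity with room to spare ([growth_interpolate]),
    turn this into convergence in the modular of [A].

    All this takes place for Borel functions and the Borel measure; a Lebesgue
    measurable function differs from a Borel function on a null set, which
    the Hermite coefficients and the modular do not see. *)

(** * Hermite functions: recurrences and the differential equation *)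

Section HermiteAlgebra.
Variable R : realType.
Implicit Types (k n : nat) (x y : R).

(** The physicists' normalisation: [H_(k+1) = 2 X H_k - H_k'] is what one
    differentiation of [H_k (x) exp (- x ^ 2)] produces, up to sign. *)
Fixpoint hermite_poly k : {poly R} :=
  if k is j.+1 then 2%:P * 'X * hermite_poly j - (hermite_poly j)^`() else 1.

Lemma deriv_hermite_poly k :
  (hermite_poly k.+1)^`() = (2 * k.+1%:R)%:P * hermite_poly k.
Proof.
have two_step j : (hermite_poly j.+2)^`() =
    2%:P * hermite_poly j.+1 + 2%:P * 'X * (hermite_poly j.+1)^`()
      - (hermite_poly j.+1)^`()^`().
  rewrite [hermite_poly j.+2]/= derivB !derivM derivC derivX.
  by rewrite mul0r add0r mulr1.
elim: k => [|k IH].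
  rewrite /= -polyC1 derivC subr0 polyC1 mulr1 derivM derivC derivX.
  by rewrite mul0r add0r !mulr1.
rewrite two_step IH derivM derivC mul0r add0r.
transitivity ((2 + 2 * k.+1%:R)%:P * hermite_poly k.+1).
  by rewrite (polyCD 2) /=; set c := (2 * k.+1%:R)%:P; ring.
by congr (_%:P * _); rewrite -[in RHS]natr1; ring.
Qed.

Lemma hermite_polySS k :
  hermite_poly k.+2 =
  2%:P * 'X * hermite_poly k.+1 - (2 * k.+1%:R)%:P * hermite_poly k.
Proof. by rewrite -deriv_hermite_poly. Qed.

Lemma hermite_poly1 : hermite_poly 1 = 2%:P * 'X.
Proof. by rewrite /= -polyC1 derivC subr0 polyC1 mulr1. Qed.

Let gauss y : R := expR (- y ^+ 2).

Lemma derive1n_gauss k :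
  derive1n k gauss = fun x => (-1) ^+ k * (hermite_poly k).[x] * gauss x.
Proof.
elim: k => [|k IH].
  by rewrite derive1n0; apply/funext => x; rewrite expr0 /= hornerC !mul1r.
rewrite derive1nS IH; apply/funext => x; rewrite derive1E.
apply: derive_val => /=.
have dg : is_derive x 1 gauss (- 2 * x * gauss x).
  rewrite /gauss; apply: is_derive_eq.
  by rewrite /= /GRing.scale/=; ring.
apply: is_derive_eq.
rewrite hornerD hornerN !hornerM hornerC hornerX exprS /GRing.scale /=.
by rewrite /cst; ring.
Qed.

End HermiteAlgebra.

(** Locked, so that unification never unfolds the iterated derivative. *)
HB.lock Definition hermite_fun (R : realType) (k : nat) (x : R) : R := hermite k x.

Section HermiteFunctions.
Variable R : realType.
Implicit Types (k n : nat) (x y : R).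
Local Notation gamma := (@hermite_gamma R).
Local Notation h := (@hermite_fun R).

Lemma hermiteE k x :
  h k x = gamma k * (hermite_poly R k).[x] * expR (- (x ^+ 2 / 2)).
Proof.
rewrite hermite_fun.unlock /hermite derive1n_gauss.
have -> : expR (- x ^+ 2) = expR (- (x ^+ 2 / 2)) * expR (- (x ^+ 2 / 2)) :> R.
  by rewrite -expRD; congr expR; lra.
have := expRxMexpNx_1 (x ^+ 2 / 2); set a := expR (x ^+ 2 / 2).
set b := expR _; move=> ab.
have s1 : (-1) ^+ k * (-1) ^+ k = 1 :> R.
  by rewrite -expr2 -exprM mulnC exprM sqrrN expr1n expr1n.
transitivity (((-1) ^+ k * (-1) ^+ k) * (a * b) *
   (gamma k * (hermite_poly R k).[x] * b)); first by ring.
by rewrite s1 ab !mul1r.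
Qed.

Lemma hermite_gamma_gt0 k : 0 < gamma k.
Proof.
by rewrite /hermite_gamma !mulr_gt0 ?powR_gt0 ?pi_gt0.
Qed.

Lemma hermite_gammaS k : gamma k = Num.sqrt (2 * k.+1%:R) * gamma k.+1.
Proof.
rewrite /hermite_gamma factS natrM powRM ?ler0n//.
have -> : - (k.+1%:R / 2) = - (k%:R / 2) + - 2^-1 :> R by rewrite -natr1; lra.
rewrite powRD; last by apply/implyP => _; rewrite pnatr_eq0.
rewrite sqrtrM // -!powR12_sqrt // ?ler0n //.
have inv a : 0 < a -> a `^ 2^-1 * a `^ (- 2^-1) = 1 :> R.
  by move=> a0; rewrite -powRD ?subrr ?powRr0//; apply/implyP => _; rewrite gt_eqF.
have /inv i2 : 0 < 2 :> R by [].
have /inv ik : 0 < k.+1%:R :> R by rewrite ltr0n.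
set u := 2 `^ (- 2^-1) in i2 *; set v := 2 `^ 2^-1 in i2 *.
set u' := _ `^ (- 2^-1) in ik *; set v' := _ `^ 2^-1 in ik *.
set p := pi `^ _; set q := 2 `^ _; set f := _`!%:R `^ _.
by rewrite -[LHS]mul1r -[LHS]mul1r -[X in X * _]i2 -[X in _ * (X * _)]ik; ring.
Qed.

Lemma sqrt_half_double k : Num.sqrt (k%:R / 2) * Num.sqrt (2 * k%:R) = k%:R :> R.
Proof.
rewrite -sqrtrM ?divr_ge0// (_ : _ * _ = k%:R ^+ 2); last by field.
by rewrite sqrtr_sqr ger0_norm.
Qed.

Lemma sqrt_double_half k : Num.sqrt (2 * k%:R) = 2 * Num.sqrt (k%:R / 2) :> R.
Proof.
rewrite (_ : 2 * k%:R = 2 ^+ 2 * (k%:R / 2) :> R); last by field.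
by rewrite sqrtrM ?sqr_ge0// sqrtr_sqr ger0_norm.
Qed.

Lemma hermite_gammaS' k : gamma k = 2 * Num.sqrt (k.+1%:R / 2) * gamma k.+1.
Proof. by rewrite -sqrt_double_half -hermite_gammaS. Qed.

Lemma sqrt_halfK k : Num.sqrt (k%:R / 2) * (2 * Num.sqrt (k%:R / 2)) = k%:R :> R.
Proof. by rewrite -sqrt_double_half sqrt_half_double. Qed.

Let hornerS := (hornerD, hornerN, hornerM, hornerC, hornerX).

Lemma hermite_rec k x :
  x * h k x = Num.sqrt (k.+1%:R / 2) * h k.+1 x + Num.sqrt (k%:R / 2) * h k.-1 x.
Proof.
rewrite !hermiteE; case: k => [|k].
  rewrite mul0r sqrtr0 mul0r addr0 (hermite_gammaS' 0).
  by rewrite hermite_poly1 !hornerS; ring.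
rewrite hermite_polySS !hornerS [k.+1.-1]/=.
have aux (s2 s1 g0 g1 g2 c p q e : R) : s1 * (2 * s1) = c ->
    g0 = 2 * s1 * g1 -> g1 = 2 * s2 * g2 ->
    x * (g1 * q * e) = s2 * (g2 * (2 * x * q - 2 * c * p) * e) + s1 * (g0 * p * e).
  by move=> <- -> ->; ring.
by apply: aux; [exact: sqrt_halfK|exact: hermite_gammaS'..].
Qed.

(** The derivative of [h k], as the ladder operators give it. *)
Definition hermite' k x : R :=
  Num.sqrt (k%:R / 2) * h k.-1 x - Num.sqrt (k.+1%:R / 2) * h k.+1 x.

Lemma hermite'E k x :
  hermite' k x = x * h k x - 2 * Num.sqrt (k.+1%:R / 2) * h k.+1 x.
Proof. by rewrite /hermite' hermite_rec; ring. Qed.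

Lemma is_derive_hermite k x : is_derive x 1 (h k) (hermite' k x).
Proof.
have -> : h k = fun x => gamma k * (hermite_poly R k).[x] * expR (- (x ^+ 2 / 2)).
  by apply/funext => y; rewrite hermiteE.
have dg : is_derive x 1 (fun y : R => expR (- (y ^+ 2 / 2)))
    (- x * expR (- (x ^+ 2 / 2))).
  by apply: is_derive_eq; rewrite /= /GRing.scale/= /cst; field.
apply: is_derive_eq; rewrite /GRing.scale/= /cst hermite'E !hermiteE.
rewrite !hornerS ?mulr0 ?addr0.
have aux (s g0 g1 p p' e : R) : g0 = 2 * s * g1 ->
    g0 * p * (- x * e) + e * (g0 * p') =
    x * (g0 * p * e) - 2 * s * (g1 * (2 * x * p - p') * e).
  by move=> ->; ring.
exact: aux (hermite_gammaS' k).
Qed.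

(** The Hermite equation [h'' = (x ^ 2 - (2 k + 1)) h]. *)
Lemma is_derive_hermite' k x :
  is_derive x 1 (hermite' k) ((x ^+ 2 - (2 * k%:R + 1)) * h k x).
Proof.
have -> : hermite' k = fun x => x * h k x - 2 * Num.sqrt (k.+1%:R / 2) * h k.+1 x.
  by apply/funext => y; rewrite hermite'E.
have d1 := is_derive_hermite k x.
have d2 := is_derive_hermite k.+1 x.
apply: is_derive_eq; rewrite /GRing.scale/= /cst hermite'E.
rewrite /hermite' [k.+1.-1]/= ?mulr0 ?addr0.
have := hermite_rec k.+1 x; rewrite [k.+1.-1]/=.
have := sqrt_halfK k.+1; rewrite -[X in _ = X]natr1.
set s := Num.sqrt _; set s' := Num.sqrt _; set c := k%:R.
set h0 := h k x; set h1 := h _ x; set h2 := h _ x.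
move=> sc hr.
have -> : s * h0 - s' * h2 = 2 * (s * h0) - x * h1 by rewrite hr; ring.
have -> : (x ^+ 2 - (2 * c + 1)) * h0 =
   (x ^+ 2 - (2 * (c + 1) - 1)) * h0 by ring.
by rewrite -sc; ring.
Qed.

End HermiteFunctions.

(** * Size of the Hermite functions, and the kernel of the Hermite sums *)

Section HermiteBounds.
Variable R : realType.
Implicit Types (k n : nat) (x y : R).
Local Notation h := (@hermite_fun R).

(** Sonin's quantity: by the Hermite equation its derivative keeps only the
    term that comes from the coefficient [2 k + 1 - x ^ 2]. *)
Definition sonin k x := (2 * k%:R + 1 - x ^+ 2) * h k x ^+ 2 + hermite' k x ^+ 2.

Lemma is_derive_sonin k x : is_derive x 1 (sonin k) (- (2 * x * h k x ^+ 2)).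
Proof.
have d1 := is_derive_hermite k x; have d2 := is_derive_hermite' k x.
by apply: is_derive_eq; rewrite /GRing.scale/= /cst; ring.
Qed.

Lemma sonin_le k x : sonin k x <= sonin k 0.
Proof.
have cF a b : {within `[a, b], continuous (sonin k)}.
  apply: continuous_subspaceT => z.
  by apply/differentiable_continuous/derivable1_diffP; case: (is_derive_sonin k z).
have dF (a b z : R) : z \in `]a, b[ -> is_derive z 1 (sonin k) (- (2 * z * h k z ^+ 2)).
  by move=> _; exact: is_derive_sonin.
case: (leP 0 x) => [x0|/ltW x0].
- have [c /itvP cx E] := MVT_segment x0 (@dF _ _) (cF _ _).
  have c0 : 0 <= c by rewrite cx.
  have p0 := mulr_ge0 (mulr_ge0 c0 (sqr_ge0 (h k c))) x0.
  by rewrite -subr_le0 E; lra.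
- have [c /itvP cx E] := MVT_segment x0 (@dF _ _) (cF _ _).
  have c0 : c <= 0 by rewrite cx.
  have p0 := mulr_ge0_le0 (sqr_ge0 (h k c)) c0.
  have {}p0 := mulr_le0 p0 x0.
  by rewrite -subr_ge0 E; lra.
Qed.

Lemma hermite_at0_rec k :
  k.+2%:R * h k.+2 0 ^+ 2 = k.+1%:R * h k 0 ^+ 2.
Proof.
have := hermite_rec k.+1 (0 : R); rewrite mul0r [k.+1.-1]/= => /esym/eqP.
move: (h k.+2 0) (h k 0) => u v.
rewrite addr_eq0 => /eqP /(congr1 (fun z => z ^+ 2)).
rewrite sqrrN !exprMn !sqr_sqrtr ?divr_ge0 // => E.
transitivity (2 * (k.+2%:R / 2 * u ^+ 2)); first by field.
by rewrite E; field.
Qed.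

(** Wallis: [h_(2m)(0) ^ 2 = pi ^ (-1/2) 'C(2m, m) / 4 ^ m] is of order
    [m ^ (-1/2)]; the induction advances two indices at a time. *)
Lemma hermite_at0_le k : k.+1%:R * h k 0 ^+ 4 <= 1.
Proof.
suff [] : k.+1%:R * h k 0 ^+ 4 <= 1 /\ k.+2%:R * h k.+1 0 ^+ 4 <= 1 by [].
elim: k => [|k [IH IH']]; split => //.
- have -> : h 0 0 = pi `^ (- 4^-1).
    rewrite hermiteE expr0n /= mul0r oppr0 expR0 hornerC /hermite_gamma mul0r.
    by rewrite oppr0 powRr0 fact0 powR1 !mulr1.
  rewrite mul1r -powR_mulrn ?powR_ge0 // -powRrM.
  rewrite (_ : - 4^-1 * 4%:R = - 1 :> R); last by field.
  by rewrite powRN powRr1 ?pi_ge0 // invf_le1 ?pi_gt0 // (le_trans _ (pi_ge2 _)) // ler1n.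
- rewrite (_ : h 1 0 = 0) ?expr0n ?mulr0 //.
  by rewrite hermiteE hermite_poly1 hornerM hornerX !(mulr0, mul0r).
- have E := hermite_at0_rec k.
  have k2 : 0 < k.+2%:R :> R by [].
  move: (h k.+2 0) (h k 0) E IH => u v E IH.
  have -> : u ^+ 4 = k.+1%:R ^+ 2 / k.+2%:R ^+ 2 * v ^+ 4.
    rewrite (exprM u 2 2) (exprM v 2 2).
    have -> : u ^+ 2 = k.+1%:R * v ^+ 2 / k.+2%:R.
      by rewrite -E mulrAC divff ?mul1r // gt_eqF.
    by rewrite !exprMn exprVn mulrAC.
  rewrite (_ : _ * (_ * _) = (k.+3%:R * k.+1%:R / k.+2%:R ^+ 2)
      * (k.+1%:R * v ^+ 4)); last by field; rewrite gt_eqF.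
  have c1 : k.+3%:R * k.+1%:R / k.+2%:R ^+ 2 <= 1 :> R.
    rewrite ler_pdivrMr ?exprn_gt0 // mul1r -!natrM -natrX ler_nat.
    by rewrite -mulnn; nia.
  rewrite -[leRHS]mulr1; apply: ler_pM => //.
  by rewrite mulr_ge0 // exprn_even_ge0.
Qed.

Lemma hermite_at0_sqr_le k : h k 0 ^+ 2 * Num.sqrt k.+1%:R <= 1.
Proof.
have := hermite_at0_le k; move: (h k 0) => a ha.
have p0 : 0 <= a ^+ 2 * Num.sqrt k.+1%:R by apply: mulr_ge0; rewrite ?sqr_ge0.
rewrite -(@expr_le1 _ 2) //.
by rewrite exprMn sqr_sqrtr // -exprM mulrC.
Qed.

(** Sonin's comparison of [h] with its size at the origin, which is valid up
    to a fixed fraction of the turning point [sqrt (2 k + 1)]. *)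
Lemma hermite_sqr_le k x : x ^+ 2 <= k%:R ->
  h k x ^+ 2 * Num.sqrt k.+1%:R <= 4.
Proof.
move=> xk.
have := hermite_at0_sqr_le k; have := hermite_at0_sqr_le k.+1.
have := sonin_le k x.
rewrite /sonin [X in _ <= _ + X ^+ 2]hermite'E [0 ^+ 2]expr0n subr0 mul0r sub0r.
rewrite sqrrN.
have t12 : Num.sqrt k.+1%:R <= Num.sqrt k.+2%:R :> R.
  by rewrite ler_sqrt // ler_nat.
have t0 : 0 < Num.sqrt k.+1%:R :> R by rewrite sqrtr_gt0.
have tt : Num.sqrt k.+1%:R ^+ 2 = k.+1%:R :> R by rewrite sqr_sqrtr.
have ss : Num.sqrt (k.+1%:R / 2) ^+ 2 = k.+1%:R / 2 :> R.
  by rewrite sqr_sqrtr ?divr_ge0.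
move: (Num.sqrt (_ / 2)) (Num.sqrt k.+1%:R) (Num.sqrt k.+2%:R) t12 t0 tt ss.
move: (hermite' k x) (h k x) (h k 0) (h k.+1 0) => d H a b s t t2 t12 t0 tt ss.
rewrite 2!exprMn ss.
have := sqr_ge0 d; have := sqr_ge0 H; have := sqr_ge0 a; have := sqr_ge0 b.
move: (d ^+ 2) (H ^+ 2) (a ^+ 2) (b ^+ 2) => {d H}d H {}a {}b b0 a0 H0 d0.
rewrite -natr1 in tt *; have k0 : 0 <= k%:R :> R by [].
move: (k%:R) (x ^+ 2) xk tt k0 => {k x ss} k x xk tt k0 F bt at1.
have bt1 : b * t <= 1 by apply: le_trans bt; rewrite ler_wpM2l.
have t2H : t ^+ 2 * H <= 2 * t ^+ 2 * (a + b).
  by rewrite tt; nra.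
rewrite -(@ler_pM2l _ (t ^+ 2)) ?exprn_gt0 //.
have := ler_wpM2r (ltW t0) t2H.
have t20 : 0 <= t ^+ 2 by exact: sqr_ge0.
have := ler_wpM2l t20 bt1; have := ler_wpM2l t20 at1.
by lra.
Qed.

(** The common normalisation under which the two Hermite functions that enter
    the Christoffel-Darboux formula are bounded uniformly in [n]. *)
Definition cd_scale n : R := Num.sqrt (Num.sqrt (n.+1%:R / 2)).

Lemma cd_scale_bound n k x : (n <= k <= n.+1)%N -> x ^+ 2 <= n%:R ->
  `|cd_scale n * h k x| <= 2.
Proof.
move=> /andP[nk kn] xn.
have xk : x ^+ 2 <= k%:R by rewrite (le_trans xn) // ler_nat.
rewrite -(@ler_pXn2r _ 2) ?nnegrE // -normrX ger0_norm ?sqr_ge0 //.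
rewrite exprMn sqr_sqrtr ?sqrtr_ge0 // mulrC.
rewrite (_ : 2 ^+ 2 = 4) -?natrX //.
apply: le_trans (hermite_sqr_le xk).
rewrite ler_wpM2l ?sqr_ge0 // ler_sqrt // ler_pdivrMr //.
by rewrite mulr_natr -mulrnA ler_nat; lia.
Qed.

Definition hermite_kernel n x y : R := \sum_(0 <= k < n.+1) h k x * h k y.

(** The three-term recurrence makes the sum [(x - y) h_k (x) h_k (y)]
    telescope. *)
Lemma christoffel_darboux n x y :
  (x - y) * hermite_kernel n x y =
  cd_scale n * h n.+1 x * (cd_scale n * h n y) -
  cd_scale n * h n x * (cd_scale n * h n.+1 y).
Proof.
transitivity (Num.sqrt (n.+1%:R / 2) * (h n.+1 x * h n y - h n x * h n.+1 y)).
  rewrite /hermite_kernel; elim: n => [|n IH].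
    rewrite big_nat1.
    have := hermite_rec 0 x; have := hermite_rec 0 y.
    rewrite mul0r sqrtr0 !mul0r !addr0.
    move: (Num.sqrt _) (h 0 x) (h 0 y) (h 1 x) (h 1 y) => s a b c d e1 e2.
    transitivity (x * a * b - a * (y * b)); first by ring.
    by rewrite e1 e2; ring.
  rewrite big_nat_recr //= mulrDr IH.
  have := hermite_rec n.+1 x; have := hermite_rec n.+1 y; rewrite [n.+1.-1]/=.
  move: (Num.sqrt _) (Num.sqrt _) (h n.+1 x) (h n.+1 y) => s t a b.
  move: (h n.+2 x) (h n.+2 y) (h n x) (h n y) => c d u v e1 e2.
  transitivity (s * (a * v - u * b) + (x * a * b - a * (y * b))); first by ring.
  by rewrite e1 e2; ring.
rewrite -{1}(@sqr_sqrtr _ (Num.sqrt _)) ?sqrtr_ge0 // -/(cd_scale n).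
by ring.
Qed.

End HermiteBounds.

(** * Boole's lemma on rational Cauchy transforms *)

Section Boole.
Variable R : realType.
Implicit Types (s : seq R) (m : R -> R) (l x t : R).

(** The Hilbert transform, up to a constant, of the measure with atoms [t] in
    [s] and masses [m t]. *)
Definition cauchy_sum s m x := \sum_(t <- s) m t / (x - t).

Lemma seq_max_exists s : s != [::] ->
  exists2 t, t \in s & forall x, x \in s -> x <= t.
Proof.
elim: s => // a s IH _; case: (eqVneq s [::]) => [->|/IH[t ts tmax]].
  by exists a; rewrite ?mem_head // => x; rewrite inE => /eqP ->.
case: (leP a t) => [at_|/ltW ta].
  exists t; rewrite ?inE ?ts ?orbT // => x; rewrite inE => /orP[/eqP->//|].
  exact: tmax.
exists a; rewrite ?mem_head // => x; rewrite inE => /orP[/eqP->//|/tmax xt].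
exact: le_trans ta.
Qed.

Section Positive.
Variables (s : seq R) (m : R -> R) (l : R).
Hypotheses (s_uniq : uniq s) (m_gt0 : forall t, t \in s -> 0 < m t) (l_gt0 : 0 < l).

Let others t : {poly R} := \prod_(t' <- s | t' != t) ('X - t'%:P).

(* The numerator of [l - cauchy_sum s m]. *)
Let P : {poly R} := l *: \prod_(t <- s) ('X - t%:P) - \sum_(t <- s) m t *: others t.

Let others_eval t x : (others t).[x] = \prod_(t' <- s | t' != t) (x - t').
Proof. by rewrite horner_prod; apply: eq_bigr => t' _; rewrite hornerXsubC. Qed.

Let P_eval x : x \notin s ->
  P.[x] = (l - cauchy_sum s m x) * \prod_(t <- s) (x - t).
Proof.
move=> xs; rewrite hornerD hornerN hornerZ horner_prod horner_sum mulrBl.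
congr (l * _ - _); first by apply: eq_bigr => t _; rewrite hornerXsubC.
rewrite mulr_suml; apply: eq_big_seq => t ts; rewrite hornerZ others_eval.
rewrite [in RHS](bigD1_seq t) //= mulrA divfK // subr_eq0.
by apply: contraNneq xs => ->.
Qed.

Let P_atom t : t \in s -> P.[t] = - (m t * \prod_(t' <- s | t' != t) (t - t')).
Proof.
move=> ts; rewrite hornerD hornerN hornerZ.
have -> : (\prod_(t' <- s) ('X - t'%:P)).[t] = 0.
  by rewrite horner_prod (bigD1_seq t) //= hornerXsubC subrr mul0r.
rewrite mulr0 sub0r horner_sum (bigD1_seq t) //= hornerZ others_eval.
rewrite [X in _ + X]big1_seq ?addr0 // => u /andP[ut us].
rewrite hornerZ others_eval -big_filter (bigD1_seq t) ?filter_uniq //=.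
  by rewrite subrr mul0r mulr0.
by rewrite mem_filter ts eq_sym ut.
Qed.

Let ivt (p : {poly R}) a b : a < b -> p.[a] * p.[b] < 0 ->
  exists2 x, a < x < b & root p x.
Proof.
move=> ab pab.
have pa0 : p.[a] != 0 by apply: contraTneq pab => ->; rewrite mul0r ltxx.
have pb0 : p.[b] != 0 by apply: contraTneq pab => ->; rewrite mulr0 ltxx.
have [x /andP[ax xb] px] : exists2 x, a <= x <= b & root p x.
  case: (ltP p.[a] 0) => pa.
    apply: poly_ivt (ltW ab) _; rewrite (ltW pa) /=.
    by rewrite leNgt -(nmulr_rgt0 p.[b] pa) -leNgt ltW.
  have {}pa : 0 < p.[a] by rewrite lt_def pa0.
  have [] := @poly_ivt _ (- p) a b (ltW ab); last by move=> x ?; rewrite rootN; exists x.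
  by rewrite !hornerN oppr_le0 oppr_ge0 (ltW pa) -(pmulr_rle0 _ pa) ltW.
exists x => //; rewrite !lt_neqAle ax xb !andbT.
apply/andP; split.
  by apply: contraTneq px => <-; rewrite rootE.
by apply: contraTneq px => ->; rewrite rootE.
Qed.

Let cauchy_sum_le0 x : (forall t, t \in s -> x < t) -> cauchy_sum s m x <= 0.
Proof.
move=> xs; rewrite /cauchy_sum big_seq; apply: sumr_le0 => t ts.
by rewrite mulr_ge0_le0 ?(ltW (m_gt0 ts)) // invr_le0 subr_le0 ltW ?xs.
Qed.

(* [cauchy_sum s m] falls from plus infinity to minus infinity, or to [0]
   after the last atom, and so takes the value [l] in the gap to the right of
   each atom; [P] changes sign there. *)
Let root_right t : t \in s ->
  exists x, [/\ t < x, root P x & forall t', t' \in s -> t < t' -> x < t'].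
Proof.
move=> ts; case: (eqVneq [seq - u | u <- s & t < u] [::]) => [nil|].
  have max_t t' : t' \in s -> t' <= t.
    move=> t's; rewrite leNgt; apply/negP => tt'.
    have : - t' \in [seq - u | u <- s & t < u].
      by apply/mapP; exists t'; rewrite // mem_filter tt'.
    by rewrite nil.
  pose M := \sum_(u <- s) m u.
  have M0 : 0 <= M by rewrite /M big_seq sumr_ge0 // => u /m_gt0/ltW.
  pose X := t + (M / l + 1).
  have d0 : 0 < M / l + 1 by rewrite ltr_wpDl // divr_ge0 // ltW.
  have tX : t < X by rewrite ltrDl.
  have Xs : X \notin s by apply/negP => /max_t; rewrite leNgt tX.
  have PX : 0 < P.[X].
    rewrite P_eval // mulr_gt0 //; last first.
      by rewrite big_seq prodr_gt0 // => u us; rewrite subr_gt0 (le_lt_trans (max_t u us)).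
    rewrite subr_gt0; apply: (@le_lt_trans _ _ (M / (M / l + 1))).
      rewrite /cauchy_sum mulr_suml !big_seq; apply: ler_sum => u us.
      rewrite ler_wpM2l ?(ltW (m_gt0 us)) // lef_pV2 ?posrE //; last first.
        by rewrite subr_gt0 (le_lt_trans (max_t u us)).
      by rewrite /X; have := max_t u us; lra.
    rewrite ltr_pdivrMr // mulrDr mulr1 mulrCA divff ?gt_eqF // mulr1.
    by rewrite ltrDl.
  have Pt : P.[t] < 0.
    rewrite P_atom // oppr_lt0 mulr_gt0 ?m_gt0 // big_seq_cond prodr_gt0 // => u /andP[us ut].
    by rewrite subr_gt0 lt_neqAle ut max_t.
  have PtX : P.[t] * P.[X] < 0 by rewrite nmulr_rlt0.
  have [x /andP[tx _] px] := ivt tX PtX.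
  by exists x; split => // t' /max_t; rewrite leNgt => /negbTE ->.
move=> /seq_max_exists[_ /mapP[t2 + ->] t2min].
rewrite mem_filter => /andP[tt2 t2s].
have {}t2min u : u \in s -> t < u -> t2 <= u.
  move=> us tu; rewrite -lerN2; apply: t2min; apply/mapP.
  by exists u; rewrite // mem_filter tu.
have tNt2 : t2 != t by rewrite gt_eqF.
have Ptt2 : P.[t] * P.[t2] < 0.
  rewrite !P_atom // mulrNN mulrACA pmulr_rlt0 ?mulr_gt0 ?m_gt0 //.
  rewrite -big_filter (bigD1_seq t2) ?filter_uniq ?mem_filter ?tNt2 //=.
  rewrite -[X in _ * X]big_filter (bigD1_seq t) ?filter_uniq ?mem_filter ?(eq_sym t) ?tNt2 //=.
  rewrite mulrACA nmulr_rlt0; last first.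
    by rewrite nmulr_rlt0 ?subr_gt0 // subr_lt0.
  rewrite !big_filter_cond [X in _ * X](eq_bigl (fun u => (u != t) && (u != t2))); last first.
    by move=> u; rewrite andbC.
  rewrite -big_split /= big_seq_cond prodr_gt0 // => u /and3P[us ut ut2].
  case: (ltP u t) => [lt_ut|le_tu].
    by rewrite mulr_gt0 // subr_gt0 // (lt_trans lt_ut).
  have lt_tu : t < u by rewrite lt_neqAle eq_sym ut.
  have lt_t2u : t2 < u by rewrite lt_neqAle eq_sym ut2 t2min.
  by rewrite nmulr_rgt0 subr_lt0.
have [x /andP[tx xt2] px] := ivt tt2 Ptt2.
exists x; split => // u us tu; exact: lt_le_trans (t2min _ us tu).
Qed.

(* The two leading coefficients of [P], from which Vieta reads off the sum of
   the roots. *)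
Let P_coef : [/\ size P = (size s).+1, lead_coef P = l &
  s != [::] -> P`_(size s).-1 = - (l * \sum_(t <- s) t + \sum_(t <- s) m t)].
Proof.
have size_others t : t \in s -> size (others t) = size s.
  move=> ts; rewrite /others -big_filter size_prod_XsubC -(rem_filter t s_uniq).
  by rewrite size_rem // prednK //; case: (s) ts.
have size_sum : (size (\sum_(t <- s) m t *: others t)%R <= size s)%N.
  rewrite big_seq; apply: (big_ind (fun p : {poly R} => (size p <= size s)%N)).
  - by rewrite size_poly0.
  - by move=> p q hp hq; rewrite (leq_trans (size_polyD _ _)) // geq_max hp.
  - by move=> t ts; rewrite (leq_trans (size_scale_leq _ _)) // size_others.
have size_main : size (l *: \prod_(t <- s) ('X - t%:P)) = (size s).+1.
  by rewrite size_scale ?gt_eqF // size_prod_XsubC.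
have size_lt : (size (- (\sum_(t <- s) m t *: others t))%R < size (l *: \prod_(t <- s) ('X - t%:P)))%N.
  by rewrite size_main size_polyN ltnS.
split; first by rewrite size_polyDl // size_main.
  rewrite lead_coefDl // lead_coefZ (monicP _) ?mulr1 //.
  exact: monic_prod_XsubC.
move=> s0; rewrite coefB coefZ coefPn_prod_XsubC ?size_eq0 // coef_sum opprD mulrN.
congr (_ - _); apply: eq_big_seq => t ts; rewrite coefZ.
have mo : others t \is monic by exact: monic_prod_XsubC.
by rewrite -[X in _`_X.-1](size_others t ts) -/(lead_coef _) (monicP mo) mulr1.
Qed.

(** Boole: the superlevel set of a positive Cauchy sum is the union of the
    intervals from each atom to the next root, and by Vieta their lengths add
    up to the total mass divided by the level. *)
Lemma boole_cover : exists2 r : R -> R,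
  (forall t, t \in s -> t <= r t) /\ \sum_(t <- s) (r t - t) = \sum_(t <- s) m t / l &
  forall x, x \notin s -> l < cauchy_sum s m x ->
    exists2 t, t \in s & t <= x <= r t.
Proof.
have /choice[r rP] : forall t, exists x, t \in s ->
    [/\ t < x, root P x & forall t', t' \in s -> t < t' -> x < t'].
  move=> t; case: (boolP (t \in s)) => [/root_right[x xP]|_]; last by exists 0.
  by exists x.
have rNs t : t \in s -> r t \notin s.
  move=> /rP[tr _ rs]; apply/negP => rts.
  by have := rs _ rts tr; rewrite ltxx.
have r_inj t t' : t \in s -> t' \in s -> t < t' -> r t < r t'.
  by move=> ts t's tt'; have [_ _ /(_ _ t's tt')] := rP _ ts; have [] := rP _ t's; lra.
have r_root t : t \in s -> cauchy_sum s m (r t) = l.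
  move=> ts; have rs := rNs _ ts; have [_ + _] := rP t ts.
  rewrite rootE P_eval // mulf_eq0 => /orP[|/eqP p0].
    by rewrite subr_eq0 => /eqP.
  suff : \prod_(t' <- s) (r t - t') != 0 by rewrite p0 eqxx.
  rewrite prodf_seq_neq0; apply/allP => u us /=; rewrite subr_eq0.
  by apply: contraNneq rs => ->.
exists r; first split.
- by move=> t /rP[/ltW].
- case: (eqVneq s [::]) => [->|s0]; first by rewrite !big_nil.
  have [sP lP cP] := P_coef.
  have us : uniq_roots (map r s).
    rewrite uniq_rootsE map_inj_in_uniq // => t t' ts t's rr.
    by case: (ltgtP t t') => // [/(r_inj _ _ ts t's)|/(r_inj _ _ t's ts)]; rewrite rr ltxx.
  have rs : all (root P) (map r s) by apply/allP => _ /mapP[t /rP[_ rt _] ->].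
  have sz : size P = (size (map r s)).+1 by rewrite size_map.
  have PE := all_roots_prod_XsubC sz rs us.
  rewrite lP in PE.
  have := cP s0; rewrite {1}PE coefZ -[X in _`_X.-1](size_map r).
  rewrite coefPn_prod_XsubC ?size_map ?size_eq0 // big_map mulrN => /oppr_inj rE.
  rewrite sumrB -mulr_suml; apply: (@mulfI _ l); first by rewrite gt_eqF.
  by rewrite mulrBr rE mulrCA divff ?gt_eqF // mulr1; ring.
- move=> x xs lgx.
  have [nil|] := eqVneq [seq u <- s | u < x] [::].
    suff : cauchy_sum s m x <= 0 by rewrite leNgt (lt_trans l_gt0 lgx).
    apply: cauchy_sum_le0 => t ts.
    have xt : t != x by apply: contraNneq xs => <-.
    rewrite lt_neqAle eq_sym xt leNgt; apply/negP => tx.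
    have : t \in [seq u <- s | u < x] by rewrite mem_filter tx.
    by rewrite nil.
  move=> /seq_max_exists[t]; rewrite mem_filter => /andP[tx ts] tmax.
  exists t => //; rewrite (ltW tx) leNgt; apply/negP => rx.
  suff : cauchy_sum s m x <= l by rewrite leNgt lgx.
  rewrite -(r_root _ ts) /cauchy_sum !big_seq; apply: ler_sum => u us.
  rewrite ler_wpM2l ?(ltW (m_gt0 us)) //.
  have ux : u != x by apply: contraNneq xs => <-.
  have [tr _ rt] := rP _ ts.
  case: (ltP u x) => [lt_ux|le_xu].
    have ut : u <= t by rewrite tmax // mem_filter lt_ux.
    by rewrite lef_pV2 ?posrE; lra.
  have {ux}le_xu : x < u by rewrite lt_neqAle eq_sym ux.
  by rewrite lef_nV2 ?negrE; lra.
Qed.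

End Positive.

Local Notation mu := (@lebesgue_measure R).

(** By reflection [x |-> - x]. *)
Lemma boole_cover_neg s m l : uniq s -> (forall t, t \in s -> 0 < m t) -> 0 < l ->
  exists2 r : R -> R,
    (forall t, t \in s -> r t <= t) /\ \sum_(t <- s) (t - r t) = \sum_(t <- s) m t / l &
  forall x, x \notin s -> cauchy_sum s m x < - l ->
    exists2 t, t \in s & r t <= x <= t.
Proof.
move=> us m0 l0; have us' : uniq (map -%R s) by rewrite map_inj_uniq //; exact: oppr_inj.
have m0' t : t \in map -%R s -> 0 < m (- t).
  by move=> /mapP[u us_ ->]; rewrite opprK m0.
have [r [rt rs] rc] := boole_cover us' m0' l0.
exists (fun t => - r (- t)); first split.
- by move=> t ts; rewrite lerNl rt // map_f.
- move: rs; rewrite !big_map => rs.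
  under eq_bigr do rewrite opprK addrC -[X in _ + X]opprK.
  rewrite rs; apply: eq_bigr => t _; by rewrite opprK.
- move=> x xs gx.
  have xs' : - x \notin map -%R s by rewrite mem_map //; exact: oppr_inj.
  have [|t /mapP[u us_ ->] uxr] := rc _ xs'.
    rewrite ltrNr in gx; apply: lt_le_trans gx _.
    rewrite /cauchy_sum big_map -sumrN le_eqVlt; apply/orP; left; apply/eqP.
    by apply: eq_bigr => t _; rewrite opprK (addrC (- x)) -(opprB x t) invrN mulrN.
  by exists u => //; move: uxr; lra.
Qed.

Lemma measure_cover_le (c : seq (R * R)) (E : set R) :
  measurable E -> (forall ab, ab \in c -> ab.1 <= ab.2) ->
  (forall x, E x -> exists2 ab, ab \in c & ab.1 <= x <= ab.2) ->
  (mu E <= (\sum_(ab <- c) (ab.2 - ab.1))%:E)%E.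
Proof.
move=> mE le_c cover.
apply: (@le_trans _ _ (mu (\big[setU/set0]_(ab <- c) `[ab.1, ab.2]%classic))).
  apply: le_measure; rewrite ?inE //; first by apply: bigsetU_measurable.
  move=> x /cover[ab abc xab]; rewrite -bigcup_seq; exists ab => //=; rewrite ?in_itv //.
elim: c le_c {cover} => [|ab c IH] le_c; first by rewrite !big_nil measure0.
rewrite !big_cons EFinD.
apply: le_trans (measureU2 _ _ _) _; [by []|by apply: bigsetU_measurable|].
apply: leeD; last by apply: IH => u uc; rewrite le_c // inE uc orbT.
have le_ab : ab.1 <= ab.2 by rewrite le_c // mem_head.
by rewrite [leLHS]lebesgue_measure_itv /= lte_fin; case: ltP => // _; rewrite lee_fin subr_ge0.
Qed.

(** Where the sum of the parts of positive and of negative mass exceeds [l] in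
    absolute value, one of them exceeds [l / 2]: four applications of Boole's
    lemma at height [l / 2], each of them costing at most the total mass over
    [l / 2]. The atoms themselves are covered by degenerate intervals. *)
Lemma cauchy_sum_weak11 s m l (E : set R) : uniq s -> 0 < l -> measurable E ->
  (forall x, E x -> x \notin s -> l < `|cauchy_sum s m x|) ->
  (mu E <= (4 * (\sum_(t <- s) `|m t|) / l)%:E)%E.
Proof.
move=> us l0 mE El.
pose sp := [seq t <- s | 0 < m t]; pose sn := [seq t <- s | m t < 0].
have l20 : 0 < l / 2 by rewrite divr_gt0.
have usp : uniq sp by rewrite filter_uniq.
have usn : uniq sn by rewrite filter_uniq.
have mp t : t \in sp -> 0 < m t by rewrite mem_filter => /andP[].
have mn t : t \in sn -> 0 < - m t by rewrite mem_filter oppr_gt0 => /andP[].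
have [r1 [r1t r1s] r1c] := boole_cover usp mp l20.
have [r2 [r2t r2s] r2c] := boole_cover_neg usp mp l20.
have [r3 [r3t r3s] r3c] := boole_cover usn mn l20.
have [r4 [r4t r4s] r4c] := boole_cover_neg usn mn l20.
pose c := [seq (t, r1 t) | t <- sp] ++ [seq (r2 t, t) | t <- sp] ++
  [seq (t, r3 t) | t <- sn] ++ [seq (r4 t, t) | t <- sn] ++ [seq (t, t) | t <- s].
have sumE (F : R -> R) : (forall t, m t = 0 -> F t = 0) ->
    \sum_(t <- s) F t = \sum_(t <- sp) F t + \sum_(t <- sn) F t.
  move=> F0; rewrite !big_filter [LHS](bigID (fun t => 0 < m t)) /=; congr (_ + _).
  rewrite [LHS](bigID (fun t => m t < 0)) /= [X in _ + X]big1 ?addr0.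
    by apply: eq_bigl => t; case: ltgtP.
  by move=> t; case: (ltgtP 0 (m t)) => //= /esym/F0.
have gE x : cauchy_sum s m x = cauchy_sum sp m x - cauchy_sum sn (\- m) x.
  rewrite /cauchy_sum sumE; last by move=> t ->; rewrite mul0r.
  by congr (_ + _); rewrite -sumrN; apply: eq_bigr => t _; rewrite /= mulNr opprK.
apply: (@le_trans _ _ (\sum_(ab <- c) (ab.2 - ab.1))%:E).
  apply: measure_cover_le => //.
    move=> ab; rewrite !mem_cat => /or4P[||| /orP[]] /mapP[t ts ->] /=;
      by [exact: r1t|exact: r2t|exact: r3t|exact: r4t|].
  move=> x Ex; case: (boolP (x \in s)) => [xs|xs].
    exists (x, x); rewrite /= ?lexx //.
    by rewrite !mem_cat (map_f (fun t => (t, t))) ?orbT.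
  have xsp : x \notin sp by rewrite mem_filter (negbTE xs) andbF.
  have xsn : x \notin sn by rewrite mem_filter (negbTE xs) andbF.
  have := El _ Ex xs; rewrite gE.
  set u := cauchy_sum sp m x; set v := cauchy_sum sn _ x => luv.
  have : [\/ l / 2 < u, u < - (l / 2), l / 2 < v | v < - (l / 2)].
    case: (ltP (l / 2) u) => hu1; first by constructor 1.
    case: (ltP u (- (l / 2))) => hu2; first by constructor 2.
    case: (ltP (l / 2) v) => hv1; first by constructor 3.
    case: (ltP v (- (l / 2))) => hv2; first by constructor 4.
    by exfalso; move: luv; rewrite ltNge ler_norml; lra.
  case=> [/(r1c _ xsp)|/(r2c _ xsp)|/(r3c _ xsn)|/(r4c _ xsn)] [t ts tx].
  - by exists (t, r1 t) => //; rewrite !mem_cat (map_f (fun t => (t, r1 t))).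
  - by exists (r2 t, t) => //; rewrite !mem_cat (map_f (fun t => (r2 t, t))) ?orbT.
  - by exists (t, r3 t) => //; rewrite !mem_cat (map_f (fun t => (t, r3 t))) ?orbT.
  - by exists (r4 t, t) => //; rewrite !mem_cat (map_f (fun t => (r4 t, t))) ?orbT.
rewrite lee_fin !big_cat /= !big_map /= r1s r2s r3s r4s.
have -> : \sum_(t <- s) (t - t) = 0 by apply: big1 => t _; rewrite subrr.
rewrite addr0.
rewrite -!mulr_suml sumE; last by move=> t ->; rewrite normr0.
have -> : \sum_(t <- sp) `|m t| = \sum_(t <- sp) m t.
  by apply: eq_big_seq => t /mp/ltW/ger0_norm.
have -> : \sum_(t <- sn) `|m t| = \sum_(t <- sn) - m t.
  by apply: eq_big_seq => t /mn/ltW mt; rewrite -normrN ger0_norm.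
by rewrite le_eqVlt; apply/orP; left; apply/eqP; field; rewrite gt_eqF.
Qed.

End Boole.

(** * Integration of real-valued functions on the line *)

(** Locked, so that rewriting does not look through the integral. *)
HB.lock Definition lebint (R : realType) (f : R -> R) : R :=
  \int[@lebesgue_measure R]_x f x.

#[global] Instance lebesgue_ae_filter (R : realType) :
  Filter (almost_everywhere (@lebesgue_measure R)) := ae_filter_ringOfSetsType _.

Section Integration.
Variable R : realType.
Local Notation mu := (@lebesgue_measure R).
Implicit Types (f g : R -> R).

Definition meas f := measurable_fun [set: R] f.
Definition L1 f := mu.-integrable [set: R] (EFin \o f).

Lemma L1_meas f : L1 f -> meas f.
Proof. by move=> /measurable_int /measurable_EFinP. Qed.

Lemma L1_le f g : meas f -> (forall x, `|f x| <= g x) -> L1 g -> L1 f.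
Proof.
move=> mf fg; apply: le_integrable => //; first exact/measurable_EFinP.
by move=> x _ /=; rewrite lee_fin (le_trans (fg x)) // ler_norm.
Qed.

Lemma L1D f g : L1 f -> L1 g -> L1 (fun x => f x + g x).
Proof. by move=> Lf Lg; have := integrableD measurableT Lf Lg; apply: eq_integrable. Qed.

Lemma L1Z a f : L1 f -> L1 (fun x => a * f x).
Proof. by move=> Lf; have := integrableZl measurableT a Lf; apply: eq_integrable. Qed.

Lemma L1N f : L1 f -> L1 (fun x => - f x).
Proof.
move=> /(L1Z (-1)); congr L1; apply/funext => x; exact: mulN1r.
Qed.

Lemma L1B f g : L1 f -> L1 g -> L1 (fun x => f x - g x).
Proof. by move=> Lf /L1N; exact: L1D. Qed.

Lemma L1_0 : L1 (fun=> 0).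
Proof. by have := integrable0 mu [set: R]; apply: eq_integrable. Qed.

Lemma L1_sum I (s : seq I) (F : I -> R -> R) :
  (forall i, L1 (F i)) -> L1 (fun x => \sum_(i <- s) F i x).
Proof.
move=> LF; elim: s => [|i s IH].
  by rewrite (_ : (fun _ => _) = fun=> 0) ?L1_0 //; apply/funext => x; rewrite big_nil.
rewrite (_ : (fun _ => _) = fun x => F i x + \sum_(j <- s) F j x); first exact: L1D.
by apply/funext => x; rewrite big_cons.
Qed.

Lemma L1_norm f : L1 f -> L1 (fun x => `|f x|).
Proof. by move=> Lf; apply: integrable_norm. Qed.

Lemma lebintD f g : L1 f -> L1 g ->
  lebint (fun x => f x + g x) = lebint f + lebint g.
Proof. by rewrite lebint.unlock; exact: RintegralD. Qed.

Lemma lebintB f g : L1 f -> L1 g ->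
  lebint (fun x => f x - g x) = lebint f - lebint g.
Proof. by rewrite lebint.unlock; exact: RintegralB. Qed.

Lemma lebintZ a f : L1 f -> lebint (fun x => a * f x) = a * lebint f.
Proof. by move=> Lf; rewrite lebint.unlock; exact: RintegralZl. Qed.

Lemma lebint0 : lebint (fun=> 0 : R) = 0.
Proof. by rewrite lebint.unlock Rintegral_cst // mul0r. Qed.

Lemma lebint_sum I (s : seq I) (F : I -> R -> R) : (forall i, L1 (F i)) ->
  lebint (fun x => \sum_(i <- s) F i x) = \sum_(i <- s) lebint (F i).
Proof.
move=> LF; elim: s => [|i s IH].
  rewrite big_nil -[RHS]lebint0; congr lebint.
  by apply/funext => x; rewrite big_nil.
rewrite big_cons -IH -lebintD //; last exact: L1_sum.
by congr lebint; apply/funext => x; rewrite big_cons.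
Qed.

Lemma lebint_le f g : L1 f -> L1 g -> (forall x, f x <= g x) ->
  lebint f <= lebint g.
Proof. by move=> Lf Lg fg; rewrite lebint.unlock; apply: le_Rintegral. Qed.

Lemma lebint_ge0 f : (forall x, 0 <= f x) -> 0 <= lebint f.
Proof. by move=> f0; rewrite lebint.unlock; apply: Rintegral_ge0. Qed.

Lemma lebint_norm_le f : L1 f -> `|lebint f| <= lebint (fun x => `|f x|).
Proof. by move=> Lf; rewrite lebint.unlock; apply: le_normr_Rintegral. Qed.

Lemma lebint_ae_eq f g : meas f -> meas g -> {ae mu, forall x, f x = g x} ->
  lebint f = lebint g.
Proof.
move=> mf mg fg; rewrite lebint.unlock /Rintegral; congr fine.
apply: ae_eq_integral => //; [exact/measurable_EFinP|exact/measurable_EFinP|].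
by move: fg; apply: filterS => x ->.
Qed.

Lemma EFin_lebint f : L1 f -> (\int[mu]_x (f x)%:E)%E = (lebint f)%:E.
Proof. by move=> Lf; rewrite lebint.unlock /Rintegral fineK //; exact: integrable_fin_num. Qed.

Lemma lebint_dominated (f_ : nat -> R -> R) f g :
  (forall n, meas (f_ n)) -> meas f -> L1 g ->
  (forall n x, `|f_ n x| <= g x) ->
  {ae mu, forall x, f_ n x @[n --> \oo] --> f x} ->
  lebint (f_ n) @[n --> \oo] --> lebint f.
Proof.
move=> mf_ mf Lg fg cvg.
have mF_ n : measurable_fun setT (EFin \o f_ n) by apply/measurable_EFinP; exact: mf_.
have mF : measurable_fun setT (EFin \o f) by exact/measurable_EFinP.
have cF : {ae mu, forall x, setT x -> (EFin \o f_ n) x @[n --> \oo] --> (EFin \o f) x}.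
  by move: cvg; apply: filterS => x hx _; apply: cvg_EFin => //; exact: nearW.
have FG : {ae mu, forall x n, setT x -> (`|(EFin \o f_ n) x| <= (EFin \o g) x)%E}.
  by apply: aeW => x n _ /=; rewrite lee_fin.
have [Lf _ Hcvg] := @dominated_convergence _ _ _ mu setT measurableT _ _ _ mF_ mF cF Lg FG.
have Lf_ n : L1 (f_ n) by exact: L1_le Lg.
move: Hcvg; rewrite /= EFin_lebint // => Hcvg.
apply: (fine_cvg (f := fun n => (lebint (f_ n))%:E)).
by move: Hcvg; under eq_fun do rewrite EFin_lebint //.
Qed.

Lemma measD f g : meas f -> meas g -> meas (fun x => f x + g x).
Proof. exact: measurable_funD. Qed.
Lemma measM f g : meas f -> meas g -> meas (fun x => f x * g x).
Proof. exact: measurable_funM. Qed.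
Lemma measB f g : meas f -> meas g -> meas (fun x => f x - g x).
Proof. exact: measurable_funB. Qed.
Lemma measX f n : meas f -> meas (fun x => f x ^+ n).
Proof. exact: measurable_funX. Qed.
Lemma meas_norm f : meas f -> meas (fun x => `|f x|).
Proof. by move=> mf; exact: measurableT_comp. Qed.
Lemma meas_cst (a : R) : meas (fun=> a).
Proof. exact: measurable_cst. Qed.
Lemma meas_continuous f : continuous f -> meas f.
Proof. exact: continuous_measurable_fun. Qed.
Lemma meas_indic (E : set R) : measurable E -> meas \1_E.
Proof. by move=> mE; exact: measurable_indic. Qed.
Lemma meas_sum I (s : seq I) (F : I -> R -> R) :
  (forall i, meas (F i)) -> meas (fun x => \sum_(i <- s) F i x).
Proof. by move=> mF; exact: measurable_sum. Qed.

End Integration.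

(** * Functions with Gaussian decay; orthonormality of the Hermite functions *)

Section GaussianDecay.
Variable R : realType.
Local Notation mu := (@lebesgue_measure R).
Local Notation h := (@hermite_fun R).
Implicit Types (f g : R -> R) (p q : {poly R}) (x a C : R).

(** Degree by degree, halving [a]: each factor [x] is absorbed by
    [exp (a / 2 * x ^ 2)]. *)
Lemma poly_le_expR p a : 0 < a -> exists2 C, 0 <= C &
  forall x, `|p.[x]| <= C * expR (a * x ^+ 2).
Proof.
elim/poly_ind: p a => [|p c IH] a a0.
  by exists 0 => // x; rewrite horner0 normr0 mul0r.
have a20 : 0 < a / 2 by rewrite divr_gt0.
have [C C0 HC] := IH _ a20.
exists (C * (1 + (a / 2)^-1) + `|c|).
  by rewrite addr_ge0 // mulr_ge0 // addr_ge0 // invr_ge0 ltW.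
move=> x; rewrite hornerMXaddC.
apply: le_trans (ler_normD _ _) _; rewrite mulrDl; apply: lerD; last first.
  by rewrite ler_peMr // -expR0 ler_expR mulr_ge0 ?sqr_ge0 // ltW.
have -> : expR (a * x ^+ 2) = expR (a / 2 * x ^+ 2) * expR (a / 2 * x ^+ 2).
  by rewrite -expRD; congr expR; field.
rewrite normrM [leRHS](_ : _ = C * expR (a / 2 * x ^+ 2) *
  ((1 + (a / 2)^-1) * expR (a / 2 * x ^+ 2))); last by ring.
apply: ler_pM => //.
have x1 : `|x| <= 1 + x ^+ 2 by rewrite -real_normK ?num_real //; nra.
have e1 := expR_ge1Dx (a / 2 * x ^+ 2).
have e2 : 1 <= expR (a / 2 * x ^+ 2).
  by rewrite -[leLHS]expR0 ler_expR mulr_ge0 ?sqr_ge0 // ltW.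
apply: (le_trans x1); rewrite mulrDl mul1r; apply: lerD => //.
rewrite mulrC ler_pdivlMr // mulrC.
by move: e1; lra.
Qed.

(** Integrability and square integrability are automatic for these functions,
    and they contain both the Hermite functions and the bounded functions with
    bounded support. *)
Definition gauss_bounded f :=
  meas f /\ exists C, forall x, `|f x| <= C * expR (- (x ^+ 2 / 4)).

Lemma gauss_boundedD f g : gauss_bounded f -> gauss_bounded g ->
  gauss_bounded (fun x => f x + g x).
Proof.
move=> [mf [C HC]] [mg [D HD]]; split; first exact: measD.
exists (C + D) => x; rewrite mulrDl (le_trans (ler_normD _ _)) // lerD //.
Qed.

Lemma gauss_boundedZ a f : gauss_bounded f -> gauss_bounded (fun x => a * f x).
Proof.
move=> [mf [C HC]]; split; first exact: measM (meas_cst _) mf.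
by exists (`|a| * C) => x; rewrite normrM -mulrA ler_wpM2l.
Qed.

Lemma gauss_bounded0 : gauss_bounded (fun=> 0).
Proof. by split; [exact: meas_cst|exists 0 => x; rewrite normr0 mul0r]. Qed.

Lemma gauss_boundedB f g : gauss_bounded f -> gauss_bounded g ->
  gauss_bounded (fun x => f x - g x).
Proof.
move=> Gf /(gauss_boundedZ (-1)) Gg; have := gauss_boundedD Gf Gg.
by congr gauss_bounded; apply/funext => x; rewrite mulN1r.
Qed.

Lemma gauss_bounded_sum I (s : seq I) (F : I -> R -> R) :
  (forall i, gauss_bounded (F i)) -> gauss_bounded (fun x => \sum_(i <- s) F i x).
Proof.
move=> GF; elim: s => [|i s IH].
  by under eq_fun do rewrite big_nil; exact: gauss_bounded0.
by under eq_fun do rewrite big_cons; exact: gauss_boundedD.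
Qed.

Lemma gauss_bounded_poly p s : 1 <= s ->
  gauss_bounded (fun x => p.[x] * expR (- (s * (x ^+ 2 / 2)))).
Proof.
move=> s1; split.
  apply: measM; first exact: meas_continuous (@continuous_horner _ p).
  apply: meas_continuous => x.
  apply: (@continuous_comp _ _ _ (fun x : R => - (s * (x ^+ 2 / 2))) expR);
    last exact: continuous_expR.
  apply: cvgN; apply: cvgM; first exact: cvg_cst.
  by apply: cvgM; [exact: exprn_continuous|exact: cvg_cst].
have [|C C0 HC] := @poly_le_expR p 4^-1; first by rewrite invr_gt0.
exists C => x; rewrite normrM (ger0_norm (expR_ge0 _)).
apply: le_trans (ler_wpM2r (expR_ge0 _) (HC x)) _.
rewrite -mulrA ler_wpM2l // -expRD ler_expR.
by have := sqr_ge0 x; nra.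
Qed.

Lemma gauss_bounded_hermite k : gauss_bounded (h k).
Proof.
have := gauss_boundedZ (hermite_gamma R k) (gauss_bounded_poly (hermite_poly R k) (lexx 1)).
by congr gauss_bounded; apply/funext => x; rewrite hermiteE mul1r mulrA.
Qed.

Lemma gauss_bounded_hermite' k : gauss_bounded (hermite' k).
Proof.
by apply: gauss_boundedB; apply: gauss_boundedZ; exact: gauss_bounded_hermite.
Qed.

Lemma L1_expR : L1 (fun x => expR (- (x ^+ 2 / 2))).
Proof.
have := L1Z (normal_peak 1)^-1 (integrable_normal_pdf (0 : R) 1).
congr L1; apply/funext => x /=.
rewrite /normal_pdf (negbTE (oner_neq0 _)) /= mulrA mulVf ?mul1r; last first.
  by rewrite gt_eqF // normal_peak_gt0 // oner_eq0.
by rewrite /normal_fun subr0 expr1n mulNr.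
Qed.

Lemma gauss_boundedM_L1 f g : gauss_bounded f -> gauss_bounded g ->
  L1 (fun x => f x * g x).
Proof.
move=> [mf [C HC]] [mg [D HD]].
apply: (L1_le (g := fun x => C * D * expR (- (x ^+ 2 / 2)))).
- exact: measM.
- move=> x; rewrite normrM (_ : expR _ = expR (- (x ^+ 2 / 4)) * expR (- (x ^+ 2 / 4))).
    by rewrite mulrACA ler_pM.
  by rewrite -expRD; congr expR; lra.
- exact/L1Z/L1_expR.
Qed.

Lemma gauss_boundedM f g : gauss_bounded f -> gauss_bounded g ->
  gauss_bounded (fun x => f x * g x).
Proof.
move=> [mf [C HC]] [mg [D HD]]; split; first exact: measM.
exists (C * D) => x; rewrite normrM -[leRHS]mulrA [D * _]mulrC mulrA.
have D0 : 0 <= D.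
  by rewrite -(pmulr_lge0 _ (expR_gt0 (- (x ^+ 2 / 4)))) (le_trans _ (HD x)).
apply: ler_pM => //; apply: le_trans (HD x) _; rewrite ler_piMr //.
by rewrite -[leRHS]expR0 ler_expR oppr_le0 divr_ge0 ?sqr_ge0.
Qed.

Lemma gauss_bounded_supp f C T : meas f -> (forall x, `|f x| <= C) ->
  (forall x, T <= `|x| -> f x = 0) -> gauss_bounded f.
Proof.
move=> mf fC fT; split => //; exists (C * expR (T ^+ 2 / 4)) => x.
have C0 : 0 <= C by apply: le_trans (fC 0).
case: (leP T `|x|) => [/fT ->|xT].
  by rewrite normr0 !mulr_ge0 // expR_ge0.
rewrite -mulrA -expRD; apply: le_trans (fC x) _; rewrite ler_peMr //.
rewrite -[leLHS]expR0 ler_expR -[x ^+ 2]real_normK ?num_real //.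
have := normr_ge0 x; nra.
Qed.

Lemma L1_gauss_bounded f : gauss_bounded f -> L1 f.
Proof.
move=> [mf [C HC]].
have := L1_le (f := f) (g := fun x => C * expR (- (x ^+ 2 / 4))) mf HC.
apply; apply: L1Z.
have := L1Z (normal_peak (Num.sqrt 2))^-1 (integrable_normal_pdf (0 : R) (Num.sqrt 2)).
congr L1; apply/funext => x /=.
have s0 : Num.sqrt 2 != 0 :> R by rewrite gt_eqF // sqrtr_gt0.
rewrite /normal_pdf (negbTE s0) /= mulrA mulVf ?mul1r; last first.
  by rewrite gt_eqF // normal_peak_gt0.
rewrite /normal_fun subr0 sqr_sqrtr // mulNr; congr (expR (- (_ / _))).
by rewrite mulr2n; lra.
Qed.

End GaussianDecay.

Section HermiteOrthonormal.
Variable R : realType.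
Local Notation mu := (@lebesgue_measure R).
Local Notation h := (@hermite_fun R).
Implicit Types (f g : R -> R) (k n : nat) (x : R).

(** The fundamental theorem of calculus on [[- n, n]], letting [n] tend to
    infinity. *)
Lemma lebint_derive0 (F F' : R -> R) : gauss_bounded F -> gauss_bounded F' ->
  (forall x, is_derive x 1 F (F' x)) -> continuous F' -> lebint F' = 0.
Proof.
move=> [_ [C HC]] GF' dF cF'.
have cF : continuous F.
  move=> x; apply/differentiable_continuous/derivable1_diffP.
  by case: (dF x).
pose I n : set R := `[- n.+1%:R, n.+1%:R]%classic.
have mI n : measurable (I n) by exact: measurable_itv.
have Icvg : lebint (fun x => F' x * \1_(I n) x) @[n --> \oo] --> lebint F'.
  apply: (lebint_dominated (g := fun x => `|F' x|)).
  - by move=> n; apply: measM; [case: GF'|exact: meas_indic].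
  - by case: GF'.
  - exact/L1_norm/L1_gauss_bounded.
  - move=> n x; rewrite normrM ler_piMr // indicE.
    by case: (_ \in _); rewrite ?normr1 ?normr0.
  - apply: aeW => x; apply: cvg_near_cst.
    near=> n; rewrite indicE mem_set ?mulr1 //.
    rewrite /I /= in_itv /= -ler_norml.
    apply: le_trans (_ : n%:R <= _); last by rewrite ler_nat.
    by near: n; exact: nbhs_infty_ger.
have IE n : lebint (fun x => F' x * \1_(I n) x) = F n.+1%:R - F (- n.+1%:R).
  rewrite lebint.unlock /Rintegral.
  have -> : (\int[mu]_x (F' x * \1_(I n) x)%:E)%E = (\int[mu]_(x in I n) (F' x)%:E)%E.
    rewrite [RHS]integral_mkcond; apply: eq_integral => x _.
    by rewrite patchE indicE; case: (x \in I n); rewrite ?mulr1 ?mulr0.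
  rewrite (@continuous_FTC2 _ F' F) //.
  - by rewrite gtrN.
  - exact: continuous_subspaceT.
  - split.
    + by move=> x _; case: (dF x).
    + exact/cvg_at_right_filter/cF.
    + exact/cvg_at_left_filter/cF.
  - by move=> x _; rewrite derive1E; apply: derive_val.
have C0 : 0 <= C.
  rewrite -(pmulr_lge0 _ (expR_gt0 (- (0 ^+ 2 / 4)))).
  exact: le_trans (normr_ge0 _) (HC 0).
have Fcvg : (fun n => F n.+1%:R - F (- n.+1%:R)) @ \oo --> 0.
  apply/norm_cvg0P.
  apply: (@squeeze_cvgr _ _ _ _ (fun=> 0) (fun n => 8 * C * n.+1%:R^-1)).
  - near=> n; rewrite normr_ge0 /=.
    have bnd y : y ^+ 2 = n.+1%:R ^+ 2 -> `|F y| <= 4 * C * n.+1%:R^-1.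
      move=> yn; apply: le_trans (HC y) _; rewrite yn (_ : 4 * C * _ = C * (4 * n.+1%:R^-1)) ?ler_wpM2l //; last by ring.
      rewrite expRN -[leRHS]invrK lef_pV2 ?posrE ?expR_gt0 ?invr_gt0 ?divr_gt0 //.
      rewrite invf_div.
      apply: le_trans (expR_ge1Dx _).
      have : 1 <= n.+1%:R :> R by rewrite ler1n.
      by move: (n.+1%:R) => m m1; nra.
    apply: le_trans (ler_normB _ _) _.
    rewrite (_ : 8 * C * _ = 4 * C * n.+1%:R^-1 + 4 * C * n.+1%:R^-1); last by ring.
    by apply: lerD; apply: bnd; rewrite ?sqrrN.
  - exact: cvg_cst.
  - rewrite -[X in _ --> X](mulr0 (8 * C)); apply: cvgM; first exact: cvg_cst.
    exact: cvg_harmonic.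
move: Icvg; under eq_fun do rewrite IE.
by move=> Icvg; apply: (cvg_unique _ Icvg Fcvg).
Unshelve. all: by end_near. Qed.

Lemma continuous_hermite k : continuous (h k).
Proof.
move=> x; apply/differentiable_continuous/derivable1_diffP.
by case: (is_derive_hermite k x).
Qed.

Definition ip f g := lebint (fun x => f x * g x).

Lemma ipC f g : ip f g = ip g f.
Proof. by rewrite /ip; congr lebint; apply/funext => x; rewrite mulrC. Qed.

(** The Wronskian [h_j' h_k - h_j h_k'] decays at infinity, and by the Hermite
    equation its derivative is [2 (k - j) h_j h_k]. *)
Lemma hermite_orthogonal j k : j != k -> ip (h j) (h k) = 0.
Proof.
move=> jk; have Gj := gauss_bounded_hermite R j; have Gk := gauss_bounded_hermite R k.
have L := gauss_boundedM_L1 Gj Gk.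
pose F x := hermite' j x * h k x - h j x * hermite' k x.
pose F' x := 2 * (k%:R - j%:R) * (h j x * h k x).
have : lebint F' = 0.
  apply: (@lebint_derive0 F F').
  - by apply: gauss_boundedB; apply: gauss_boundedM => //; exact: gauss_bounded_hermite'.
  - exact/gauss_boundedZ/gauss_boundedM.
  - move=> x; have d1 := is_derive_hermite j x; have d2 := is_derive_hermite' j x.
    have d3 := is_derive_hermite k x; have d4 := is_derive_hermite' k x.
    apply: is_derive_eq; rewrite /F' /GRing.scale/= /cst.
    move: (h j x) (h k x) (hermite' j x) (hermite' k x) => a b c d; ring.
  - move=> x; apply: cvgM; first exact: cvg_cst.
    by apply: cvgM; exact: continuous_hermite.
rewrite /F' lebintZ // => /eqP; rewrite mulf_eq0 mulf_eq0 pnatr_eq0 /= subr_eq0 eqr_nat.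
by rewrite eq_sym (negbTE jk) => /eqP.
Qed.

Lemma ipDl f g u : gauss_bounded f -> gauss_bounded g -> gauss_bounded u ->
  ip (fun x => f x + g x) u = ip f u + ip g u.
Proof.
move=> Gf Gg Gu; rewrite /ip -lebintD; try exact: gauss_boundedM_L1.
by congr lebint; apply/funext => x; rewrite mulrDl.
Qed.

Lemma ipZl a f u : gauss_bounded f -> gauss_bounded u ->
  ip (fun x => a * f x) u = a * ip f u.
Proof.
move=> Gf Gu; rewrite /ip -lebintZ; try exact: gauss_boundedM_L1.
by congr lebint; apply/funext => x; rewrite mulrA.
Qed.

Lemma ipBl f g u : gauss_bounded f -> gauss_bounded g -> gauss_bounded u ->
  ip (fun x => f x - g x) u = ip f u - ip g u.
Proof.
move=> Gf Gg Gu; rewrite /ip -lebintB; try exact: gauss_boundedM_L1.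
by congr lebint; apply/funext => x; rewrite mulrBl.
Qed.

Lemma ip_suml I (s : seq I) (F : I -> R -> R) u :
  (forall i, gauss_bounded (F i)) -> gauss_bounded u ->
  ip (fun x => \sum_(i <- s) F i x) u = \sum_(i <- s) ip (F i) u.
Proof.
move=> GF Gu; rewrite /ip -lebint_sum; last by move=> i; exact: gauss_boundedM_L1.
by congr lebint; apply/funext => x; rewrite mulr_suml.
Qed.

Lemma ip_ge0 f : 0 <= ip f f.
Proof. by apply: lebint_ge0 => x; rewrite -expr2 sqr_ge0. Qed.

(** Multiplication by [x] is symmetric; comparing the two expansions of
    [ip (x h_k) (h_(k+1))] carries the norm from [k] to [k + 1], starting from
    the Gaussian integral. *)
Lemma hermite_norm k : ip (h k) (h k) = 1.
Proof.
have G := gauss_bounded_hermite R; have GZ a j := gauss_boundedZ a (G j).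
elim: k => [|k IH].
  rewrite /ip; have -> : (fun x => h 0 x * h 0 x) =
      fun x => hermite_gamma R 0 ^+ 2 * gauss_fun x.
    apply/funext => x; rewrite hermiteE [hermite_poly R 0]/= hornerC mulr1.
    rewrite /gauss_fun (_ : - x ^+ 2 = - (x ^+ 2 / 2) + - (x ^+ 2 / 2)); last by lra.
    by rewrite expRD; ring.
  rewrite lebintZ; last exact: integrableT_gauss.
  rewrite lebint.unlock /Rintegral integralT_gauss /=.
  rewrite /hermite_gamma mul0r oppr0 powRr0 fact0 powR1 !mulr1.
  rewrite -powR12_sqrt ?pi_ge0 // -powR_mulrn ?powR_ge0 // -powRrM -powRD; last first.
    by apply/implyP => _; rewrite gt_eqF // pi_gt0.
  by rewrite (_ : - 4^-1 * 2%:R + 2^-1 = 0) ?powRr0 //; field.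
have : ip (fun x => x * h k x) (h k.+1) = ip (fun x => x * h k.+1 x) (h k).
  by rewrite /ip; congr lebint; apply/funext => x; ring.
under eq_fun do rewrite hermite_rec.
under [in RHS]eq_fun do rewrite hermite_rec.
rewrite !ipDl // !ipZl // [k.+1.-1]/= IH (@hermite_orthogonal k.+2) ?mulr0 ?add0r; last first.
  by rewrite gtn_eqF.
rewrite (@hermite_orthogonal k.-1) ?mulr0 ?addr0; last by rewrite ltn_eqF //; case: (k).
by apply: mulfI; rewrite gt_eqF // sqrtr_gt0 divr_gt0.
Qed.

End HermiteOrthonormal.

(** * Mean-square convergence of Hermite sums *)

Section MeanSquare.
Variable R : realType.
Local Notation mu := (@lebesgue_measure R).
Local Notation h := (@hermite_fun R).
Implicit Types (f g : R -> R) (k n : nat) (x : R).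

Definition hsum n f x := \sum_(0 <= k < n.+1) ip f (h k) * h k x.

Definition sqnorm f := ip f f.

Lemma sqnorm_ge0 f : 0 <= sqnorm f. Proof. exact: ip_ge0. Qed.

Lemma gauss_bounded_hsum n f : gauss_bounded (hsum n f).
Proof.
apply: gauss_bounded_sum => k; apply: gauss_boundedZ.
exact: gauss_bounded_hermite.
Qed.

Lemma hsum_hermite n k : (k <= n)%N -> hsum n (h k) = h k.
Proof.
move=> kn; apply/funext => x; rewrite /hsum (bigD1_seq k) ?mem_index_iota ?iota_uniq //=.
rewrite hermite_norm mul1r big1 ?addr0 // => j jk.
by rewrite hermite_orthogonal ?mul0r // eq_sym.
Qed.

Lemma hsumD n f g : gauss_bounded f -> gauss_bounded g ->
  hsum n (fun x => f x + g x) = fun x => hsum n f x + hsum n g x.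
Proof.
move=> Gf Gg; apply/funext => x; rewrite -big_split; apply: eq_bigr => k _ /=.
by rewrite ipDl ?mulrDl //; exact: gauss_bounded_hermite.
Qed.

Lemma hsumZ n a f : gauss_bounded f ->
  hsum n (fun x => a * f x) = fun x => a * hsum n f x.
Proof.
move=> Gf; apply/funext => x; rewrite mulr_sumr; apply: eq_bigr => k _ /=.
by rewrite ipZl ?mulrA //; exact: gauss_bounded_hermite.
Qed.

Lemma ip_hsum n f g : gauss_bounded g ->
  ip (hsum n f) g = \sum_(0 <= k < n.+1) ip f (h k) * ip g (h k).
Proof.
move=> Gg; rewrite ip_suml //; last first.
  by move=> k; apply: gauss_boundedZ; exact: gauss_bounded_hermite.
by apply: eq_bigr => k _; rewrite ipZl ?(ipC _ g) //; exact: gauss_bounded_hermite.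
Qed.

Lemma ip_hsumC n f g : gauss_bounded f -> gauss_bounded g ->
  ip (hsum n f) g = ip f (hsum n g).
Proof.
move=> Gf Gg; rewrite (ipC f) !ip_hsum //.
by apply: eq_bigr => k _; rewrite mulrC.
Qed.

Lemma hsumK n f : hsum n (hsum n f) = hsum n f.
Proof.
apply/funext => x; rewrite /hsum; apply: eq_big_nat => k /andP[_ kn]; congr (_ * _).
rewrite ip_hsum; last exact: gauss_bounded_hermite.
rewrite (bigD1_seq k) ?mem_index_iota ?iota_uniq //= hermite_norm mulr1.
rewrite big1 ?addr0 // => j jk.
by rewrite hermite_orthogonal ?mulr0 // eq_sym.
Qed.

(** Pythagoras: [hsum n] is an orthogonal projection. *)
Lemma sqnormD_hsum n f : gauss_bounded f ->
  sqnorm f = sqnorm (fun x => f x - hsum n f x) + sqnorm (hsum n f).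
Proof.
move=> Gf; have GS := gauss_bounded_hsum n f.
have GB := gauss_boundedB Gf GS.
have PSS : ip (hsum n f) (hsum n f) = ip f (hsum n f).
  by rewrite ip_hsumC // hsumK.
rewrite /sqnorm ipBl // (ipC f) (ipC (hsum n f) (fun x => f x - _)) !ipBl //.
by rewrite (ipC (hsum n f) f) PSS; ring.
Qed.

Lemma sqnorm_hsum_le n f : gauss_bounded f -> sqnorm (hsum n f) <= sqnorm f.
Proof. by move=> /(sqnormD_hsum n) ->; rewrite lerDr sqnorm_ge0. Qed.

Lemma sqnorm_subhsum_le n f : gauss_bounded f ->
  sqnorm (fun x => f x - hsum n f x) <= sqnorm f.
Proof. by move=> /(sqnormD_hsum n) ->; rewrite lerDl sqnorm_ge0. Qed.

Lemma sqnormD_le f g : gauss_bounded f -> gauss_bounded g ->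
  sqnorm (fun x => f x + g x) <= 2 * sqnorm f + 2 * sqnorm g.
Proof.
move=> Gf Gg; rewrite /sqnorm /ip -!lebintZ; try exact: gauss_boundedM_L1.
rewrite -lebintD; try by apply: L1Z; exact: gauss_boundedM_L1.
apply: lebint_le.
- by apply: gauss_boundedM_L1; exact: gauss_boundedD.
- by apply: L1D; apply: L1Z; exact: gauss_boundedM_L1.
- by move=> x; have := sqr_ge0 (f x - g x); lra.
Qed.

Lemma sqnormZ a f : gauss_bounded f -> sqnorm (fun x => a * f x) = a ^+ 2 * sqnorm f.
Proof.
move=> Gf; rewrite /sqnorm ipZl ?(ipC f) ?ipZl //; last exact: gauss_boundedZ.
by rewrite mulrA expr2.
Qed.

(** Completeness amounts to finding every bounded function of bounded support
    in this class, which is enlarged step by step below. *)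
Definition hermite_cvg f := gauss_bounded f /\
  forall e : R, 0 < e -> exists N, forall n, (N <= n)%N ->
    sqnorm (fun x => f x - hsum n f x) <= e.

Lemma hermite_cvg_hermite k : hermite_cvg (h k).
Proof.
split; first exact: gauss_bounded_hermite.
move=> e e0; exists k => n kn; rewrite hsum_hermite // (_ : (fun _ => _) = fun=> 0).
  by rewrite /sqnorm /ip (_ : (fun _ => _) = fun=> 0) ?lebint0 ?ltW //; apply/funext => x; rewrite mulr0.
by apply/funext => x; rewrite subrr.
Qed.

Lemma hermite_cvgD f g : hermite_cvg f -> hermite_cvg g ->
  hermite_cvg (fun x => f x + g x).
Proof.
move=> [Gf Df] [Gg Dg]; split; first exact: gauss_boundedD.
move=> e e0; have e40 : 0 < e / 4 by rewrite divr_gt0.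
have [M HM] := Df _ e40; have [N HN] := Dg _ e40.
exists (maxn M N) => n; rewrite geq_max => /andP[/HM hm /HN hn].
rewrite hsumD // (_ : (fun _ => _) = fun x => (f x - hsum n f x) + (g x - hsum n g x)).
  apply: le_trans (sqnormD_le _ _) _; try by apply: gauss_boundedB => //; exact: gauss_bounded_hsum.
  by move: hm hn; lra.
by apply/funext => x; ring.
Qed.

Lemma hermite_cvgZ a f : hermite_cvg f -> hermite_cvg (fun x => a * f x).
Proof.
move=> [Gf Df]; split; first exact: gauss_boundedZ.
move=> e e0; have a0 : 0 < a ^+ 2 + 1 by rewrite ltr_wpDl // sqr_ge0.
have [|N HN] := Df (e / (a ^+ 2 + 1)); first by rewrite divr_gt0.
exists N => n /HN; rewrite ler_pdivlMr // hsumZ //.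
rewrite (_ : (fun x => _ - a * _) = fun x => a * (f x - hsum n f x)); last first.
  by apply/funext => x; ring.
rewrite sqnormZ; last by apply: gauss_boundedB => //; exact: gauss_bounded_hsum.
have := sqnorm_ge0 (fun x => f x - hsum n f x); lra.
Qed.

Lemma hermite_cvg0 : hermite_cvg (fun=> 0).
Proof.
have := hermite_cvgZ 0 (hermite_cvg_hermite 0).
by congr hermite_cvg; apply/funext => x; rewrite mul0r.
Qed.

Lemma hermite_cvg_sum I (s : seq I) (F : I -> R -> R) :
  (forall i, hermite_cvg (F i)) -> hermite_cvg (fun x => \sum_(i <- s) F i x).
Proof.
move=> DF; elim: s => [|i s IH].
  by under eq_fun do rewrite big_nil; exact: hermite_cvg0.
by under eq_fun do rewrite big_cons; exact: hermite_cvgD.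
Qed.

(** The projections do not increase the norm, so approximation by members of
    the class is enough. *)
Lemma hermite_cvg_closed f : gauss_bounded f ->
  (forall e : R, 0 < e -> exists2 g, hermite_cvg g & sqnorm (fun x => f x - g x) <= e) ->
  hermite_cvg f.
Proof.
move=> Gf approx; split => // e e0; have e40 : 0 < e / 4 by rewrite divr_gt0.
have [g [Gg Dg] fg] := approx _ e40; have [N HN] := Dg _ e40.
exists N => n /HN hn.
have Gfg := gauss_boundedB Gf Gg.
have E : hsum n f = fun x => hsum n (fun x => f x - g x) x + hsum n g x.
  by rewrite -hsumD //; congr hsum; apply/funext => x; ring.
rewrite (_ : (fun _ => _) = fun x => ((f x - g x) - hsum n (fun x => f x - g x) x)
    + (g x - hsum n g x)); last by apply/funext => x; rewrite E; ring.
apply: le_trans (sqnormD_le _ _) _; try by apply: gauss_boundedB => //; exact: gauss_bounded_hsum.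
by have := sqnorm_subhsum_le n Gfg; move: hn fg; lra.
Qed.

(** Dominated convergence, as it is used to enlarge the class. *)
Lemma hermite_cvg_limit (F : nat -> R -> R) f (C : R) :
  meas f -> (forall n, hermite_cvg (F n)) ->
  (forall x, `|f x| <= C * expR (- (x ^+ 2 / 4))) ->
  (forall n x, `|F n x| <= C * expR (- (x ^+ 2 / 4))) ->
  {ae mu, forall x, F n x @[n --> \oo] --> f x} ->
  hermite_cvg f.
Proof.
move=> mf DF fC FC cvgF.
have Gf : gauss_bounded f by split => //; exists C.
have GF n : gauss_bounded (F n) by case: (DF n).
have cvg0 : sqnorm (fun x => f x - F n x) @[n --> \oo] --> (0 : R).
  rewrite /sqnorm /ip -[X in _ --> X](lebint0 R).
  apply: (lebint_dominated (g := fun x => (2 * C) ^+ 2 * expR (- (x ^+ 2 / 2)))).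
  - by move=> n; apply: measM; apply: measB => //; case: (GF n).
  - exact: meas_cst.
  - exact/L1Z/L1_expR.
  - move=> n x; rewrite normrM -expr2 (_ : expR _ = expR (- (x ^+ 2 / 4)) ^+ 2); last first.
      by rewrite [RHS]expr2 -expRD; congr expR; lra.
    rewrite -exprMn ler_pXn2r ?nnegrE //.
      by rewrite (le_trans (ler_normB _ _)) // -mulrA mulr_natl mulr2n lerD.
    by rewrite -mulrA mulr_ge0 // (le_trans _ (fC x)).
  - move: cvgF; apply: filterS => x Fx.
    rewrite (_ : 0 = (f x - f x) * (f x - f x)); last by rewrite subrr mulr0.
    by apply: cvgM; apply: cvgB => //; exact: cvg_cst.
apply: hermite_cvg_closed => // e e0.
have /cvgrPdist_le/(_ _ e0)[N _ HN] := cvg0.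
exists (F N) => //; have := HN N (leqnn N).
by rewrite /= sub0r normrN ger0_norm // sqnorm_ge0.
Qed.

(** By the three-term recurrence a polynomial times [h 0] is a finite
    combination of Hermite functions. *)
Lemma hermite_cvg_gauss p : hermite_cvg (fun x => p.[x] * expR (- (x ^+ 2 / 2))).
Proof.
have Dxh m k : hermite_cvg (fun x => x ^+ m * h k x).
  elim: m k => [|m IH] k.
    by under eq_fun do rewrite expr0 mul1r; exact: hermite_cvg_hermite.
  have -> : (fun x => x ^+ m.+1 * h k x) = fun x =>
      Num.sqrt (k.+1%:R / 2) * (x ^+ m * h k.+1 x) + Num.sqrt (k%:R / 2) * (x ^+ m * h k.-1 x).
    by apply/funext => x; rewrite exprSr -mulrA hermite_rec; ring.
  by apply: hermite_cvgD; exact: hermite_cvgZ.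
have -> : (fun x => p.[x] * expR (- (x ^+ 2 / 2))) =
    fun x => \sum_(i < size p) (p`_i / hermite_gamma R 0) * (x ^+ i * h 0 x).
  apply/funext => x; rewrite horner_coef mulr_suml; apply: eq_bigr => i _.
  rewrite hermiteE [hermite_poly R 0]/= hornerC mulr1.
  by field; rewrite gt_eqF // hermite_gamma_gt0.
by apply: hermite_cvg_sum => i; exact: hermite_cvgZ.
Qed.

End MeanSquare.

(** * Uniform grids *)

Section Grid.
Variable R : realType.
Implicit Types (T x : R) (N i j : nat).

(** The division of [[- T, T)] into [N] half-open cells of equal length. *)
Definition grid T N j : R := - T + j%:R * (2 * T / N%:R).

Definition cell T N j : set R := `[grid T N j, grid T N j.+1[%classic.

Lemma cellP T N j x : 0 < T -> (0 < N)%N ->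
  (cell T N j x <-> j%:R <= (x + T) / (2 * T / N%:R) < j.+1%:R).
Proof.
move=> T0 N0; have d0 : 0 < 2 * T / N%:R by rewrite divr_gt0 ?mulr_gt0 ?ltr0n.
rewrite /cell /grid /= in_itv /= ler_pdivlMr // ltr_pdivrMr //.
by split; lra.
Qed.

Lemma grid_cell T N x : 0 < T -> (0 < N)%N -> - T <= x < T ->
  exists2 j, (j < N)%N & cell T N j x.
Proof.
move=> T0 N0 /andP[Tx xT].
have d0 : 0 < 2 * T / N%:R by rewrite divr_gt0 ?mulr_gt0 ?ltr0n.
have y0 : 0 <= (x + T) / (2 * T / N%:R) by apply: divr_ge0; [lra|exact: ltW].
have /andP[j1 j2] := truncn_itv y0.
exists (Num.truncn ((x + T) / (2 * T / N%:R))); last first.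
  by apply/cellP => //; rewrite j1 j2.
rewrite -(ltr_nat R); apply: (le_lt_trans j1).
rewrite ltr_pdivrMr // mulrCA divff ?mulr1; last by rewrite pnatr_eq0 -lt0n.
by lra.
Qed.

Lemma cell_sub T N j x : 0 < T -> (0 < N)%N -> (j < N)%N -> cell T N j x -> - T <= x < T.
Proof.
move=> T0 N0 jN; rewrite /cell /grid /= in_itv /= => /andP[a b].
have d0 : 0 < 2 * T / N%:R by rewrite divr_gt0 ?mulr_gt0 ?ltr0n.
have j0 : 0 <= j%:R * (2 * T / N%:R) by rewrite mulr_ge0 // ltW.
have j1 : j.+1%:R * (2 * T / N%:R) <= N%:R * (2 * T / N%:R).
  by apply: ler_wpM2r; [exact: ltW|rewrite ler_nat].
move: j1; rewrite [leRHS]mulrCA divff ?mulr1; last by rewrite pnatr_eq0 -lt0n.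
by move: a b j0; lra.
Qed.

Lemma cell_inj T N i j x : 0 < T -> (0 < N)%N -> cell T N i x -> cell T N j x -> i = j.
Proof.
move=> T0 N0 /cellP-/(_ T0 N0)/andP[a b] /cellP-/(_ T0 N0)/andP[c d].
have := le_lt_trans a d; have := le_lt_trans c b; rewrite !ltr_nat !ltnS => ji ij.
by apply/eqP; rewrite eqn_leq ij ji.
Qed.

Lemma grid_sum T N j x (F : nat -> R) : 0 < T -> (j < N)%N -> cell T N j x ->
  \sum_(0 <= i < N) F i * \1_(cell T N i) x = F j.
Proof.
move=> T0 jN xj; have N0 : (0 < N)%N by exact: leq_ltn_trans jN.
rewrite (bigD1_seq j) ?mem_index_iota ?iota_uniq //= indicE mem_set // mulr1.
rewrite big1 ?addr0 // => i ij; rewrite indicE memNset ?mulr0 // => xi.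
by move: ij; rewrite (cell_inj T0 N0 xi xj) eqxx.
Qed.

Lemma grid_sum0 T N x (F : nat -> R) : 0 < T -> ~~ (- T <= x < T) ->
  \sum_(0 <= i < N) F i * \1_(cell T N i) x = 0.
Proof.
move=> T0 xT; apply: big1_seq => i /=; rewrite mem_index_iota => iN.
rewrite indicE memNset ?mulr0 // => xi; move: xT.
by rewrite (@cell_sub T N i) //; exact: leq_ltn_trans iN.
Qed.

Lemma grid_dist T N j x : cell T N j x -> `|x - grid T N j| <= 2 * T / N%:R.
Proof.
rewrite /cell /= in_itv /= => /andP[a b]; rewrite ger0_norm ?subr_ge0 //.
by move: b; rewrite /grid -natr1; lra.
Qed.

Lemma measurable_cell T N j : measurable (cell T N j).
Proof. exact: measurable_itv. Qed.

Lemma grid_lt T N i j : 0 < T -> (0 < N)%N -> (i < j)%N -> grid T N i < grid T N j.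
Proof.
move=> T0 N0 ij; rewrite ltrD2l ltr_pM2r ?ltr_nat // divr_gt0 ?mulr_gt0 ?ltr0n //.
Qed.

Lemma grid_bound T N j : 0 < T -> (j < N)%N -> - T <= grid T N j < T.
Proof.
move=> T0 jN; have N0 : (0 < N)%N by exact: leq_ltn_trans jN.
by apply: (@cell_sub T N j) => //; rewrite /cell /= in_itv /= lexx grid_lt.
Qed.

End Grid.

(** * Completeness of the Hermite functions *)

Section Completeness.
Variable R : realType.
Local Notation mu := (@lebesgue_measure R).
Implicit Types (f g : R -> R) (k n : nat) (x t a : R) (p q : {poly R}).

Lemma exp_partial_le (y : R) n : `|series (exp_coeff y) n| <= expR `|y|.
Proof.
apply: le_trans (_ : series (exp_coeff `|y|) n <= _).
  rewrite /series /= (le_trans (ler_norm_sum _ _ _)) // ler_sum // => i _.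
  by rewrite /exp_coeff /= normrM normrX (@ger0_norm _ _^-1) ?invr_ge0.
apply: nondecreasing_cvgn_le; last exact: is_cvg_series_exp_coeff.
apply/nondecreasing_seqP => m; rewrite /series /= big_nat_recr //= lerDl.
exact: exp_coeff_ge0.
Qed.

(** A factor [exp q] may be added as long as enough decay remains, because the
    Taylor polynomials of [exp q] only change the polynomial factor. *)
Lemma hermite_cvg_mul_exp g q (C : R) : meas g ->
  (forall x, `|g x| * expR `|q.[x]| <= C * expR (- (5 / 16 * x ^+ 2))) ->
  (forall p, hermite_cvg (fun x => p.[x] * g x)) ->
  forall p, hermite_cvg (fun x => p.[x] * (g x * expR q.[x])).
Proof.
move=> mg gq Dg p.
have C0 : 0 <= C.
  rewrite -(pmulr_lge0 _ (expR_gt0 (- (5 / 16 * 0 ^+ 2)))).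
  by apply: le_trans (gq 0); rewrite mulr_ge0 ?expR_ge0.
have mp r : meas (fun x => r.[x]) by exact: meas_continuous (@continuous_horner _ r).
(* 5 / 16 = 1 / 4 + 1 / 16: the surplus over the decay that the class asks for
   absorbs the polynomial. *)
have [|D D0 HD] := @poly_le_expR R p 16^-1; first by rewrite invr_gt0.
pose F n x := p.[x] * (g x * series (exp_coeff q.[x]) n).
have bound x (y : R) : `|y| <= expR `|q.[x]| ->
    `|p.[x] * (g x * y)| <= D * C * expR (- (x ^+ 2 / 4)).
  move=> hy; rewrite normrM normrM.
  rewrite (_ : D * C * _ = D * expR (16^-1 * x ^+ 2) * (C * expR (- (5 / 16 * x ^+ 2)))).
    apply: ler_pM => //; apply: le_trans (gq x).
    by rewrite ler_wpM2l.
  rewrite [RHS]mulrACA -expRD; congr (_ * expR _); lra.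
apply: (@hermite_cvg_limit R F _ (D * C)).
- apply: measM => //; apply: measM => //; apply: measurableT_comp => //; exact: mp.
- move=> n; have := Dg (p * \sum_(i < n) (i`!%:R^-1)%:P * q ^+ i).
  congr hermite_cvg; apply/funext => x; rewrite /F /series /= big_mkord hornerM.
  rewrite horner_sum -mulrA; congr (_ * _); rewrite mulrC; congr (_ * _).
  by apply: eq_bigr => i _; rewrite hornerM hornerC horner_exp mulrC.
- by move=> x; apply: bound; rewrite ger0_norm ?expR_ge0 // ler_expR ler_norm.
- by move=> n x; apply: bound; exact: exp_partial_le.
- apply: aeW => x; apply: cvgM; first exact: cvg_cst.
  by apply: cvgM; [exact: cvg_cst|exact: is_cvg_series_exp_coeff].
Qed.

Lemma meas_gauss a t : meas (fun x : R => expR (- (a * (x ^+ 2 / 2)) + t * x)).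
Proof.
apply: measurableT_comp => //.
have := meas_continuous (@continuous_horner R (- (a / 2) *: 'X^2 + t *: 'X)).
congr meas; apply/funext => x; rewrite hornerD !hornerZ hornerXn hornerX.
by field.
Qed.

(** The factor [exp (t x)] comes first; then the coefficient is raised from [1]
    to [a] in steps [d <= 1 / 4], small enough for the Taylor polynomials of
    [exp (- d x ^ 2 / 2)] to stay dominated. *)
Lemma hermite_cvg_gauss_shift a t p : 1 <= a ->
  hermite_cvg (fun x => p.[x] * expR (- (a * (x ^+ 2 / 2)) + t * x)).
Proof.
move=> a1.
pose d := (a - 1) / (Num.truncn (4 * a)).+1%:R.
have aE : a = 1 + (Num.truncn (4 * a)).+1%:R * d.
  by rewrite /d mulrCA divff ?mulr1; [ring|rewrite pnatr_eq0].
have d0 : 0 <= d by rewrite divr_ge0 // subr_ge0.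
have d1 : d <= 4^-1.
  have a0 : 0 <= 4 * a by lra.
  have /andP[_] := truncn_itv a0.
  by rewrite /d ler_pdivrMr // => ?; lra.
rewrite aE; elim: _.+1 p => [|j IH] p.
  have mg : meas (fun x : R => expR (- (x ^+ 2 / 2))).
    have := @meas_gauss 1 0; congr meas; apply/funext => x.
    by rewrite mul1r mul0r addr0.
  have bnd x : `|expR (- (x ^+ 2 / 2))| * expR `|(t *: 'X).[x]| <=
      expR (8 * t ^+ 2) * expR (- (5 / 16 * x ^+ 2)).
    rewrite hornerZ hornerX ger0_norm ?expR_ge0 // -!expRD ler_expR normrM.
    have := sqr_ge0 (`|x| - 16 * `|t|); have := sqr_ge0 x.
    rewrite -[x ^+ 2]real_normK ?num_real // -[t ^+ 2]real_normK ?num_real //.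
    by move: `|x| `|t| => u v; lra.
  have := hermite_cvg_mul_exp mg bnd (@hermite_cvg_gauss R) p.
  congr hermite_cvg; apply/funext => x.
  by rewrite hornerZ hornerX mul0r addr0 mul1r -expRD.
pose b := 1 + j%:R * d.
have d20 : 0 <= d / 2 by lra.
have b1 : 1 <= b by rewrite lerDl mulr_ge0.
have bnd x : `|expR (- (b * (x ^+ 2 / 2)) + t * x)| * expR `|(- (d / 2) *: 'X^2).[x]| <=
    expR (8 * t ^+ 2) * expR (- (5 / 16 * x ^+ 2)).
  rewrite hornerZ hornerXn ger0_norm ?expR_ge0 // -!expRD ler_expR.
  rewrite normrM normrN normrX real_normK ?num_real // (ger0_norm d20).
  have := sqr_ge0 (x - 16 * t); have := sqr_ge0 x.
  have h1 : 0 <= (4^-1 - d) * x ^+ 2 by rewrite mulr_ge0 ?sqr_ge0 ?subr_ge0.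
  have h2 : 0 <= (b - 1) * x ^+ 2 by rewrite mulr_ge0 ?sqr_ge0 ?subr_ge0.
  by lra.
have := hermite_cvg_mul_exp (meas_gauss b t) bnd IH p.
congr hermite_cvg; apply/funext => x.
rewrite hornerZ hornerXn -expRD; congr (_ * expR _).
by rewrite /b -natr1; field.
Qed.

Lemma hermite_cvg_gauss_at a t : 1 <= 2 * a ->
  hermite_cvg (fun x => expR (- (a * (x - t) ^+ 2))).
Proof.
move=> a1; have := hermite_cvgZ (expR (- (a * t ^+ 2)))
  (hermite_cvg_gauss_shift (2 * a * t) 1 a1).
congr hermite_cvg; apply/funext => x; rewrite hornerC mul1r -expRD.
by congr expR; field.
Qed.

(** [1 - (1 - w) ^ n] is the telescoping sum of [w (1 - w) ^ j], which expands
    into powers of [w]. *)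
Lemma hermite_cvg_one_sub (w : R -> R) n :
  (forall j, hermite_cvg (fun x => w x ^+ j.+1)) ->
  hermite_cvg (fun x => 1 - (1 - w x) ^+ n).
Proof.
move=> Dw.
have Dwn m j : hermite_cvg (fun x => w x ^+ j.+1 * (1 - w x) ^+ m).
  elim: m j => [|m IH] j; first by under eq_fun do rewrite expr0 mulr1; exact: Dw.
  have := hermite_cvgD (IH j) (hermite_cvgZ (-1) (IH j.+1)).
  by congr hermite_cvg; apply/funext => x; rewrite !exprS; ring.
elim: n => [|n IH].
  by under eq_fun do rewrite expr0 subrr; exact: hermite_cvg0.
have := hermite_cvgD IH (Dwn n 0%N).
by congr hermite_cvg; apply/funext => x; rewrite expr1 exprS; ring.
Qed.

Lemma ae_neq a : {ae mu, forall x, x != a}.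
Proof.
exists [set a]; split; [exact: measurable_set1|exact: lebesgue_measure_set1|].
by move=> x /= /negP; rewrite negbK => /eqP.
Qed.

(** With [z = exp (- c (x - t) ^ 2)], the functions [1 - (1 - z ^ m) ^ (2 ^ m)]
    converge to the indicator of [z > 1 / 2] where [z <> 1 / 2], and they are at
    most [(2 z) ^ m], which gives the domination. *)
Lemma hermite_cvg_itv t r : 0 < r -> hermite_cvg \1_(`]t - r, t + r[%classic : set R).
Proof.
move=> r0; pose c : R := ln 2 / r ^+ 2.
have ln2 : 0 < ln 2 :> R by rewrite ln_gt0 // ltr1n.
have c0 : 0 < c by rewrite divr_gt0 ?exprn_gt0.
pose z x : R := expR (- (c * (x - t) ^+ 2)).
have z0 x : 0 < z x by exact: expR_gt0.
have z1 x : z x <= 1.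
  by rewrite -[leRHS]expR0 ler_expR oppr_le0 mulr_ge0 ?sqr_ge0 // ltW.
(* The powers of [z] from the [M]-th on decay fast enough for the class. *)
pose M := (Num.truncn c^-1).+1.
have cM : 1 <= c * M%:R.
  have := truncnS_gt c^-1; rewrite -/M => /ltW; rewrite -ler_pdivrMl //.
  by rewrite mulr1.
pose F n x := 1 - (1 - z x ^+ (n + M)) ^+ (2 ^ (n + M)).
have zE n x : z x ^+ n = expR (- (c * n%:R * (x - t) ^+ 2)).
  by rewrite -expRM_natl; congr expR; ring.
have w01 n x : 0 <= z x ^+ n <= 1.
  by rewrite exprn_ge0 ?exprn_ile1 // ltW.
have v01 n x : 0 <= 1 - z x ^+ n <= 1 by have := w01 n x; lra.
have u01 n x k : 0 <= (1 - z x ^+ n) ^+ k <= 1.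
  by have /andP[v0 v1] := v01 n x; rewrite exprn_ge0 ?exprn_ile1.
have Fge0 n x : 0 <= F n x by rewrite /F subr_ge0; case/andP: (u01 (n + M)%N x (2 ^ (n + M))%N).
have Fle1 n x : F n x <= 1 by rewrite /F gerBl; case/andP: (u01 (n + M)%N x (2 ^ (n + M))%N).
have bernoulli (w : R) k : 0 <= w <= 1 -> 1 - (1 - w) ^+ k <= k%:R * w.
  move=> /andP[w0 w1]; elim: k => [|k IH]; first by rewrite expr0 subrr mul0r.
  rewrite exprS -natr1.
  have e1 : (1 - w) ^+ k <= 1 by rewrite exprn_ile1 ?subr_ge0 // lerBlDr lerDl.
  by move: IH e1; move: ((1 - w) ^+ k) => u IH e1; nra.
have Fle n x : F n x <= (2 * z x) ^+ (n + M).
  rewrite exprMn -natrX; exact: bernoulli.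
have domz x : (2 * z x) ^+ M <= 2 ^+ M * expR (t ^+ 2) * expR (- (x ^+ 2 / 4)).
  rewrite exprMn zE -[leRHS]mulrA ler_wpM2l ?exprn_ge0 // -expRD ler_expR.
  have h1 : 0 <= (c * M%:R - 1) * (x - t) ^+ 2 by rewrite mulr_ge0 ?sqr_ge0 ?subr_ge0.
  have := sqr_ge0 (x - 2 * t); have := sqr_ge0 x; lra.
have FleM n x : F n x <= (2 * z x) ^+ M.
  case: (leP (2 * z x) 1) => [le1|/ltW ge1].
    apply: le_trans (Fle n x) _; rewrite exprD ler_piMl ?exprn_ge0 ?mulr_ge0 ?(ltW (z0 x)) //.
    by rewrite exprn_ile1 // mulr_ge0 ?(ltW (z0 x)).
  by apply: le_trans (Fle1 n x) _; rewrite exprn_ege1.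
have z2E x : 2 * z x = expR (ln 2 * (1 - (`|x - t| / r) ^+ 2)).
  rewrite -[X in X * _](@lnK _ 2) ?posrE // -expRD; congr expR.
  by rewrite expr_div_n real_normK ?num_real // /c; field; rewrite gt_eqF.
have q0 x : 0 <= `|x - t| / r by rewrite divr_ge0 ?normr_ge0 // ltW.
have z_in x : (t - r < x < t + r) = (1 < 2 * z x).
  rewrite z2E expR_gt1 pmulr_rgt0 // subr_gt0.
  by rewrite expr_lt1 // ltr_pdivrMr // mul1r ltr_distl.
have z_out x : r < `|x - t| -> 2 * z x < 1.
  move=> rx; rewrite z2E expR_lt1 pmulr_rlt0 // subr_lt0.
  by rewrite expr_gt1 // ltr_pdivlMr // mul1r.
have Ipos x : \1_(`]t - r, t + r[%classic : set R) x = (1 < 2 * z x)%R%:R.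
  rewrite indicE -z_in; congr (nat_of_bool _)%:R.
  by apply/idP/idP => [/set_mem|xI]; [rewrite /= in_itv|apply/mem_set; rewrite /= in_itv].
apply: (@hermite_cvg_limit R F _ (2 ^+ M * expR (t ^+ 2))).
- by apply: meas_indic; exact: measurable_itv.
- move=> n; apply: hermite_cvg_one_sub => j.
  have := @hermite_cvg_gauss_at (c * ((n + M) * j.+1)%:R) t.
  rewrite (_ : (fun x => expR _) = fun x => (z x ^+ (n + M)) ^+ j.+1); last first.
    by apply/funext => x; rewrite -exprM zE.
  apply; apply: le_trans (_ : c * M%:R <= _).
    exact: cM.
  rewrite [leRHS]mulrCA ler_wpM2l ?(ltW c0) // -natrM ler_nat; nia.
- move=> x; apply: le_trans (domz x); rewrite Ipos normr_nat.
  case: ltP => [z2|_]; last by rewrite exprn_ge0 // mulr_ge0 ?(ltW (z0 x)).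
  by rewrite exprn_ege1 // ltW.
- by move=> n x; rewrite ger0_norm //; exact: le_trans (FleM n x) (domz x).
apply: filterS (filterI (ae_neq (t - r)) (ae_neq (t + r))) => x [xl xr].
rewrite Ipos.
case: (ltP 1 (2 * z x)) => [z2|].
  have bpos : 0 < 2 * z x by exact: lt_trans z2.
  have inv1 : `|(2 * z x)^-1| < 1.
    by rewrite ger0_norm ?invr_ge0 ?(ltW bpos) // invf_lt1.
  have cvg_inv : (2 * z x)^-1 ^+ (n + M) @[n --> \oo] --> (0 : R).
    by have := cvg_expr inv1; rewrite -(cvg_shiftn M).
  rewrite -[X in _ --> X]subr0; apply: cvgB; first exact: cvg_cst.
  apply: squeeze_cvgr (cvg_cst _) cvg_inv.
  apply: nearW => n; have /andP[-> _] := u01 (n + M)%N x (2 ^ (n + M))%N; rewrite /=.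
  apply: (@le_trans _ _ (expR (- (z x ^+ (n + M))) ^+ (2 ^ (n + M)))).
    have /andP[v0 _] := v01 (n + M)%N x.
    rewrite ler_pXn2r ?expn_gt0 ?nnegrE ?expR_ge0 //.
    exact: expR_ge1Dx.
  rewrite -expRM_natl mulrN natrX -exprMn expRN exprVn lef_pV2 ?posrE ?expR_gt0 ?exprn_gt0 //.
  by apply: le_trans (expR_ge1Dx _); rewrite lerDr.
move=> z2.
have {}z2 : 2 * z x < 1.
  apply: z_out; rewrite ltNge le_eqVlt negb_or; apply/andP; split.
    apply/negP => /eqP; case: (leP 0 (x - t)) => s0.
      by rewrite ger0_norm // => E; move/eqP: xr; apply; lra.
    by rewrite ltr0_norm // => E; move/eqP: xl; apply; lra.
  by rewrite ltr_distl z_in -leNgt.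
have bpos : 0 <= 2 * z x by rewrite mulr_ge0 // ltW.
have norm1 : `|2 * z x| < 1 by rewrite ger0_norm.
have cvgz : (2 * z x) ^+ (n + M) @[n --> \oo] --> (0 : R).
  by have := cvg_expr norm1; rewrite -(cvg_shiftn M).
apply: squeeze_cvgr (cvg_cst _) cvgz.
by apply: nearW => n; rewrite Fge0 Fle.
Qed.

End Completeness.

Section BoundedDense.
Variable R : realType.
Local Notation mu := (@lebesgue_measure R).
Implicit Types (f g : R -> R) (k n : nat) (x t a b : R).

Lemma hermite_cvg_ae f g : gauss_bounded f -> hermite_cvg g ->
  {ae mu, forall x, f x = g x} -> hermite_cvg f.
Proof.
move=> Gf Dg fg; apply: hermite_cvg_closed => // e e0; exists g => //.
rewrite /sqnorm /ip (@lebint_ae_eq R _ (fun=> 0)) ?lebint0 ?ltW //.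
- have mfg : meas (fun x => f x - g x) by apply: measB; [case: Gf|case: Dg => -[]].
  exact: measM.
- exact: meas_cst.
- by move: fg; apply: filterS => x ->; rewrite subrr mul0r.
Qed.

Lemma hermite_cvg_cell a b : a < b -> hermite_cvg \1_(`[a, b[%classic : set R).
Proof.
move=> ab; have r0 : 0 < (b - a) / 2 by rewrite divr_gt0 // subr_gt0.
have := hermite_cvg_itv ((a + b) / 2) r0.
rewrite (_ : _ - _ = a); last by field.
rewrite (_ : _ + (b - a) / 2 = b); last by field.
move=> D; apply: hermite_cvg_ae D _.
  apply: (@gauss_bounded_supp R _ 1 (`|a| + `|b| + 1)).
  - by apply: meas_indic; exact: measurable_itv.
  - by move=> x; rewrite indicE; case: (_ \in _); rewrite ?normr1 ?normr0.
  - move=> x xab; rewrite indicE memNset //= in_itv /=.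
    move=> /andP[ax xb]; move: xab; rewrite leNgt => /negP; apply.
    rewrite ltr_norml; have := ler_norm a; have := ler_norm b.
    have := ler_norm (- a); have := ler_norm (- b); rewrite !normrN.
    by have := normr_ge0 a; have := normr_ge0 b; lra.
apply: filterS (ae_neq a) => x /negbTE xa; rewrite !indicE; congr (nat_of_bool _)%:R.
apply/idP/idP => /set_mem; rewrite /= in_itv /= => /andP[ax xb]; apply/mem_set;
  rewrite /= in_itv /= xb andbT ?(ltW ax) //.
by rewrite lt_neqAle ax eq_sym xa.
Qed.

(** Step functions on finer and finer grids converge to a continuous function
    everywhere. *)
Lemma hermite_cvg_continuous g (T K : R) : 0 < T -> continuous g ->
  (forall x, `|g x| <= K) ->
  hermite_cvg (fun x => g x * \1_(`[- T, T[%classic : set R) x).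
Proof.
move=> T0 cg gK.
have K0 : 0 <= K by exact: le_trans (gK 0).
pose F n x := \sum_(0 <= j < n.+1) g (grid T n.+1 j) * \1_(cell T n.+1 j) x.
have in_cell x : (`[- T, T[%classic : set R) x = (- T <= x < T) by rewrite /= in_itv.
have bound (u : R) x : `|u| <= K -> - T <= x < T ->
    `|u| <= K * expR (T ^+ 2 / 4) * expR (- (x ^+ 2 / 4)).
  move=> uK /andP[Tx xT]; apply: le_trans uK _; rewrite -mulrA -expRD ler_peMr //.
  rewrite -[leLHS]expR0 ler_expR; nra.
have bound0 x : `|0 : R| <= K * expR (T ^+ 2 / 4) * expR (- (x ^+ 2 / 4)).
  by rewrite normr0 !mulr_ge0 // expR_ge0.
apply: (@hermite_cvg_limit R F _ (K * expR (T ^+ 2 / 4))).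
- apply: measM; first exact: meas_continuous.
  by apply: meas_indic; exact: measurable_itv.
- move=> n; apply: hermite_cvg_sum => j; apply: hermite_cvgZ.
  by apply: hermite_cvg_cell; apply: grid_lt.
- move=> x; rewrite indicE; case: (boolP (- T <= x < T)) => xT.
    by rewrite mem_set ?in_cell // mulr1; exact: bound.
  by rewrite memNset ?in_cell ?mulr0 //; exact/negP.
- move=> n x; rewrite /F; case: (boolP (- T <= x < T)) => xT; last by rewrite grid_sum0.
  have [j jn xj] := grid_cell T0 (ltn0Sn n) xT.
  by rewrite (grid_sum _ T0 jn xj); exact: bound.
apply: aeW => x; case: (boolP (- T <= x < T)) => xT; last first.
  rewrite indicE memNset ?in_cell; last exact/negP.
  by rewrite mulr0; apply: cvg_near_cst; apply: nearW => n; rewrite /F grid_sum0.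
rewrite indicE mem_set ?in_cell // mulr1.
apply/cvgrPdist_le => e e0.
have /cvgrPdist_le/(_ _ e0) := cg x; rewrite -filter_from_ballE => -[d /= d0 dg].
near=> n; have [j jn xj] := grid_cell T0 (ltn0Sn n) xT.
rewrite /F (grid_sum _ T0 jn xj); apply: dg.
rewrite -ball_normE /=; apply: le_lt_trans (grid_dist xj) _.
rewrite ltr_pdivrMr ?ltr0n // -ltr_pdivrMl //.
apply: lt_le_trans (_ : n%:R <= _); last by rewrite ler_nat.
near: n; exact: nbhs_infty_gtr.
Unshelve. all: by end_near. Qed.

(** Completeness. Continuous functions approximate [f] in [L1]; after clipping
    at the height [K] of [f] they approximate it in mean square as well. *)
Lemma hermite_cvg_bounded f (K T : R) : 0 < T -> meas f ->
  (forall x, `|f x| <= K) -> (forall x, T <= `|x| -> f x = 0) -> hermite_cvg f.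
Proof.
move=> T0 mf fK fT.
have K0 : 0 <= K by exact: le_trans (fK 0).
have Gf := gauss_bounded_supp mf fK fT.
apply: hermite_cvg_closed => // e e0.
pose E : set R := `[- T, T[%classic.
have mE : measurable E by exact: measurable_itv.
have muE : (mu E < +oo)%E.
  by rewrite /E lebesgue_measure_itv /=; case: ifP; rewrite ?ltry.
have iE : mu.-integrable E (EFin \o f).
  by apply: (@integrableS _ _ _ mu setT E) => //; exact: L1_gauss_bounded.
have [g_ [cg_ ig_ cvg_g]] := approximation_continuous_integrable mE muE iE.
have fE x : ~ E x -> f x = 0.
  rewrite /E /= in_itv /= => xE; apply: fT; rewrite leNgt; apply/negP => xT.
  by apply: xE; move: xT; rewrite ltr_norml => /andP[/ltW -> ->].
have [N hN] : exists n, (\int[mu]_(z in E) `|(f z - g_ n z)%:E| <= (e / (2 * K + 1))%:E)%E.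
  have e'0 : 0 < e / (2 * K + 1) by rewrite divr_gt0 // ltr_wpDl // mulr_ge0.
  have /fine_cvgP[fin] := cvg_g.
  move=> /cvgrPdist_le/(_ _ e'0) near_e.
  have [N [finN]] : exists N, (\int[mu]_(z in E) `|(f z - g_ N z)%:E|)%E \is a fin_num /\
      `|0 - fine (\int[mu]_(z in E) `|(f z - g_ N z)%:E|)%E| <= e / (2 * K + 1).
    by have [N _ HN] := filterI fin near_e; exists N; exact: HN (leqnn N).
  rewrite sub0r normrN => leN; exists N; rewrite -(fineK finN) lee_fin.
  exact: le_trans (ler_norm _) leN.
pose c x := Num.min K (Num.max (- K) (g_ N x)).
have cK x : `|c x| <= K.
  by rewrite ler_norml /c ge_min lexx le_min le_max lexx /= andbT; lra.
have fc x : `|f x - c x| <= `|f x - g_ N x|.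
  move: (fK x); rewrite /c ler_norml; set y := f x; set w := g_ N x => /andP[y1 y2].
  case: (leP (- K) w) => w1; case: (leP K _) => w2 //.
  - rewrite !ler0_norm ?subr_le0 //; lra.
  - rewrite !ger0_norm ?subr_ge0 //; lra.
  - rewrite !ger0_norm ?subr_ge0 //; lra.
have cc : continuous c.
  move=> x; apply: (@continuous_min _ _ (fun=> K) (fun x => Num.max (- K) (g_ N x))).
    exact: cvg_cst.
  apply: (@continuous_max _ _ (fun=> - K) (g_ N)); [exact: cvg_cst|exact: cg_].
have Dc : hermite_cvg (fun x => c x * \1_E x) by exact: (@hermite_cvg_continuous _ _ K).
exists (fun x => c x * \1_E x) => //.
pose phi x := `|f x - g_ N x| * \1_E x.
have phiE : EFin \o phi = (fun x => `|(f x - g_ N x)%:E|%E) \_ E.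
  by apply/funext => x; rewrite /phi /= patchE indicE; case: (x \in E); rewrite ?mulr1 ?mulr0.
have L1phi : L1 phi.
  rewrite /L1 phiE; apply: (@integrable_mkcond _ _ _ mu E _ mE).1.
  have iB := @integrableB _ _ _ mu E mE _ _ iE (ig_ N).
  exact: (@integrable_abse _ _ _ mu E _ iB).
have phi_le : lebint phi <= e / (2 * K + 1).
  rewrite -lee_fin -EFin_lebint // (_ : (fun x => (phi x)%:E) = EFin \o phi) //.
  by rewrite phiE -integral_mkcond.
have GD : gauss_bounded (fun x => f x - c x * \1_E x).
  by apply: gauss_boundedB => //; case: Dc.
apply: (@le_trans _ _ (lebint (fun x => 2 * K * phi x))).
  apply: lebint_le; [exact: gauss_boundedM_L1|exact: L1Z|] => x.
  rewrite /phi indicE; case: (boolP (x \in E)) => xE.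
    rewrite !mulr1 -expr2 -[_ ^+ 2]real_normK ?num_real // expr2 ler_pM //.
    apply: le_trans (ler_normB _ _) _; rewrite mulr_natl mulr2n; exact: lerD.
  by rewrite (fE x) ?mulr0 ?subr0 ?mulr0 // => /mem_set; exact/negP.
rewrite lebintZ //; apply: le_trans (_ : 2 * K * (e / (2 * K + 1)) <= e).
  by rewrite ler_wpM2l // mulr_ge0.
have K1 : 0 < 2 * K + 1 by rewrite ltr_wpDl // mulr_ge0.
by rewrite mulrA ler_pdivrMr //; nra.
Qed.

End BoundedDense.

(** * The weak type (1, 1) inequality for truncated Hermite sums *)

Section WeakType.
Variable R : realType.
Local Notation mu := (@lebesgue_measure R).
Local Notation h := (@hermite_fun R).
Implicit Types (f g : R -> R) (k n N : nat) (x y t l T : R).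

Lemma hermite_bounded k : exists C, forall x, `|h k x| <= C.
Proof.
have [_ [C HC]] := gauss_bounded_hermite R k; exists C => x.
apply: le_trans (HC x) _.
have C0 : 0 <= C.
  by rewrite -(pmulr_lge0 _ (expR_gt0 (- (0 ^+ 2 / 4)))) (le_trans _ (HC 0)).
by rewrite ler_piMr // -[leRHS]expR0 ler_expR oppr_le0 divr_ge0 ?sqr_ge0.
Qed.

Lemma hermite_lipschitz k : exists C, forall x y, `|h k x - h k y| <= C * `|x - y|.
Proof.
have [C HC] := hermite_bounded k.-1; have [D HD] := hermite_bounded k.+1.
pose B := Num.sqrt (k%:R / 2) * C + Num.sqrt (k.+1%:R / 2) * D.
have HB x : `|hermite' k x| <= B.
  rewrite (le_trans (ler_normB _ _)) // !normrM !(ger0_norm (sqrtr_ge0 _)).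
  by rewrite lerD // ler_wpM2l ?sqrtr_ge0.
exists B => x y; wlog xy : x y / x <= y.
  by move=> W; case: (leP x y) => [/W//|/ltW/W]; rewrite (distrC (h k x)) (distrC x).
have [|c _ E] := @MVT_segment R (h k) (hermite' k) x y xy (fun z _ => is_derive_hermite k z).
  exact/continuous_subspaceT/continuous_hermite.
by rewrite distrC E normrM (distrC x) ler_wpM2r.
Qed.

(** Only the existence of a constant matters, and it may depend on [n]: the
    grid on which [f] is discretised is chosen after [n]. *)
Lemma hermite_kernel_lipschitz n : exists2 C, 0 <= C & forall x y y',
  `|hermite_kernel n x y - hermite_kernel n x y'| <= C * `|y - y'|.
Proof.
rewrite /hermite_kernel; elim: n.+1 => [|m [C C0 HC]].
  by exists 0 => // x y y'; rewrite !big_geq // subrr normr0 mul0r.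
have [D HD] := hermite_bounded m; have [L HL] := hermite_lipschitz m.
have D0 : 0 <= D by exact: le_trans (HD 0).
have L0 : 0 <= L by have := HL 1 0; rewrite subr0 normr1 mulr1; exact: le_trans.
exists (C + D * L); first by rewrite addr_ge0 ?mulr_ge0.
move=> x y y'; rewrite !big_nat_recr //= opprD addrACA -mulrBr mulrDl.
rewrite (le_trans (ler_normD _ _)) // lerD // normrM -mulrA.
by rewrite ler_pM.
Qed.

Lemma L1_bounded_mul f g (C : R) : L1 f -> meas g -> (forall x, `|g x| <= C) ->
  L1 (fun x => f x * g x).
Proof.
move=> Lf mg gC; apply: (L1_le (g := fun x => C * `|f x|)).
- by apply: measM => //; exact: L1_meas.
- by move=> x; rewrite normrM mulrC ler_wpM2r.
- exact/L1Z/L1_norm.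
Qed.

Lemma meas_hermite k : meas (h k).
Proof. by case: (gauss_bounded_hermite R k). Qed.

Lemma L1_mul_hermite f k : L1 f -> L1 (fun x => f x * h k x).
Proof.
by move=> Lf; have [C HC] := hermite_bounded k; exact: L1_bounded_mul Lf (meas_hermite k) HC.
Qed.

Lemma L1_mul_kernel f n x : L1 f -> L1 (fun y => f y * hermite_kernel n x y).
Proof.
move=> Lf; have := @L1_sum R _ (index_iota 0 n.+1)
  (fun k y => h k x * (f y * h k y)) (fun k => L1Z _ (L1_mul_hermite k Lf)).
congr L1; apply/funext => y; rewrite mulr_sumr; apply: eq_bigr => k _; ring.
Qed.

Lemma hsum_kernel n f x : L1 f ->
  hsum n f x = lebint (fun y => f y * hermite_kernel n x y).
Proof.
move=> Lf; transitivity (lebint (fun y => \sum_(0 <= k < n.+1) h k x * (f y * h k y))).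
  rewrite lebint_sum; last by move=> k; exact/L1Z/L1_mul_hermite.
  by apply: eq_bigr => k _; rewrite lebintZ ?(mulrC (h k x)) //; exact: L1_mul_hermite.
congr lebint; apply/funext => y; rewrite mulr_sumr; apply: eq_bigr => k _; ring.
Qed.

(** On functions supported in [(- T, T)] this is the truncated Hermite sum
    [chi S_n (chi f)]. *)
Definition ksum n T f x : R := \1_(`]- T, T[%classic : set R) x * hsum n f x.

Lemma meas_hsum n f : meas (hsum n f).
Proof. by case: (gauss_bounded_hsum n f). Qed.

Lemma meas_ksum n T f : meas (ksum n T f).
Proof.
by apply: measM; [apply: meas_indic; exact: measurable_itv|exact: meas_hsum].
Qed.

(** Division is discontinuous at [t]; the reciprocal is written as
    [(x - t) * ((x - t) ^ 2) ^ (- 1)], a product of measurable functions. *)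
Lemma meas_inv_sub t : meas (fun x : R => (x - t)^-1).
Proof.
have mt : meas (fun x : R => x - t) by apply: measB; [exact: measurable_id|exact: meas_cst].
have mp : meas (fun x : R => ((x - t) ^+ 2) `^ (-1)).
  apply: (@measurableT_comp _ _ _ _ _ _ (fun u : R => u `^ (-1)) _ (fun x : R => (x - t) ^+ 2)).
    exact: measurable_powR.
  exact: (measX 2 mt).
have := measM mt mp; congr meas; apply/funext => x /=.
rewrite powR_inv1 ?sqr_ge0 //; case: (eqVneq (x - t) 0) => [->|xt].
  by rewrite mul0r invr0.
by field.
Qed.

Lemma meas_cauchy_sum (s : seq R) (m : R -> R) : meas (cauchy_sum s m).
Proof.
by apply: meas_sum => t; apply: measM; [exact: meas_cst|exact: meas_inv_sub].
Qed.

(** Replacing [f] by atoms on a grid: the mass of each cell is moved to its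
    left end. *)
Lemma atomic_approx n T f N x (L : R) : 0 < T -> (0 < N)%N -> L1 f ->
  (forall y, ~~ (- T <= y < T) -> f y = 0) -> 0 <= L ->
  (forall x y y', `|hermite_kernel n x y - hermite_kernel n x y'| <= L * `|y - y'|) ->
  `|\sum_(0 <= j < N) lebint (fun y => f y * \1_(cell T N j) y) *
       hermite_kernel n x (grid T N j) - hsum n f x|
  <= L * (2 * T / N%:R) * lebint (fun y => `|f y|).
Proof.
move=> T0 N0 Lf f0 L0 HL; set H := hermite_kernel n x.
have mI j : meas (\1_(cell T N j) : R -> R) by apply: meas_indic; exact: measurable_cell.
have LI j : L1 (fun y => f y * \1_(cell T N j) y).
  apply: (L1_bounded_mul (C := 1) Lf (mI j)) => y.
  by rewrite indicE; case: (_ \in _); rewrite ?normr1 ?normr0.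
have E1 : \sum_(0 <= j < N) lebint (fun y => f y * \1_(cell T N j) y) * H (grid T N j) =
    lebint (fun y => \sum_(0 <= j < N) H (grid T N j) * (f y * \1_(cell T N j) y)).
  rewrite lebint_sum; last by move=> j; exact: L1Z.
  by apply: eq_bigr => j _; rewrite lebintZ // mulrC.
have LS : L1 (fun y => \sum_(0 <= j < N) H (grid T N j) * (f y * \1_(cell T N j) y)).
  by apply: L1_sum => j; exact: L1Z.
have LK := L1_mul_kernel n x Lf.
rewrite E1 hsum_kernel // -lebintB //.
apply: le_trans (lebint_norm_le (L1B LS LK)) _.
rewrite -lebintZ; last exact: L1_norm.
apply: lebint_le; [exact/L1_norm/L1B|exact/L1Z/L1_norm|] => y.
case: (boolP (- T <= y < T)) => yT; last first.
  rewrite f0 // mul0r subr0 normr0 mulr0 big1 ?normr0 // => j _.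
  by rewrite mul0r mulr0.
have [j jN yj] := grid_cell T0 N0 yT.
have -> : \sum_(0 <= i < N) H (grid T N i) * (f y * \1_(cell T N i) y) =
    f y * H (grid T N j).
  rewrite -(grid_sum (fun i => H (grid T N i)) T0 jN yj) mulr_sumr.
  by apply: eq_bigr => i _; ring.
rewrite -mulrBr normrM mulrC ler_wpM2r // (le_trans (HL _ _ _)) // ler_wpM2l //.
by rewrite distrC; exact: grid_dist.
Qed.

Lemma sum_cell_mass_le T N f : 0 < T -> (0 < N)%N -> L1 f ->
  \sum_(0 <= j < N) `|lebint (fun y => f y * \1_(cell T N j) y)| <=
  lebint (fun y => `|f y|).
Proof.
move=> T0 N0 Lf.
have mI j : meas (\1_(cell T N j) : R -> R) by apply: meas_indic; exact: measurable_cell.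
have LI j : L1 (fun y => f y * \1_(cell T N j) y).
  apply: (L1_bounded_mul (C := 1) Lf (mI j)) => y.
  by rewrite indicE; case: (_ \in _); rewrite ?normr1 ?normr0.
apply: (@le_trans _ _ (\sum_(0 <= j < N) lebint (fun y => `|f y * \1_(cell T N j) y|))).
  by apply: ler_sum => j _; exact: lebint_norm_le.
rewrite -lebint_sum; last by move=> j; exact: L1_norm.
apply: lebint_le; [by apply: L1_sum => j; exact: L1_norm|exact: L1_norm|] => y.
under eq_bigr do rewrite normrM [X in _ * X]ger0_norm //.
case: (boolP (- T <= y < T)) => yT; last by rewrite grid_sum0.
by have [j jN yj] := grid_cell T0 N0 yT; rewrite (grid_sum _ T0 jN yj).
Qed.

(** By the Christoffel-Darboux formula the truncated sum of an atomic measure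
    is a combination, with bounded coefficients, of two Cauchy sums. *)
Lemma ksum_weak11 n T f l : 0 < T -> T ^+ 2 <= n%:R -> L1 f ->
  (forall x, ~~ (- T < x < T) -> f x = 0) -> 0 < l ->
  (mu [set x | (l < `|ksum n T f x|)%R] <= (128 * lebint (fun x => `|f x|) / l)%:E)%E.
Proof.
move=> T0 Tn Lf f0 l0.
have f0' x : ~~ (- T <= x < T) -> f x = 0.
  move=> xT; apply: f0; apply: contra xT => /andP[Tx ->].
  by rewrite (ltW Tx).
have [L L0 HL] := hermite_kernel_lipschitz n.
have A0 : 0 <= lebint (fun x => `|f x|) by apply: lebint_ge0.
pose A := lebint (fun x => `|f x|); rewrite -/A in A0 *.
(* So fine that the discretisation error is at most l / 2 everywhere. *)
pose N := (Num.truncn (L * (2 * T) * A / (l / 2))).+1.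
have N0 : (0 < N)%N by [].
have errN : L * (2 * T / N%:R) * A <= l / 2.
  have l20 : 0 < l / 2 by rewrite divr_gt0.
  have := truncnS_gt (L * (2 * T) * A / (l / 2)); rewrite -/N ltr_pdivrMr // => /ltW.
  rewrite [N%:R * _]mulrC -ler_pdivrMr ?ltr0n //.
  by congr (_ <= _); rewrite -!mulrA; congr (_ * (_ * (_ * _))); rewrite mulrC.
pose d := 2 * T / N%:R.
pose s := [seq grid T N j | j <- index_iota 0 N].
pose m t := lebint (fun y => f y * \1_(`[t, t + d[%classic : set R) y).
have gridS j : grid T N j.+1 = grid T N j + d by rewrite /grid -natr1 -/d; ring.
have mE j : lebint (fun y => f y * \1_(cell T N j) y) = m (grid T N j).
  by rewrite /m /cell gridS.
have us : uniq s.
  rewrite map_inj_uniq ?iota_uniq // => i j.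
  case: (ltngtP i j) => // ij E.
    by have := grid_lt T0 N0 ij; rewrite E ltxx.
  by have := grid_lt T0 N0 ij; rewrite E ltxx.
have sT t : t \in s -> t ^+ 2 <= n%:R.
  move=> /mapP[j]; rewrite mem_index_iota => /andP[_ jN] ->.
  by have /andP[a b] := grid_bound T0 jN; apply: le_trans Tn; nra.
have mass : \sum_(t <- s) `|m t| <= A.
  rewrite big_map; apply: le_trans (sum_cell_mass_le T0 N0 Lf).
  by apply: ler_sum => j _; rewrite mE.
pose u x := cd_scale R n * h n.+1 x; pose v x := cd_scale R n * h n x.
have ub x : x ^+ 2 <= n%:R -> `|u x| <= 2.
  by move=> xn; apply: (@cd_scale_bound R n) => //; rewrite leqnSn leqnn.
have vb x : x ^+ 2 <= n%:R -> `|v x| <= 2.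
  by move=> xn; apply: (@cd_scale_bound R n) => //; rewrite leqnSn leqnn.
pose g1 := cauchy_sum s (fun t => m t * v t).
pose g2 := cauchy_sum s (fun t => m t * u t).
pose E : set R := [set x | (l < `|ksum n T f x|)%R].
have mE' : measurable E.
  have := meas_norm (meas_ksum n T f) => /(_ measurableT _ (measurable_itv `]l, +oo[)).
  by rewrite setTI; congr measurable; apply/seteqP; split => x /=; rewrite in_itv /= andbT.
have msup (g : R -> R) : meas g -> measurable (E `&` [set x | l / 8 < `|g x|]).
  move=> mg; apply: measurableI => //.
  have := meas_norm mg => /(_ measurableT _ (measurable_itv `]l / 8, +oo[)).
  by rewrite setTI; congr measurable; apply/seteqP; split => x /=; rewrite in_itv /= andbT.
have g1m : meas g1 by exact: meas_cauchy_sum.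
have g2m : meas g2 by exact: meas_cauchy_sum.
pose E2 := E `&` [set x | l / 8 < `|g2 x|]; pose E1 := E `\` E2.
have mE2 : measurable E2 by exact: msup.
have mE1 : measurable E1 by exact: measurableD.
have sum_mass (w : R -> R) : (forall x, x ^+ 2 <= n%:R -> `|w x| <= 2) ->
    \sum_(t <- s) `|m t * w t| <= 2 * A.
  move=> wb; apply: (@le_trans _ _ (\sum_(t <- s) 2 * `|m t|)); last first.
    by rewrite -mulr_sumr ler_wpM2l.
  rewrite !big_seq; apply: ler_sum => t /sT ts.
  by rewrite normrM mulrC ler_wpM2r // wb.
have key x : E x -> x \notin s -> l / 8 < `|g1 x| \/ l / 8 < `|g2 x|.
  rewrite /E /= /ksum => Ex xs.
  have xT : - T < x < T.
    apply: contraLR Ex => xT; rewrite -leNgt indicE memNset ?mul0r ?normr0 ?ltW //.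
    by rewrite /= in_itv /=; exact/negP.
  have xn : x ^+ 2 <= n%:R by apply: le_trans Tn; move: xT => /andP[a b]; nra.
  move: Ex; rewrite indicE mem_set ?mul1r; last by rewrite /= in_itv.
  move=> Ex.
  have := atomic_approx x T0 N0 Lf f0' L0 HL; rewrite -/A => /le_trans/(_ errN).
  have -> : \sum_(0 <= j < N) lebint (fun y => f y * \1_(cell T N j) y) *
      hermite_kernel n x (grid T N j) = u x * g1 x - v x * g2 x.
    transitivity (\sum_(t <- s) m t * hermite_kernel n x t).
      by rewrite big_map; apply: eq_bigr => j _; rewrite mE.
    rewrite /g1 /g2 /cauchy_sum !mulr_sumr -sumrB; apply: eq_big_seq => t ts.
    have xt : x - t != 0 by rewrite subr_eq0; apply: contraNneq xs => ->.
    apply: (mulfI xt); rewrite mulrCA christoffel_darboux -/(u x) -/(v x).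
    rewrite -/(u t) -/(v t); by field.
  move=> err.
  have {err} : l / 2 < `|u x * g1 x - v x * g2 x|.
    have := ler_dist_dist (hsum n f x) (u x * g1 x - v x * g2 x).
    by rewrite distrC => /le_trans/(_ err); rewrite ler_norml => /andP[_]; lra.
  case: (ltP (l / 8) `|g1 x|) => g1l; first by left.
  case: (ltP (l / 8) `|g2 x|) => g2l; first by right.
  have : `|u x * g1 x - v x * g2 x| <= 2 * (l / 8) + 2 * (l / 8).
    apply: le_trans (ler_normB _ _) _; rewrite (normrM (u x)) (normrM (v x)).
    by apply: lerD; apply: ler_pM => //; [exact: ub|exact: vb].
  by lra.
have l80 : 0 < l / 8 by rewrite divr_gt0.
have b1 : (mu E1 <= (4 * (2 * A) / (l / 8))%:E)%E.
  apply: le_trans (cauchy_sum_weak11 us l80 mE1 (m := fun t => m t * v t) _) _.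
    by move=> x [Ex nE2] xs; have [//|g2l] := key x Ex xs; case: nE2.
  rewrite lee_fin ler_wpM2r ?invr_ge0 ?(ltW l80) // ler_wpM2l //.
  exact: sum_mass.
have b2 : (mu E2 <= (4 * (2 * A) / (l / 8))%:E)%E.
  apply: le_trans (cauchy_sum_weak11 us l80 mE2 (m := fun t => m t * u t) _) _.
    by move=> x [].
  rewrite lee_fin ler_wpM2r ?invr_ge0 ?(ltW l80) // ler_wpM2l //.
  exact: sum_mass.
rewrite -/E; have -> : E = E1 `|` E2 by rewrite /E1 setUC setDUK // => x [].
apply: le_trans (measureU2 _ _ _) _; [exact: mE1|exact: mE2|].
apply: le_trans (leeD b1 b2) _.
rewrite -EFinD lee_fin le_eqVlt; apply/orP; left; apply/eqP.
by field; rewrite gt_eqF.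
Qed.

End WeakType.

(** * Marcinkiewicz interpolation for a modular *)

Lemma expn_unbounded (R : realType) (b z : R) : 1 < b -> exists k, z <= b ^+ k.
Proof.
move=> b1; exists (Num.truncn (z / (b - 1))).+1.
have b10 : 0 < b - 1 by rewrite subr_gt0.
have := truncnS_gt (z / (b - 1)); move: (_.+1) => k /ltW; rewrite ler_pdivrMr // => zk.
apply: le_trans zk _; elim: k => [|k IH]; first by rewrite mul0r.
have bk1 : 1 <= b ^+ k by rewrite exprn_ege1 // ltW.
rewrite exprS -[k.+1%:R]natr1.
have : 0 <= (b - 1) * (b ^+ k - 1) by rewrite mulr_ge0 ?subr_ge0 // ltW.
by move: IH; lra.
Qed.

Section Interpolation.
Variable R : realType.
Local Notation mu := (@lebesgue_measure R).
Implicit Types (f g : R -> R) (x t s y : R).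

Lemma L1_indic (E : set R) : measurable E -> (mu E < +oo)%E -> L1 (\1_E).
Proof.
move=> mE Eoo; apply/integrableP; split.
  by apply/measurable_EFinP; exact: meas_indic.
under eq_integral do rewrite /= ger0_norm //.
by rewrite integral_indic // setIT.
Qed.

Lemma lebint_indicE (E : set R) : measurable E -> (mu E < +oo)%E ->
  (lebint \1_E)%:E = mu E :> \bar R.
Proof.
move=> mE Eoo; rewrite -EFin_lebint; last exact: L1_indic.
by rewrite integral_indic // setIT.
Qed.

Lemma measurable_superlevel f t : meas f -> measurable [set x | (t < f x)%R].
Proof.
move=> mf; have := mf measurableT _ (measurable_itv `]t, +oo[).
by rewrite setTI; congr measurable; apply/seteqP; split => x /=; rewrite in_itv /= andbT.
Qed.

(** [B] behaves like a Young function whose growth lies strictly between [t]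
    and [t ^ q]; both gaps are visible at the single scale ratio [b]. *)
Record intermediate_growth (B : R -> R) (b D : R) (q : nat) : Prop := {
  growth_b_gt1 : 1 < b ;
  growth_D_gt0 : 0 < D ;
  growth_bq : 2 * D <= b ^+ q ;
  growth0 : B 0 = 0 ;
  growth_ge0 : forall t, 0 <= t -> 0 <= B t ;
  growth_ratio : forall s t, 0 < s -> s <= t -> B s / s <= B t / t ;
  growth_doubling : forall t, 0 < t -> B (b * t) <= D * B t ;
  growth_nabla : forall t, 0 < t -> B t <= B (b * t) / (2 * b) }.

Section Geometric.
Variables (B : R -> R) (b D : R) (q : nat).
Hypothesis hB : intermediate_growth B b D q.

Let b_gt1 : 1 < b := growth_b_gt1 hB.
Let D_gt0 : 0 < D := growth_D_gt0 hB.
Let bq : 2 * D <= b ^+ q := growth_bq hB.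
Let B_ge0 : forall t, 0 <= t -> 0 <= B t := growth_ge0 hB.
Let B_ratio := growth_ratio hB.
Let B_doubling := growth_doubling hB.
Let B_nabla := growth_nabla hB.

Let b_gt0 : 0 < b. Proof. exact: lt_trans b_gt1. Qed.
Let bX_gt0 i : 0 < b ^+ i. Proof. by rewrite exprn_gt0. Qed.

Lemma growth_ndecr s t : 0 < s -> s <= t -> B s <= B t.
Proof.
move=> s0 st; have t0 : 0 < t by exact: lt_le_trans st.
have := B_ratio s0 st; rewrite ler_pdivrMr // => /le_trans; apply.
rewrite mulrAC -mulrA; apply: ler_piMr; first by rewrite B_ge0 // ltW.
by rewrite ler_pdivrMr // mul1r.
Qed.

(** Small scales: the ratios [B (b s) / s] at least double at each step, so the
    sum is dominated by its last term. *)
Lemma sum_below s0 y M : 0 < s0 -> 0 < y ->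
  \sum_(0 <= i < M) (s0 * b ^+ i < y)%R%:R * (B (s0 * b ^+ i.+1) / (s0 * b ^+ i))
    <= 2 * D * (B y / y).
Proof.
move=> s00 y0; pose r i := B (s0 * b ^+ i.+1) / (s0 * b ^+ i).
have sp i : 0 < s0 * b ^+ i by rewrite mulr_gt0.
have r_ge0 i : 0 <= r i by rewrite divr_ge0 ?B_ge0 // ltW.
have r_double i : 2 * r i <= r i.+1.
  rewrite /r; have := B_nabla (sp i.+1); rewrite mulrCA -exprS => h.
  apply: (@le_trans _ _ (2 * (B (s0 * b ^+ i.+2) / (2 * b) / (s0 * b ^+ i)))).
    by rewrite ler_wpM2l // ler_wpM2r // invr_ge0 ltW.
  rewrite le_eqVlt; apply/orP; left; apply/eqP.
  move: (B _) => v; rewrite exprS.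
  by field; rewrite !gt_eqF.
have geom m : \sum_(0 <= i < m.+1) r i <= 2 * r m.
  elim: m => [|m IH]; first by rewrite big_nat1 ler_peMl // ler1n.
  by rewrite big_nat_recr //=; move: IH (r_double m); lra.
have By0 : 0 <= B y / y by rewrite divr_ge0 ?B_ge0 ?ltW.
have D20 : 0 <= 2 * D by rewrite mulr_ge0 // ltW.
elim: M => [|M IH]; first by rewrite big_geq // mulr_ge0.
case: (ltP (s0 * b ^+ M) y) => sy; last first.
  by rewrite big_nat_recr //= ltNge sy mul0r addr0.
apply: le_trans (_ : 2 * r M <= _).
  apply: le_trans (geom M); apply: ler_sum => i _.
  by apply: ler_piMl; [exact: r_ge0|rewrite lern1 leq_b1].
rewrite -mulrA ler_wpM2l //; apply: le_trans (_ : D * (B (s0 * b ^+ M) / (s0 * b ^+ M)) <= _).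
  rewrite mulrA ler_wpM2r ?invr_ge0 ?(ltW (sp _)) // exprS mulrCA; exact: B_doubling.
by rewrite ler_wpM2l ?(ltW D_gt0) // B_ratio // ltW.
Qed.

(** As [D <= b ^ q], one step of the doubling condition does not increase
    [B s / s ^ q]; the constant accounts for the last, incomplete step. *)
Lemma quasi_decreasing s y : 0 < y -> y <= s -> B s / s ^+ q <= D * (B y / y ^+ q).
Proof.
move=> y0 ys; have [m sm] : exists m, s <= b ^+ m * y.
  have [m] := expn_unbounded (s / y) b_gt1; rewrite ler_pdivrMr // => sm; by exists m.
have pos_q (u : R) : 0 < u -> 0 < u ^+ q by move=> ?; rewrite exprn_gt0.
have By0 : 0 <= B y / y ^+ q by rewrite divr_ge0 ?B_ge0 ?ltW // pos_q.
have near_case u : y <= u -> u <= b * y -> B u / u ^+ q <= D * (B y / y ^+ q).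
  move=> yu uby; have u0 : 0 < u by exact: lt_le_trans yu.
  rewrite mulrA; apply: ler_pM.
  - by rewrite B_ge0 // ltW.
  - by rewrite invr_ge0 ltW // pos_q.
  - by apply: le_trans (B_doubling y0); exact: growth_ndecr.
  - by rewrite lef_pV2 ?posrE ?pos_q // lerXn2r // nnegrE ltW.
elim: m s ys sm => [|m IH] s ys sm.
  by apply: near_case; rewrite // (le_trans sm) // expr0 ler_pM2r // ltW.
case: (leP s (b * y)) => sb; first exact: near_case.
have s0 : 0 < s by exact: lt_le_trans ys.
have sb0 : 0 < s / b by rewrite divr_gt0.
have ysb : y <= s / b by rewrite ler_pdivlMr // mulrC ltW.
have sbm : s / b <= b ^+ m * y by rewrite ler_pdivrMr // mulrAC -exprSr.
have {IH} := IH _ ysb sbm; have := B_doubling sb0; rewrite mulrCA divff ?gt_eqF // mulr1.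
rewrite expr_div_n invf_div mulrCA => Bs IH.
have q0 := pos_q _ s0; have bq0 := pos_q _ b_gt0.
apply: le_trans IH; apply: (@le_trans _ _ (D * (B (s / b) / s ^+ q))).
  by rewrite mulrA ler_wpM2r // invr_ge0 ltW.
have u0 : 0 <= B (s / b) / s ^+ q by rewrite divr_ge0 ?B_ge0 ?ltW.
rewrite ler_wpM2r //; apply: le_trans bq.
by rewrite ler_peMl ?ler1n // ltW.
Qed.

(** Large scales: the ratios [B (b s) / s ^ q] at least halve at each step,
    because [2 D <= b ^ q], so the sum is dominated by its first term. *)
Lemma sum_above s0 y M : 0 < s0 -> 0 < y ->
  \sum_(0 <= i < M) (y <= s0 * b ^+ i)%R%:R * (B (s0 * b ^+ i.+1) / (s0 * b ^+ i) ^+ q)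
    <= 2 * D ^+ 2 * (B y / y ^+ q).
Proof.
move=> s00 y0; pose w s := B (b * s) / s ^+ q.
have pos_q (u : R) : 0 < u -> 0 < u ^+ q by move=> ?; rewrite exprn_gt0.
have w_ge0 s : 0 < s -> 0 <= w s.
  by move=> sp; rewrite divr_ge0 ?B_ge0 ?ltW ?mulr_gt0 ?pos_q.
have w_half s : 0 < s -> 2 * w (b * s) <= w s.
  move=> sp; have bs0 : 0 < b * s by rewrite mulr_gt0.
  have bq0 := pos_q _ b_gt0.
  apply: (@le_trans _ _ (2 * (D * B (b * s) / (b * s) ^+ q))).
    by rewrite ler_wpM2l // ler_wpM2r ?invr_ge0 ?(ltW (pos_q _ bs0)) // B_doubling.
  rewrite exprMn invfM /w; apply: (@le_trans _ _ ((2 * D / b ^+ q) * (B (b * s) / s ^+ q))).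
    by rewrite le_eqVlt; apply/orP; left; apply/eqP; ring.
  by rewrite ler_piMl ?w_ge0 // ler_pdivrMr // mul1r.
have geom m s : 0 < s -> \sum_(0 <= i < m) w (s * b ^+ i) <= 2 * w s.
  elim: m s => [|m IH] s sp; first by rewrite big_geq // mulr_ge0 ?w_ge0.
  rewrite big_nat_recl // expr0 mulr1.
  have bs0 : 0 < b * s by rewrite mulr_gt0.
  have := IH _ bs0; have := w_half _ sp.
  have -> : \sum_(0 <= i < m) w (b * s * b ^+ i) = \sum_(0 <= i < m) w (s * b ^+ i.+1).
    by apply: eq_bigr => i _; congr w; rewrite exprS; ring.
  by lra.
have w_le s : 0 < s -> y <= s -> 2 * w s <= 2 * D ^+ 2 * (B y / y ^+ q).
  move=> sp ys; rewrite -mulrA ler_wpM2l // expr2 -mulrA.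
  apply: (@le_trans _ _ (D * (B s / s ^+ q))).
    by rewrite mulrA ler_wpM2r ?invr_ge0 ?(ltW (pos_q _ sp)) // B_doubling.
  by rewrite ler_wpM2l ?(ltW D_gt0) // quasi_decreasing.
rewrite (eq_bigr (fun i => (y <= s0 * b ^+ i)%R%:R * w (s0 * b ^+ i))); last first.
  by move=> i _; rewrite /w (exprS b i) [b * (s0 * _)]mulrCA.
have By0 : 0 <= B y / y ^+ q by rewrite divr_ge0 ?B_ge0 ?ltW ?pos_q.
have D20 : 0 <= 2 * D ^+ 2 by rewrite mulr_ge0 // exprn_ge0 // ltW.
elim: M s0 s00 => [|M IH] s0 s00; first by rewrite big_geq // mulr_ge0.
case: (leP y s0) => ys.
  apply: le_trans (w_le _ s00 ys); apply: le_trans (geom M.+1 _ s00).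
  apply: ler_sum => i _; apply: ler_piMl; last by rewrite lern1 leq_b1.
  by rewrite w_ge0 // mulr_gt0.
rewrite big_nat_recl // expr0 mulr1 (lt_geF ys) mul0r add0r.
have := IH (s0 * b) (mulr_gt0 s00 b_gt0).
by under eq_bigr do rewrite -mulrA -exprS.
Qed.

Lemma layer_cake s0 M t : 0 < s0 -> s0 < t -> t <= s0 * b ^+ M ->
  B t <= \sum_(0 <= i < M) B (s0 * b ^+ i.+1) * (s0 * b ^+ i < t)%R%:R.
Proof.
move=> s00 st; have t0 : 0 < t by exact: lt_trans st.
have sp i : 0 < s0 * b ^+ i by rewrite mulr_gt0.
elim: M => [|M IH] tM; first by move: st; rewrite ltNge -[leRHS]mulr1 -(expr0 b) tM.
rewrite big_nat_recr //=; case: (ltP (s0 * b ^+ M) t) => tsM; last first.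
  by rewrite mulr0 addr0; exact: IH.
rewrite mulr1 ler_wpDl //; last exact: growth_ndecr.
by apply: sumr_ge0 => i _; rewrite mulr_ge0 // B_ge0 // ltW.
Qed.

End Geometric.

Definition supported (T : R) f := forall x, ~~ (- T < x < T) -> f x = 0.

(** An operator on functions supported in [(- T, T)] with the two endpoint
    bounds of the Marcinkiewicz theorem. Boundedness of [K f] is qualitative. *)
Record weak_strong (K : (R -> R) -> R -> R) (T C1 C2 : R) (q : nat) : Prop := {
  ws_C1 : 0 <= C1 ;
  ws_C2 : 0 <= C2 ;
  ws_add : forall f g, L1 f -> L1 g -> forall x, K (fun x => f x + g x) x = K f x + K g x ;
  ws_meas : forall f, meas (K f) ;
  ws_bounded : forall f, exists C, forall x, `|K f x| <= C ;
  ws_supp : forall f, supported T (K f) ;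
  ws_weak : forall f l, L1 f -> supported T f -> 0 < l ->
    (mu [set x | (l < `|K f x|)%R] <= (C1 * lebint (fun x => `|f x|) / l)%:E)%E ;
  ws_strong : forall f C, meas f -> (forall x, `|f x| <= C) -> supported T f ->
    lebint (fun x => `|K f x| ^+ q) <= C2 * lebint (fun x => `|f x| ^+ q) }.

Lemma L1_supported T C f : meas f -> (forall x, `|f x| <= C) -> supported T f -> L1 f.
Proof.
move=> mf fC fT; apply: L1_gauss_bounded.
apply: (gauss_bounded_supp (T := T) mf fC) => x xT; apply: fT.
by apply/negP; rewrite -ltr_norml ltNge xT.
Qed.

Lemma measurable_itvT (T : R) : measurable (`]- T, T[%classic : set R).
Proof. exact: measurable_itv. Qed.

Lemma mu_itvT (T : R) : (mu (`]- T, T[%classic : set R)%R < +oo)%E.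
Proof. by rewrite lebesgue_measure_itv /=; case: ifP; rewrite ?ltry. Qed.

End Interpolation.

Section Marcinkiewicz.
Variable R : realType.
Local Notation mu := (@lebesgue_measure R).
Implicit Types (f g : R -> R) (x t s y : R).

Variables (K : (R -> R) -> R -> R) (T C1 C2 : R) (q : nat).
Hypotheses (q_gt0 : (0 < q)%N) (hK : weak_strong K T C1 C2 q).

Let finite_superlevel (F : R -> R) t : 0 <= t -> supported T F ->
  [set x | (t < `|F x|)%R] `<=` `]- T, T[%classic.
Proof.
move=> t0 FT x /= tF; rewrite in_itv /=; apply: contraLR tF => /FT ->.
by rewrite normr0 -leNgt.
Qed.

Let superlevel_lty (F : R -> R) t : meas F -> 0 <= t -> supported T F ->
  (mu [set x | (t < `|F x|)%R] < +oo)%E.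
Proof.
move=> mF t0 FT; apply: le_lt_trans (mu_itvT T).
apply: le_measure; rewrite ?inE; last exact: finite_superlevel.
  exact: measurable_superlevel (meas_norm mF).
exact: measurable_itvT.
Qed.

Let L1_pow f : supported T (K f) -> L1 (fun x => `|K f x| ^+ q).
Proof.
move=> sT; have [C HC] := ws_bounded hK f.
have C0 : 0 <= C by exact: le_trans (HC 0).
apply: (@L1_supported _ T (C ^+ q)).
- by apply: measX; apply: meas_norm; exact: ws_meas hK _.
- by move=> x; rewrite normrX normr_id lerXn2r ?nnegrE.
- by move=> x /sT ->; rewrite normr0 expr0n gtn_eqF.
Qed.

(** The part of [f] above the height [s] is measured in [L1], through the weak
    type, and the rest in [Lq], through the strong type. *)
Lemma superlevel_split f s : L1 f -> supported T f -> 0 < s ->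
  lebint (\1_[set x | (s < `|K f x| / 2)%R]) <=
  C1 / s * lebint (fun x => `|f x| * (s < `|f x|)%R%:R) +
  C2 / s ^+ q * lebint (fun x => `|f x| ^+ q * (`|f x| <= s)%R%:R).
Proof.
move=> Lf fT s0; have mf := L1_meas Lf.
pose E : set R := [set x | (s < `|f x|)%R].
have mE : measurable E by exact: measurable_superlevel (meas_norm mf).
have EP x : (x \in E) = (s < `|f x|) by apply/idP/idP; rewrite inE.
pose f1 x := f x * \1_E x; pose f2 x := f x * (1 - \1_E x).
have m1 : meas f1 by apply: measM => //; exact: meas_indic.
have m2 : meas f2.
  by apply: measM => //; apply: measB; [exact: meas_cst|exact: meas_indic].
have f1T : supported T f1 by move=> x /fT; rewrite /f1 => ->; rewrite mul0r.
have f2T : supported T f2 by move=> x /fT; rewrite /f2 => ->; rewrite mul0r.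
have f1E x : `|f1 x| = `|f x| * (s < `|f x|)%R%:R.
  by rewrite /f1 indicE EP normrM normr_nat.
have f2E x : `|f2 x| = `|f x| * (`|f x| <= s)%R%:R.
  by rewrite /f2 indicE EP ltNge; case: leP => _ /=;
     rewrite ?subr0 ?subrr ?mulr1 ?mulr0 ?normr0.
have f2s x : `|f2 x| <= s.
  by rewrite f2E; case: (leP `|f x| s) => ?; rewrite ?mulr1 ?mulr0 // ltW.
have L1f1 : L1 f1.
  apply: L1_le (L1_norm Lf) => // x; rewrite f1E ler_piMr //.
  by rewrite lern1 leq_b1.
have L1f2 : L1 f2 by exact: L1_supported f2s f2T.
have Kadd x : K f x = K f1 x + K f2 x.
  rewrite -(ws_add hK L1f1 L1f2); congr (K _ x); apply/funext => y.
  by rewrite /f1 /f2; ring.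
have mK := ws_meas hK; have KT := ws_supp hK.
pose E0 : set R := [set x | (s < `|K f x| / 2)%R].
pose E1 : set R := [set x | (s < `|K f1 x|)%R].
pose E2 : set R := [set x | (s < `|K f2 x|)%R].
have mE0 : measurable E0.
  apply: (@measurable_superlevel _ (fun x => `|K f x| / 2)).
  by apply: measM; [apply: meas_norm; exact: mK|exact: meas_cst].
have mE1 : measurable E1 by exact: measurable_superlevel (meas_norm (mK _)).
have mE2 : measurable E2 by exact: measurable_superlevel (meas_norm (mK _)).
have E1oo : (mu E1 < +oo)%E by apply: superlevel_lty => //; exact: ltW.
have E2oo : (mu E2 < +oo)%E by apply: superlevel_lty => //; exact: ltW.
have E0sub : E0 `<=` E1 `|` E2.
  move=> x; rewrite /E0 /E1 /E2 /= Kadd => sx.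
  case: (ltP s `|K f1 x|) => h1; [by left|right; rewrite ltNge; apply/negP => h2].
  have := ler_normD (K f1 x) (K f2 x); lra.
have E0oo : (mu E0 < +oo)%E.
  apply: (@le_lt_trans _ _ (mu (E1 `|` E2))).
    by apply: le_measure; rewrite ?inE //; exact: measurableU.
  by apply: le_lt_trans (measureU2 _ _ _) _ => //; rewrite lte_add_pinfty.
have L0 := L1_indic mE0 E0oo; have L1' := L1_indic mE1 E1oo; have L2 := L1_indic mE2 E2oo.
apply: (@le_trans _ _ (lebint \1_E1 + lebint \1_E2)).
  rewrite -lebintD //; apply: lebint_le => //; first exact: L1D.
  move=> x; rewrite !indicE; case: (boolP (x \in E0)) => [/set_mem/E0sub|_].
    by case=> /mem_set ->; rewrite ?lerDl ?lerDr.
  by rewrite addr_ge0.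
apply: lerD.
  rewrite -lee_fin lebint_indicE //; apply: le_trans (ws_weak hK L1f1 f1T s0) _.
  rewrite lee_fin mulrAC; under eq_fun do rewrite f1E; by rewrite lexx.
have -> : (fun x => `|f x| ^+ q * (`|f x| <= s)%R%:R) = fun x => `|f2 x| ^+ q.
  apply/funext => x; rewrite f2E exprMn; congr (_ * _).
  by case: (_ <= _); rewrite ?expr1n // expr0n gtn_eqF.
have sq0 : 0 < s ^+ q by rewrite exprn_gt0.
rewrite mulrAC ler_pdivlMr //; apply: le_trans (ws_strong hK m2 f2s f2T).
rewrite mulrC -lebintZ //; apply: lebint_le; [exact: L1Z|by apply: L1_pow; exact: KT|].
move=> x; rewrite indicE; case: (boolP (x \in E2)) => [/set_mem xE|_].
  by rewrite mulr1 lerXn2r ?nnegrE ?(ltW s0) //; exact: ltW.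
by rewrite mulr0 exprn_ge0.
Qed.

Variables (B : R -> R) (b D : R).
Hypothesis (hB : intermediate_growth B b D q) (mB : meas (fun t => B `|t|)).

(** Marcinkiewicz interpolation, summed over the geometric levels
    [s0 * b ^ i]; the finitely many levels suffice since [K f] is bounded, and
    [s0] tends to [0] at the end. *)
Lemma marcinkiewicz f : L1 f -> supported T f -> L1 (fun x => B `|f x|) ->
  lebint (fun x => B (`|K f x| / 2)) <=
  (2 * D * C1 + 2 * D ^+ 2 * C2) * lebint (fun x => B `|f x|).
Proof.
move=> Lf fT LBf; have mf := L1_meas Lf.
have b1 := growth_b_gt1 hB; have D0 := growth_D_gt0 hB.
have b0 : 0 < b by exact: lt_trans b1.
have B0 := growth0 hB; have Bge0 := growth_ge0 hB.
have C10 := ws_C1 hK; have C20 := ws_C2 hK.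
have [C HC] := ws_bounded hK f; have KT := ws_supp hK f; have mK := ws_meas hK f.
have C0 : 0 <= C by exact: le_trans (HC 0).
pose G x := B (`|K f x| / 2).
have mG : meas G.
  have -> : G = (fun t => B `|t|) \o (fun x => K f x / 2).
    by apply/funext => x; rewrite /G /= normf_div (@ger0_norm _ 2).
  by apply: (measurableT_comp mB); apply: measM; [exact: mK|exact: meas_cst].
have Gge0 x : 0 <= G x by rewrite Bge0 // divr_ge0.
have Bndecr := growth_ndecr hB.
have LG : L1 G.
  have C1' : 0 < C + 1 by rewrite ltr_wpDl.
  apply: (@L1_supported _ T (B (C + 1))) => //; last first.
    by move=> x /KT; rewrite /G => ->; rewrite normr0 mul0r.
  move=> x; rewrite ger0_norm // /G; have := normr_ge0 (K f x); rewrite le_eqVlt.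
  case/orP => [/eqP <-|k0]; first by rewrite mul0r B0 Bge0 // ltW.
  by apply: Bndecr; [rewrite divr_gt0|have := HC x; lra].
have LI : L1 (\1_(`]- T, T[%classic : set R)).
  by apply: L1_indic; [exact: measurable_itvT|exact: mu_itvT].
pose m := lebint (\1_(`]- T, T[%classic : set R)).
have m0 : 0 <= m by apply: lebint_ge0.
pose cst := 2 * D * C1 + 2 * D ^+ 2 * C2.
have level s0 : 0 < s0 -> lebint G <= B s0 * m + cst * lebint (fun x => B `|f x|).
  move=> s00; pose s i := s0 * b ^+ i.
  have sp i : 0 < s i by rewrite mulr_gt0 // exprn_gt0.
  have [M hM] : exists M, C <= s M.
    have [M] := expn_unbounded (C / s0) b1; rewrite ler_pdivrMr // => CM; exists M.
    by rewrite /s mulrC.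
  pose I i : R -> R := \1_[set x | (s i < `|K f x| / 2)%R].
  have mI i : measurable [set x | (s i < `|K f x| / 2)%R].
    apply: (@measurable_superlevel _ (fun x => `|K f x| / 2)).
    by apply: measM; [apply: meas_norm; exact: mK|exact: meas_cst].
  have LIi i : L1 (I i).
    apply: L1_indic => //; apply: le_lt_trans (mu_itvT T).
    apply: le_measure; rewrite ?inE; [exact: mI|exact: measurable_itvT|].
    move=> x /= tF; rewrite in_itv /=; apply: contraLR tF => /KT ->.
    by rewrite normr0 mul0r -leNgt ltW.
  have step1 : lebint G <= B s0 * m + \sum_(0 <= i < M) B (s i.+1) * lebint (I i).
    rewrite -lebintZ //; under eq_bigr do rewrite -lebintZ //.
    rewrite -lebint_sum; last by move=> i; exact: L1Z.
    rewrite -lebintD; [|exact: L1Z|by apply: L1_sum => i; exact: L1Z].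
    apply: lebint_le => //.
      by apply: L1D; [exact: L1Z|apply: L1_sum => i; exact: L1Z].
    move=> x; have Ige0 i : 0 <= B (s i.+1) * I i x by rewrite mulr_ge0 // Bge0 // ltW.
    have sum0 : 0 <= \sum_(0 <= i < M) B (s i.+1) * I i x by apply: sumr_ge0.
    have IE i : I i x = (s i < `|K f x| / 2)%R%:R.
      by rewrite /I indicE; congr (nat_of_bool _)%:R; apply/idP/idP; rewrite inE.
    case: (boolP (- T < x < T)) => xT; last first.
      by rewrite /G KT // normr0 mul0r B0 addr_ge0 ?mulr_ge0 ?Bge0 ?(ltW s00).
    rewrite indicE mem_set ?mulr1; last by rewrite /= in_itv.
    case: (leP (`|K f x| / 2) s0) => hs.
      rewrite ler_wpDr // /G; have := normr_ge0 (K f x); rewrite le_eqVlt.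
      case/orP => [/eqP <-|k0]; first by rewrite mul0r B0 Bge0 // ltW.
      by apply: Bndecr; rewrite ?divr_gt0.
    rewrite ler_wpDl ?Bge0 ?(ltW s00) // /G.
    have tM : `|K f x| / 2 <= s0 * b ^+ M.
      by apply: le_trans hM; have := HC x; have := normr_ge0 (K f x); lra.
    apply: le_trans (layer_cake hB s00 hs tM) _.
    by apply: ler_sum => i _; rewrite IE.
  apply: (le_trans step1); rewrite lerD2l.
  have mle i : meas (fun x => (`|f x| <= s i)%R%:R : R).
    have -> : (fun x => (`|f x| <= s i)%R%:R : R) =
        fun x => 1 - \1_[set x | (s i < `|f x|)%R] x.
      apply/funext => x; rewrite indicE.
      have -> : (x \in [set x | (s i < `|f x|)%R]) = (s i < `|f x|).
        by apply/idP/idP; rewrite inE.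
      by rewrite ltNge; case: leP => _ /=; rewrite ?subr0 ?subrr.
    apply: measB; first exact: meas_cst.
    by apply: meas_indic; exact: measurable_superlevel (meas_norm mf).
  have mlt i : meas (fun x => (s i < `|f x|)%R%:R : R).
    have -> : (fun x => (s i < `|f x|)%R%:R : R) = \1_[set x | (s i < `|f x|)%R].
      apply/funext => x; rewrite indicE; congr (nat_of_bool _)%:R.
      by apply/idP/idP; rewrite inE.
    by apply: meas_indic; exact: measurable_superlevel (meas_norm mf).
  have Llt i : L1 (fun x => `|f x| * (s i < `|f x|)%R%:R).
    apply: L1_le (L1_norm Lf); first by apply: measM => //; exact: meas_norm.
    by move=> x; rewrite ger0_norm ?mulr_ge0 // ler_piMr // lern1 leq_b1.
  have Lle i : L1 (fun x => `|f x| ^+ q * (`|f x| <= s i)%R%:R).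
    apply: (@L1_supported _ T (s i ^+ q)).
    - by apply: measM => //; apply: measX; exact: meas_norm.
    - move=> x; rewrite ger0_norm ?mulr_ge0 ?exprn_ge0 //.
      case: (leP `|f x| (s i)) => h; rewrite ?mulr1 ?mulr0 ?exprn_ge0 ?(ltW (sp _)) //.
      by rewrite lerXn2r ?nnegrE ?(ltW (sp _)).
    - by move=> x /fT ->; rewrite normr0 expr0n gtn_eqF // mul0r.
  pose P1 i x := B (s i.+1) / s i * (`|f x| * (s i < `|f x|)%R%:R).
  pose P2 i x := B (s i.+1) / s i ^+ q * (`|f x| ^+ q * (`|f x| <= s i)%R%:R).
  have LP1 i : L1 (P1 i) by exact: L1Z.
  have LP2 i : L1 (P2 i) by exact: L1Z.
  apply: (@le_trans _ _ (\sum_(0 <= i < M) (C1 * lebint (P1 i) + C2 * lebint (P2 i)))).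
    apply: ler_sum => i _; rewrite /P1 /P2 !lebintZ //.
    have := superlevel_split Lf fT (sp i) => /(ler_wpM2l (Bge0 _ (ltW (sp i.+1)))).
    by move=> /le_trans; apply; rewrite le_eqVlt; apply/orP; left; apply/eqP; ring.
  rewrite big_split /= -!mulr_sumr -!lebint_sum //.
  set L := lebint (fun x => B `|f x|).
  rewrite (_ : cst * L = C1 * (2 * D * L) + C2 * (2 * D ^+ 2 * L)); last first.
    by rewrite /cst; ring.
  have pos x : 0 < `|f x| \/ f x = 0.
    by case: (eqVneq (f x) 0) => [|fx]; [right|left; rewrite normr_gt0].
  apply: lerD; apply: ler_wpM2l => //; rewrite -lebintZ //; apply: lebint_le;
    try (by apply: L1_sum); try exact: L1Z.
  - move=> x; case: (pos x) => [f0|f0]; last first.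
      rewrite big1 ?f0 ?normr0 ?B0 ?mulr0 // => i _.
      by rewrite /P1 f0 normr0 mul0r mulr0.
    have := sum_below hB M s00 f0 => /(ler_wpM2r (ltW f0)).
    rewrite mulr_suml -[leRHS]mulrA divfK ?gt_eqF // => h; apply: le_trans h.
    by apply: ler_sum => i _; rewrite /P1 /s le_eqVlt; apply/orP; left; apply/eqP; ring.
  - move=> x; case: (pos x) => [f0|f0]; last first.
      rewrite big1 ?f0 ?normr0 ?B0 ?mulr0 // => i _.
      by rewrite /P2 f0 normr0 expr0n gtn_eqF // mul0r mulr0.
    have fq0 : 0 < `|f x| ^+ q by rewrite exprn_gt0.
    have := sum_above hB M s00 f0 => /(ler_wpM2r (ltW fq0)).
    rewrite mulr_suml -[leRHS]mulrA divfK ?gt_eqF // => h; apply: le_trans h.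
    by apply: ler_sum => i _; rewrite /P2 /s le_eqVlt; apply/orP; left; apply/eqP; ring.
apply/ler_addgt0Pr => e e0; rewrite addrC.
(* The lowest level contributes at most [B d * m <= d * B 1 * m <= e]. *)
pose d := Num.min 1 (e / (B 1 * m + 1)).
have B1 : 0 <= B 1 by rewrite Bge0.
have k0 : 0 < B 1 * m + 1 by rewrite ltr_wpDl // mulr_ge0.
have d0 : 0 < d by rewrite lt_min ltr01 divr_gt0.
apply: le_trans (level _ d0) _; rewrite lerD2r.
have d1 : d <= 1 by rewrite ge_min lexx.
have := growth_ratio hB d0 d1; rewrite divr1 ler_pdivrMr // => Bd.
apply: le_trans (ler_wpM2r m0 Bd) _.
have : d <= e / (B 1 * m + 1) by rewrite ge_min lexx orbT.
rewrite ler_pdivlMr //; move=> de; have := mulr_ge0 B1 m0.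
have -> : B 1 * d * m = d * (B 1 * m) by ring.
by rewrite mulrDr mulr1 in de => _; apply: le_trans de; rewrite lerDl ltW.
Qed.

End Marcinkiewicz.

(** * Truncated Hermite sums on Lebesgue spaces *)

Section StrongType.
Variable R : realType.
Local Notation mu := (@lebesgue_measure R).
Local Notation h := (@hermite_fun R).
Implicit Types (f g : R -> R) (x t : R) (T : R) (n q : nat).

Lemma ksum_supported n T f : supported T (ksum n T f).
Proof.
move=> x xT; rewrite /ksum indicE memNset ?mul0r //= in_itv /=.
exact/negP.
Qed.

Lemma ksumD n T f g : L1 f -> L1 g -> forall x,
  ksum n T (fun x => f x + g x) x = ksum n T f x + ksum n T g x.
Proof.
move=> Lf Lg x; rewrite /ksum -mulrDr; congr (_ * _).
rewrite /hsum -big_split; apply: eq_bigr => k _ /=; rewrite -mulrDl; congr (_ * _).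
rewrite /ip -lebintD; try exact: L1_mul_hermite.
by congr lebint; apply/funext => y; rewrite mulrDl.
Qed.

Lemma ksum_bounded n T f : exists C, forall x, `|ksum n T f x| <= C.
Proof.
have [_ [C HC]] := gauss_bounded_hsum n f; exists C => x.
have C0 : 0 <= C.
  by rewrite -(pmulr_lge0 _ (expR_gt0 (- (0 ^+ 2 / 4)))) (le_trans _ (HC 0)).
rewrite /ksum normrM; apply: (@le_trans _ _ `|hsum n f x|).
  by rewrite ler_piMl // indicE normr_nat lern1 leq_b1.
apply: le_trans (HC x) _.
by rewrite ler_piMr // -[leRHS]expR0 ler_expR oppr_le0 divr_ge0 ?sqr_ge0.
Qed.

Lemma supported_gauss_bounded T (C : R) f : meas f -> (forall x, `|f x| <= C) ->
  supported T f -> gauss_bounded f.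
Proof.
move=> mf fC fT; apply: (gauss_bounded_supp (T := T) mf fC) => x xT; apply: fT.
by apply/negP; rewrite -ltr_norml ltNge xT.
Qed.

Lemma weak_strong_ksum n T (C : R) q : 0 < T -> T ^+ 2 <= n%:R -> 0 <= C ->
  (forall f M, meas f -> (forall x, `|f x| <= M) -> supported T f ->
    lebint (fun x => `|ksum n T f x| ^+ q) <= C * lebint (fun x => `|f x| ^+ q)) ->
  weak_strong (ksum n T) T 128 C q.
Proof.
move=> T0 Tn C0 strong; split => //.
- exact: ksumD.
- exact: meas_ksum.
- exact: ksum_bounded.
- exact: ksum_supported.
- by move=> f l Lf fT l0; exact: ksum_weak11.
Qed.

Lemma L1_bounded_supported T (C : R) f : meas f -> (forall x, `|f x| <= C) ->
  supported T f -> forall q, (0 < q)%N -> L1 (fun x => `|f x| ^+ q).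
Proof.
move=> mf fC fT q q0; have C0 : 0 <= C by exact: le_trans (fC 0).
apply: (@L1_supported _ T (C ^+ q)).
- by apply: measX; exact: meas_norm.
- by move=> x; rewrite normrX normr_id lerXn2r ?nnegrE.
- by move=> x /fT ->; rewrite normr0 expr0n gtn_eqF.
Qed.

Lemma ksum_strong2 n T f (M : R) : meas f -> (forall x, `|f x| <= M) -> supported T f ->
  lebint (fun x => `|ksum n T f x| ^+ 2) <= 1 * lebint (fun x => `|f x| ^+ 2).
Proof.
move=> mf fM fT; rewrite mul1r; have Gf := supported_gauss_bounded mf fM fT.
have sqE (g : R -> R) : (fun x => `|g x| ^+ 2) = (fun x => g x * g x).
  by apply/funext => x; rewrite real_normK ?num_real // expr2.
rewrite (sqE f); apply: le_trans (sqnorm_hsum_le n Gf).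
have [C HC] := ksum_bounded n T f.
apply: lebint_le.
- exact: (L1_bounded_supported (meas_ksum n T f) HC (@ksum_supported n T f) (ltn0Sn 1)).
- by apply: gauss_boundedM_L1; exact: gauss_bounded_hsum.
- move=> x; rewrite /ksum normrM exprMn real_normK ?num_real // -expr2.
  by rewrite real_normK ?num_real // ler_piMl ?sqr_ge0.
Qed.

Section Power.
Variable q : nat.
Hypothesis q3 : (2 < q)%N.
Let r : R := (q.-1)%:R^-1.
Let b : R := 2 ^+ q.-1.

(** The power with exponent [q / (q - 1)], conjugate to [q]. *)
Definition conj_power t : R := t * t `^ r.

Let q10 : (0 < q.-1)%N. Proof. by rewrite -ltnS prednK // ltnW // ltnW. Qed.
Let r_gt0 : 0 < r. Proof. by rewrite invr_gt0 ltr0n. Qed.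

Lemma powr_root (u : R) : 0 <= u -> (u ^+ q.-1) `^ r = u.
Proof.
move=> u0; rewrite -powR_mulrn // -powRrM mulfV ?powRr1 //.
by rewrite pnatr_eq0 -lt0n.
Qed.

Let root_powr (u : R) : 0 <= u -> (u `^ r) ^+ q.-1 = u.
Proof.
move=> u0; rewrite -powR_mulrn ?powR_ge0 // -powRrM mulVf ?powRr1 //.
by rewrite pnatr_eq0 -lt0n.
Qed.

Let conj_power_scale c t : 0 <= c -> 0 <= t ->
  conj_power (c ^+ q.-1 * t) = c * c ^+ q.-1 * conj_power t.
Proof.
move=> c0 t0; rewrite /conj_power powRM ?exprn_ge0 // powr_root //; ring.
Qed.

Lemma conj_power_ge0 t : 0 <= t -> 0 <= conj_power t.
Proof. by move=> t0; rewrite mulr_ge0 // powR_ge0. Qed.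

(** The scale [b = 2 ^ (q - 1)] makes the small gap between the exponents [1]
    and [q / (q - 1)] visible: there [b ^ (1 + r) = 2 b] exactly. *)
Lemma conj_power_growth : intermediate_growth conj_power b (2 * b) 2.
Proof.
have b4 : 4 <= b.
  rewrite /b (_ : 4 = 2 ^+ 2); last by rewrite -natrX.
  by rewrite ler_eXn2l ?ltr1n // -ltnS prednK // ltnW // ltnW.
split.
- by apply: lt_le_trans b4; rewrite ltr1n.
- by rewrite mulr_gt0 // (lt_le_trans _ b4).
- by rewrite expr2; nra.
- by rewrite /conj_power mul0r.
- exact: conj_power_ge0.
- move=> s t s0 st; have t0 : 0 < t by exact: lt_le_trans st.
  rewrite /conj_power ![_ * _ `^ _]mulrC !mulfK ?gt_eqF //.
  by apply: ge0_ler_powR => //; rewrite ?nnegrE; exact: ltW.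
- by move=> t t0; rewrite conj_power_scale // ltW.
- by move=> t t0; rewrite conj_power_scale ?(ltW t0) // mulrAC divff ?mul1r //.
Qed.

Lemma meas_conj_power f : meas f -> meas (fun x => conj_power `|f x|).
Proof.
move=> mf; apply: measM; first exact: meas_norm.
apply: (@measurableT_comp _ _ _ _ _ _ (fun u : R => u `^ r)); first exact: measurable_powR.
exact: meas_norm.
Qed.

Lemma L1_conj_power T (C : R) f : meas f -> (forall x, `|f x| <= C) ->
  supported T f -> L1 (fun x => conj_power `|f x|).
Proof.
move=> mf fC fT; apply: (@L1_supported _ T (conj_power C)).
- exact: meas_conj_power.
- move=> x; rewrite ger0_norm ?conj_power_ge0 // ler_pM ?powR_ge0 //.
  by rewrite ge0_ler_powR ?nnegrE ?(ltW r_gt0) // (le_trans _ (fC x)).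
- by move=> x /fT ->; rewrite /conj_power normr0 mul0r.
Qed.

Let Cp : R := 4 * (2 * (2 * b) * 128 + 2 * (2 * b) ^+ 2 * 1).
Let Cp_gt0 : 0 < Cp.
Proof.
have b0 : 0 < b by rewrite exprn_gt0.
by rewrite mulr_gt0 // addr_gt0 // !mulr_gt0 // exprn_gt0 // mulr_gt0.
Qed.

(** Interpolation between the weak type (1, 1) and the strong type (2, 2). The
    factor [4] removes the division by [2] inside the modular. *)
Lemma ksum_conj_power n T f : 0 < T -> T ^+ 2 <= n%:R -> L1 f -> supported T f ->
  L1 (fun x => conj_power `|f x|) ->
  lebint (fun x => conj_power `|ksum n T f x|) <= Cp * lebint (fun x => conj_power `|f x|).
Proof.
move=> T0 Tn Lf fT LB.
have WS : weak_strong (ksum n T) T 128 1 2.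
  by apply: weak_strong_ksum => // g M mg gM gT; exact: ksum_strong2 gM gT.
have mB : meas (fun t : R => conj_power `|t|) by exact: meas_conj_power (@measurable_id _ _ _).
have := marcinkiewicz (ltn0Sn 1) WS conj_power_growth mB Lf fT LB.
move=> H; rewrite /Cp -[leRHS]mulrA; apply: le_trans (ler_wpM2l _ H) => // {H}.
have [C HC] := ksum_bounded n T f; have mK := meas_ksum n T f.
have C0 : 0 <= C by exact: le_trans (HC 0).
have KT := @ksum_supported n T f.
have mK2 : meas (fun x => ksum n T f x / 2) by apply: measM => //; exact: meas_cst.
have L2 : L1 (fun x => conj_power (`|ksum n T f x| / 2)).
  have -> : (fun x => conj_power (`|ksum n T f x| / 2)) =
      fun x => conj_power `|ksum n T f x / 2|.
    by apply/funext => x; rewrite normf_div (@ger0_norm _ 2).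
  apply: (L1_conj_power (C := C) mK2) => x; last by move/KT ->; rewrite mul0r.
  by rewrite normf_div (@ger0_norm _ 2) //; have := HC x; have := normr_ge0 (ksum n T f x); lra.
rewrite -lebintZ //; apply: lebint_le; [exact: L1_conj_power HC KT|exact: L1Z|].
move=> x; move: `|ksum n T f x| (normr_ge0 (ksum n T f x)) => u u0.
rewrite /conj_power (_ : 4 * _ = u * (2 * (u / 2) `^ r)); last by field.
rewrite ler_wpM2l // powRM ?invr_ge0 // mulrCA ler_peMr ?powR_ge0 //.
rewrite -{1}(powr_root (ler0n R 2)) -powRM ?exprn_ge0 ?invr_ge0 //.
rewrite -[leLHS](powRr0 (2 ^+ q.-1 * 2^-1)) ler_powR ?(ltW r_gt0) //.
by rewrite ler_pdivlMr // mul1r -[leLHS]expr1 ler_eXn2l // ltr1n.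
Qed.

(** Young's inequality with a small coefficient in front of the power of [c].
    Comparing [a] with [d * c `^ r] decides which term is the larger one. *)
Lemma young_split (d a c : R) : 0 < d -> 0 <= a -> 0 <= c ->
  a * c <= d * conj_power c + (d^-1) ^+ q.-1 * a ^+ q.
Proof.
move=> d0 a0 c0; case: (leP a (d * c `^ r)) => ac.
  apply: (@le_trans _ _ (d * conj_power c)).
    by rewrite /conj_power mulrCA mulrC ler_wpM2l.
  by rewrite lerDl mulr_ge0 // exprn_ge0 // invr_ge0 ltW.
apply: (@le_trans _ _ (d^-1 ^+ q.-1 * a ^+ q)); last first.
  by rewrite lerDr mulr_ge0 ?conj_power_ge0 // ltW.
have -> : a ^+ q = a * a ^+ q.-1 by rewrite -exprS prednK // ltnW // ltnW.
rewrite mulrCA -exprMn ler_wpM2l // -[leLHS](root_powr c0).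
rewrite lerXn2r ?nnegrE ?powR_ge0 ?mulr_ge0 ?invr_ge0 ?(ltW d0) //.
by rewrite mulrC ler_pdivlMr // mulrC ltW.
Qed.

(** Duality: the sums are self-adjoint, so the bound at the conjugate exponent
    gives the bound at [q]. *)
Lemma ksum_strong n T f (M : R) : 0 < T -> T ^+ 2 <= n%:R ->
  meas f -> (forall x, `|f x| <= M) -> supported T f ->
  lebint (fun x => `|ksum n T f x| ^+ q) <=
  2 * (2 * Cp) ^+ q.-1 * lebint (fun x => `|f x| ^+ q).
Proof.
move=> T0 Tn mf fM fT; have q0 : (0 < q)%N by rewrite ltnW // ltnW.
pose g := ksum n T f.
have [C HC] := ksum_bounded n T f; have mg : meas g := meas_ksum n T f.
have C0 : 0 <= C by exact: le_trans (HC 0).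
have gT : supported T g := @ksum_supported n T f.
(* The dual function of [g]: [g w = |g| ^ q] and [conj_power |w| = |g| ^ q]. *)
pose w x := g x * `|g x| ^+ q.-2.
have gw x : g x * w x = `|g x| ^+ q.
  rewrite /w mulrA -expr2 -[g x ^+ 2]real_normK ?num_real // -exprD add2n.
  by congr (_ ^+ _); case: (q) q3 => [|[|]].
have wn x : `|w x| = `|g x| ^+ q.-1.
  rewrite /w normrM normrX normr_id -exprS; congr (_ ^+ _).
  by case: (q) q3 => [|[|]].
have mw : meas w by apply: measM => //; apply: measX; exact: meas_norm.
have wC x : `|w x| <= C ^+ q.-1 by rewrite wn lerXn2r ?nnegrE // HC.
have wT : supported T w by move=> x /gT; rewrite /w => ->; rewrite mul0r.
have Gf := supported_gauss_bounded mf fM fT.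
have Gw := supported_gauss_bounded mw wC wT.
have Lw := L1_gauss_bounded Gw.
have Bw x : conj_power `|w x| = `|g x| ^+ q.
  rewrite wn /conj_power powr_root // -exprSr prednK //.
have LBw := L1_conj_power mw wC wT.
have dual : lebint (fun x => `|g x| ^+ q) = lebint (fun x => f x * ksum n T w x).
  transitivity (ip (hsum n f) w).
    congr lebint; apply/funext => x; rewrite -gw /g /ksum.
    case: (boolP (- T < x < T)) => xT; last by rewrite (wT x xT) !mulr0.
    by rewrite indicE mem_set ?mul1r //= in_itv.
  rewrite ip_hsumC //; congr lebint; apply/funext => x; rewrite /ksum.
  case: (boolP (- T < x < T)) => xT; last by rewrite (fT x xT) !mul0r.
  by rewrite indicE mem_set ?mul1r //= in_itv.
have [Cw HCw] := ksum_bounded n T w.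
have KwT := @ksum_supported n T w; have mKw := meas_ksum n T w.
have Lq := L1_bounded_supported mf fM fT q0.
have LB := L1_conj_power mKw HCw KwT.
(* With this coefficient the term in [ksum n T w] is at most half of the left
   side, which absorbs it. *)
pose d := (2 * Cp)^-1.
have d0 : 0 < d by rewrite invr_gt0 mulr_gt0.
have Gg := L1_bounded_supported mg HC gT q0.
have : lebint (fun x => `|g x| ^+ q) <=
    d * lebint (fun x => conj_power `|ksum n T w x|) +
    (d^-1) ^+ q.-1 * lebint (fun x => `|f x| ^+ q).
  rewrite dual -!lebintZ // -lebintD; try exact: L1Z.
  apply: lebint_le.
  - by apply: gauss_boundedM_L1 => //; exact: supported_gauss_bounded HCw KwT.
  - by apply: L1D; exact: L1Z.
  - move=> x; apply: le_trans (ler_norm _) _; rewrite normrM; exact: young_split.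
have := ksum_conj_power T0 Tn Lw wT LBw.
under [in X in _ <= _ * X]eq_fun do rewrite Bw.
move=> /(ler_wpM2l (ltW d0)).
have -> : d * (Cp * lebint (fun x => `|g x| ^+ q)) = lebint (fun x => `|g x| ^+ q) / 2.
  by rewrite /d; field; rewrite gt_eqF.
rewrite /d invrK -/g; lra.
Qed.

Lemma ksum_bounds : exists2 C, 0 <= C & forall n T f M, 0 < T -> T ^+ 2 <= n%:R ->
  meas f -> (forall x, `|f x| <= M) -> supported T f ->
  lebint (fun x => conj_power `|ksum n T f x|) <= C * lebint (fun x => conj_power `|f x|) /\
  lebint (fun x => `|ksum n T f x| ^+ q) <= C * lebint (fun x => `|f x| ^+ q).
Proof.
have Cq : 0 <= 2 * (2 * Cp) ^+ q.-1.
  by rewrite mulr_ge0 // exprn_ge0 // mulr_ge0 // ltW.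
exists (Cp + 2 * (2 * Cp) ^+ q.-1); first by rewrite addr_ge0 // ltW.
move=> n T f M T0 Tn mf fM fT; split.
  have Lf : L1 f by exact: L1_supported mf fM fT.
  apply: le_trans (ksum_conj_power T0 Tn Lf fT (L1_conj_power mf fM fT)) _.
  apply: ler_wpM2r; last by rewrite lerDl.
  by apply: lebint_ge0 => x; exact: conj_power_ge0.
apply: le_trans (ksum_strong T0 Tn mf fM fT) _.
apply: ler_wpM2r; last by rewrite lerDr ltW.
by apply: lebint_ge0 => x; exact: exprn_ge0.
Qed.

End Power.
End StrongType.

(** * Growth of a Young function with the doubling conditions *)

Section YoungGrowth.
Variables (R : realType) (A : R -> \bar R).
Hypotheses (hA : young_function A) (hD : Delta2 A) (hN : nabla2 A).
Implicit Types (s t : R).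

Definition young_fine t : R := fine (A t).
Local Notation a := young_fine.

Let A_scale p t : 0 <= p <= 1 -> 0 <= t -> (A (p * t)%R <= p%:E * A t)%E.
Proof.
move=> p01 t0; have := young_convex hA t0 (lexx 0) p01.
by rewrite mulr0 addr0 (young0 hA) mule0 adde0.
Qed.

Let A_le s t : 0 <= s -> s <= t -> (A s <= A t)%E.
Proof.
move=> s0 st; case: (eqVneq t 0) => [t0|t0].
  by have -> : s = t; [apply/eqP; rewrite eq_le st t0 s0|].
have tp : 0 < t by rewrite lt_neqAle eq_sym t0 (le_trans s0).
have := @A_scale (s / t) t _ (ltW tp); rewrite divfK // => H.
have p01 : 0 <= s / t <= 1 by rewrite divr_ge0 ?(ltW tp) //= ler_pdivrMr // mul1r.
apply: le_trans (H p01) _; rewrite -[leRHS]mul1e.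
by apply: lee_wpmul2r; [exact: young_ge0 hA _ (ltW tp)|rewrite lee_fin; case/andP: p01].
Qed.

Let A_pow2 : exists2 C : R, 0 < C & forall n t, 0 < t -> (A (2 ^+ n * t)%R <= (C ^+ n)%:E * A t)%E.
Proof.
have [C C0 HC] := hD; exists C => // n t t0; elim: n => [|n IH].
  by rewrite !expr0 mul1r mul1e.
rewrite exprS -mulrA; apply: le_trans (HC _ _) _; first by rewrite mulr_gt0 // exprn_gt0.
by rewrite exprS EFinM -muleA; apply: lee_wpmul2l => //; rewrite lee_fin ltW.
Qed.

Let pow2_large s t : 0 < s -> exists n, t <= 2 ^+ n * s.
Proof.
move=> s0; exists (Num.truncn (t / s)).+1.
have := truncnS_gt (t / s); move: (_.+1) => k /ltW; rewrite ler_pdivrMr // => h.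
apply: (le_trans h); rewrite ler_wpM2r ?(ltW s0) //.
by rewrite -natrX ler_nat ltnW // ltn_expl.
Qed.

(** A Young function with an infinite value would, by doubling, be infinite on
    the whole half-line. *)
Lemma young_fineK t : 0 <= t -> A t = (a t)%:E.
Proof.
move=> t0; rewrite /a fineK //.
have [C C0 HC] := A_pow2.
have [s s0 As] : exists2 s, 0 < s & (A s < +oo)%E.
  have [s [u [s0 u0 Asu]]] := young_nonconstant hA.
  case: (ltP (A s) +oo%E) => [?|]; first by exists s.
  rewrite leye_eq => /eqP As; exists u => //.
  by rewrite ltey; apply/eqP => Au; apply: Asu; rewrite As Au.
have [n tn] := pow2_large t s0.
rewrite ge0_fin_numE ?(young_ge0 hA t0) //.
apply: le_lt_trans (A_le t0 tn) _; apply: le_lt_trans (HC n _ s0) _.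
by rewrite lte_mul_pinfty // ?lee_fin ?exprn_ge0 ?(ltW C0).
Qed.

Lemma young_fine0 : a 0 = 0. Proof. by rewrite /a (young0 hA). Qed.

Lemma young_fine_ge0 t : 0 <= t -> 0 <= a t.
Proof. by move=> t0; rewrite -lee_fin -young_fineK // (young_ge0 hA). Qed.

Lemma young_fine_le s t : 0 <= s -> s <= t -> a s <= a t.
Proof.
move=> s0 st; rewrite -lee_fin -!young_fineK ?(le_trans s0) //; exact: A_le.
Qed.

Lemma young_fine_ratio s t : 0 < s -> s <= t -> a s / s <= a t / t.
Proof.
move=> s0 st; have t0 : 0 < t by exact: lt_le_trans st.
rewrite ler_pdivrMr // mulrAC -mulrA mulrC.
have := @A_scale (s / t) t _ (ltW t0); rewrite divfK ?gt_eqF //.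
rewrite !young_fineK ?(ltW s0) ?(ltW t0) // -EFinM lee_fin; apply.
by rewrite divr_ge0 ?(ltW t0) ?(ltW s0) //= ler_pdivrMr // mul1r.
Qed.

Lemma young_fine_pow2 : exists2 C : R, 1 <= C &
  forall n t, 0 <= t -> a (2 ^+ n * t) <= C ^+ n * a t.
Proof.
have [C C0 HC] := A_pow2; exists (Num.max 1 C); first by rewrite le_max lexx.
move=> n t; rewrite le_eqVlt => /orP[/eqP <-|t0].
  by rewrite mulr0 young_fine0 mulr0.
have n0 : 0 <= 2 ^+ n * t by rewrite mulr_ge0 // ?exprn_ge0 // ltW.
have := HC n t t0; rewrite (young_fineK n0) (young_fineK (ltW t0)) -EFinM lee_fin => H.
apply: (le_trans H); apply: ler_wpM2r; first exact: young_fine_ge0 (ltW t0).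
by apply: lerXn2r; rewrite ?nnegrE ?(ltW C0) // ?le_max ?lexx ?orbT ?ler01.
Qed.

Lemma young_fine_pos : exists2 t, 0 < t & 0 < a t.
Proof.
have [s [u [s0 u0 Asu]]] := young_nonconstant hA.
case: (ltP 0 (a s)) => [|as0]; first by exists s.
case: (ltP 0 (a u)) => [|au0]; first by exists u.
case: Asu; rewrite !young_fineK ?(ltW s0) ?(ltW u0) //; congr (_%:E).
apply/eqP; rewrite eq_le (le_trans as0) ?(le_trans au0) //;
  by apply: young_fine_ge0; exact: ltW.
Qed.

(** A nonzero Young function cannot satisfy [nabla_2] with [c <= 1], and by
    convexity [c] may be enlarged to a power [b] of [2], the scale at which
    [Delta_2] can be iterated. The condition [2 D <= b ^ q] then holds for all
    large [q]. *)
Lemma young_fine_growth : exists b D N, forall q, (N <= q)%N -> intermediate_growth a b D q.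
Proof.
have [c c0 Hc] := hN.
have nab t : 0 < t -> a t <= a (c * t) / (2 * c).
  move=> t0; have := Hc t t0; rewrite !young_fineK ?mulr_ge0 ?(ltW t0) ?(ltW c0) //.
  by rewrite -EFinM lee_fin mulrC.
have c1 : 1 < c.
  rewrite ltNge; apply/negP => c1; have [t t0 at0] := young_fine_pos.
  have ct0 : 0 < c * t by rewrite mulr_gt0.
  have ct : c * t <= t by rewrite ler_piMl // ltW.
  have := nab t t0; have := young_fine_ratio ct0 ct.
  rewrite ler_pdivrMr // => h1; rewrite ler_pdivlMr ?mulr_gt0 // => h2.
  have := le_trans h2 h1; have -> : a t / t * (c * t) = c * a t by field; rewrite gt_eqF.
  by have := mulr_gt0 c0 at0; lra.
have [m cm] := pow2_large c (ltr01 : 0 < 1 :> R); rewrite mulr1 in cm.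
have [C C1 HC] := young_fine_pow2.
have C0 : 0 < C by exact: lt_le_trans C1.
pose b : R := 2 ^+ m; have b0 : 0 < b by rewrite exprn_gt0.
have b1 : 1 < b by exact: lt_le_trans cm.
pose D := C ^+ m; have D0 : 0 < D by rewrite exprn_gt0.
have m0 : (0 < m)%N by rewrite lt0n; apply/eqP => m0; move: b1; rewrite /b m0 expr0 ltxx.
pose N := (Num.truncn (2 * D)).+1; exists b, D, N => q Nq; split => //.
- apply: (@le_trans _ _ q%:R).
    apply: (@le_trans _ _ N%:R); last by rewrite ler_nat.
    by apply: ltW; exact: truncnS_gt.
  apply: (@le_trans _ _ (2 ^+ q)); first by rewrite -natrX ler_nat ltnW // ltn_expl.
  by rewrite /b -exprM ler_eXn2l ?ltr1n // leq_pmull.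
- exact: young_fine0.
- exact: young_fine_ge0.
- exact: young_fine_ratio.
- by move=> t t0; apply: HC; exact: ltW.
- move=> t t0; apply: le_trans (nab t t0) _.
  have ct0 : 0 < c * t by rewrite mulr_gt0.
  have cb : c * t <= b * t by rewrite ler_pM2r.
  have H : a (c * t) / (c * t) * t / 2 <= a (b * t) / (b * t) * t / 2.
    by rewrite ler_pM2r ?invr_gt0 // ler_pM2r //; exact: young_fine_ratio.
  have -> : a (c * t) / (2 * c) = a (c * t) / (c * t) * t / 2 by field; rewrite !gt_eqF.
  by apply: (le_trans H); rewrite le_eqVlt; apply/orP; left; apply/eqP; field; rewrite !gt_eqF.
Qed.

Lemma meas_young : meas (fun t => a `|t|).
Proof.
have mm : meas (fun t => a (Num.max 0 t)).
  apply: nondecreasing_measurable => // s t st; apply: young_fine_le.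
    by rewrite le_max lexx.
  by rewrite ge_max !le_max lexx st orbT.
have := measurableT_comp mm (@meas_norm R _ (@measurable_id _ _ _)).
by congr meas; apply/funext => t /=; rewrite max_r.
Qed.

End YoungGrowth.

Section PowerBounds.
Variables (R : realType) (B : R -> R) (b D : R) (q0 : nat).
Hypothesis hB : intermediate_growth B b D q0.
Implicit Types (s t : R).

Let b_gt1 : 1 < b := growth_b_gt1 hB.
Let b_gt0 : 0 < b. Proof. exact: lt_trans b_gt1. Qed.
Let D_gt0 : 0 < D := growth_D_gt0 hB.
Let B_ge0 := growth_ge0 hB.

Lemma growth_large t : 1 <= t -> B t <= D * B 1 * t ^+ q0.
Proof.
move=> t1; have t0 : 0 < t by exact: lt_le_trans t1.
have := quasi_decreasing hB ltr01 t1; rewrite expr1n divr1 ler_pdivrMr ?exprn_gt0 //.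
Qed.

(** Going down the scales [b ^ (- k)], each step of [nabla_2] divides [B t / t]
    by [2], which is at least [b ^ r]. *)
Lemma growth_small r t : 0 <= r -> b `^ r <= 2 -> 0 < t -> t <= 1 ->
  B t <= 2 * B 1 * (t * t `^ r).
Proof.
move=> r0 br t0 t1; have B1 : 0 <= B 1 by exact: B_ge0.
have [k kt] : exists k, b ^- k <= t.
  have [k tk] := expn_unbounded t^-1 b_gt1; exists k.
  by rewrite -[leRHS]invrK lef_pV2 ?posrE ?exprn_gt0 ?invr_gt0.
elim: k t t0 t1 kt => [|k IH] t t0 t1 kt.
  have -> : t = 1 by apply/eqP; rewrite eq_le t1 -[leLHS]invr1 -(expr0 b) kt.
  by rewrite powR1 !mulr1 ler_peMl // ler1n.
have powb : 1 <= b `^ r by rewrite -[leLHS](powRr0 b) ler_powR // ltW.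
case: (leP (b * t) 1) => bt1.
  have bt0 : 0 < b * t by rewrite mulr_gt0.
  have kbt : b ^- k <= b * t.
    by rewrite -ler_pdivrMl // -invfM -exprS.
  have {kbt} := IH _ bt0 bt1 kbt => H.
  apply: le_trans (growth_nabla hB t0) _; rewrite ler_pdivrMr ?mulr_gt0 //.
  apply: (le_trans H); rewrite powRM ?(ltW b_gt0) ?(ltW t0) //.
  have -> : 2 * B 1 * (b * t * (b `^ r * t `^ r)) = 2 * B 1 * t * t `^ r * b * b `^ r by ring.
  have -> : 2 * B 1 * (t * t `^ r) * (2 * b) = 2 * B 1 * t * t `^ r * b * 2 by ring.
  apply: ler_wpM2l => //; rewrite !mulr_ge0 ?powR_ge0 //; exact: ltW.
have := growth_ratio hB t0 t1; rewrite divr1 ler_pdivrMr // => /le_trans; apply.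
rewrite [2 * B 1]mulrC -mulrA ler_wpM2l // mulrCA ler_peMr ?(ltW t0) //.
apply: (@le_trans _ _ (b `^ r * t `^ r)); last by rewrite ler_wpM2r ?powR_ge0.
rewrite -powRM ?(ltW b_gt0) ?(ltW t0) // -[leLHS](powRr0 (b * t)) ler_powR //.
exact: ltW.
Qed.

End PowerBounds.

(** * Modular convergence of the truncated sums *)

Lemma growth_le (R : realType) (B : R -> R) (b D : R) (q : nat) (s t : R) :
  intermediate_growth B b D q -> 0 <= s -> s <= t -> B s <= B t.
Proof.
move=> hB; rewrite le_eqVlt => /orP[/eqP <- t0|]; last exact: growth_ndecr hB _ _.
by rewrite (growth0 hB) (growth_ge0 hB).
Qed.

Section PointwiseSplit.
Variables (R : realType) (B : R -> R) (b D : R) (N : nat).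
Hypothesis hB : forall q, (N <= q)%N -> intermediate_growth B b D q.
Implicit Types (s t e : R).

(** The exponent [q] is taken so large that [b ^ (2 / (q - 1)) <= 2] and that
    [q - 1] is already an upper exponent. Then [B] is at most of order
    [t ^ (1 + 2 r)] at the origin and of order [t ^ (q - 1)] at infinity, where
    [r = 1 / (q - 1)]: a factor [t ^ r] or [1 / t] better than the powers on
    the right. In between, [t ^ 2] is bounded below. *)
Lemma growth_interpolate : exists2 q, (2 < q)%N & forall e, 0 < e ->
  exists2 C, 0 <= C & forall t, 0 <= t ->
    B t <= e * (conj_power q t + t ^+ q) + C * t ^+ 2.
Proof.
pose K := (Num.truncn (b ^+ 2)).+1; pose q := (N + K + 3)%N.
have q3 : (2 < q)%N by rewrite /q addnS !addnS.
have Nq : (N <= q.-1)%N by rewrite /q; move: (K) => k; lia.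
have hq := hB Nq; have hN := hB (leqnn N).
have b1 := growth_b_gt1 hq; have b0 : 0 < b by exact: lt_trans b1.
have D0 := growth_D_gt0 hq.
have B1 : 0 <= B 1 by exact: growth_ge0 hq _ ler01.
pose r : R := (q.-1)%:R^-1.
have r0 : 0 <= r by rewrite invr_ge0.
have br : b `^ (r + r) <= 2.
  rewrite powRD; last by rewrite (gt_eqF b0) implybT.
  rewrite -powRM ?(ltW b0) // -[leRHS](@powr_root R q q3) //.
  apply: ge0_ler_powR; rewrite ?nnegrE ?mulr_ge0 ?exprn_ge0 ?(ltW b0) //.
  rewrite -expr2; apply: (@le_trans _ _ K%:R); first by apply: ltW; exact: truncnS_gt.
  rewrite -natrX ler_nat; apply: (@leq_trans (2 ^ K)%N); first by rewrite ltnW // ltn_expl.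
  by rewrite leq_exp2l // /q; move: (K) => k; lia.
exists q => // e e0.
pose u := Num.min 1 (e / (2 * B 1 + 1)).
have k0 : 0 < 2 * B 1 + 1 by rewrite ltr_wpDl // mulr_ge0.
have u0 : 0 < u by rewrite lt_min ltr01 divr_gt0.
have u1 : u <= 1 by rewrite ge_min lexx.
have ue : 2 * B 1 * u <= e.
  have : u <= e / (2 * B 1 + 1) by rewrite ge_min lexx orbT.
  by rewrite ler_pdivlMr //; nra.
pose d := u ^+ q.-1; have d0 : 0 < d by rewrite exprn_gt0.
have d1 : d <= 1 by rewrite exprn_ile1 // ltW.
pose M := Num.max 1 (D * B 1 / e).
have M1 : 1 <= M by rewrite le_max lexx.
have M0 : 0 < M by exact: lt_le_trans M1.
have BM : 0 <= B M by rewrite (growth_ge0 hq) // ltW.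
have C0 : 0 <= B M / d ^+ 2 by rewrite divr_ge0 // exprn_ge0 // ltW.
have cp0 t : 0 <= t -> 0 <= conj_power q t by exact: conj_power_ge0.
exists (B M / d ^+ 2) => // t t0.
have t20 : 0 <= B M / d ^+ 2 * t ^+ 2 by rewrite mulr_ge0 // sqr_ge0.
have tq0 : 0 <= t ^+ q by rewrite exprn_ge0.
case: (leP t d) => td.
  apply: (@le_trans _ _ (e * conj_power q t)); last first.
    by rewrite ler_wpDr // ler_pM2l // lerDl.
  case: (eqVneq t 0) => [->|tn0].
    by rewrite (growth0 hq) /conj_power mul0r mulr0.
  have tp : 0 < t by rewrite lt_neqAle eq_sym tn0.
  apply: le_trans (growth_small hq (addr_ge0 r0 r0) br tp (le_trans td d1)) _.
  rewrite powRD; last by rewrite tn0 implybT.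
  have tu : t `^ r <= u.
    rewrite -(@powr_root R q q3 u (ltW u0)); apply: ge0_ler_powR => //; rewrite nnegrE //.
    exact: ltW.
  apply: le_trans (_ : 2 * B 1 * u * conj_power q t <= _); last by rewrite ler_wpM2r // cp0.
  rewrite /conj_power -/r.
  have -> : 2 * B 1 * (t * (t `^ r * t `^ r)) = 2 * B 1 * (t * t `^ r) * t `^ r by ring.
  have -> : 2 * B 1 * u * (t * t `^ r) = 2 * B 1 * (t * t `^ r) * u by ring.
  by rewrite ler_wpM2l // !mulr_ge0 ?powR_ge0.
case: (leP M t) => tM.
  apply: (@le_trans _ _ (e * t ^+ q)); last first.
    by rewrite ler_wpDr // ler_pM2l // lerDr cp0.
  have t1 : 1 <= t by exact: le_trans tM.
  apply: le_trans (growth_large hq t1) _.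
  have -> : t ^+ q = t * t ^+ q.-1 by rewrite -exprS /q addnS.
  rewrite mulrA ler_wpM2r ?exprn_ge0 // -ler_pdivrMl //.
  by apply: le_trans tM; rewrite [leLHS]mulrC /M le_max lexx orbT.
rewrite ler_wpDl //; first by apply: mulr_ge0; [exact: ltW|rewrite addr_ge0 // cp0].
apply: (@le_trans _ _ (B M)); first by apply: (growth_le hN) => //; exact: ltW.
rewrite mulrAC -mulrA ler_peMr // ler_pdivlMr ?exprn_gt0 // mul1r.
by rewrite lerXn2r ?nnegrE ?(ltW d0) // ltW.
Qed.

End PointwiseSplit.

Lemma growth_dilate (R : realType) (B : R -> R) (b D : R) (q : nat) (k : R) :
  intermediate_growth B b D q -> 0 <= k ->
  exists2 C, 0 <= C & forall t, 0 <= t -> B (k * t) <= C * B t.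
Proof.
move=> hB k0; have b1 := growth_b_gt1 hB; have D0 := growth_D_gt0 hB.
have b0 : 0 < b by exact: lt_trans b1.
have [n kn] := expn_unbounded k b1.
exists (D ^+ n) => [|t t0]; first by rewrite exprn_ge0 // ltW.
apply: le_trans (growth_le hB _ (ler_wpM2r t0 kn)) _; first by rewrite mulr_ge0.
move: t0; rewrite le_eqVlt => /orP[/eqP <-|t0]; first by rewrite mulr0 (growth0 hB) mulr0.
elim: n {kn} => [|n IH]; first by rewrite !expr0 !mul1r.
rewrite !exprS -!mulrA.
apply: le_trans (growth_doubling hB _) _; first by rewrite mulr_gt0 // exprn_gt0.
by rewrite ler_pM2l.
Qed.

Lemma growth_add (R : realType) (B : R -> R) (b D : R) (q : nat) :
  intermediate_growth B b D q -> exists2 C, 0 <= C & forall s t, 0 <= s -> 0 <= t ->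
    B (s + t) <= C * (B s + B t).
Proof.
move=> hB; have [C C0 HC] := growth_dilate hB (ler0n R 2); have B0 := growth_ge0 hB.
exists C => // s t; wlog st : s t / s <= t.
  move=> W s0 t0; case: (leP s t) => [|/ltW] st; first exact: W.
  by rewrite addrC [B s + _]addrC; exact: W.
move=> s0 t0; apply: (@le_trans _ _ (B (2 * t))).
  by apply: (growth_le hB); [rewrite addr_ge0|lra].
by apply: le_trans (HC t t0) _; rewrite ler_wpM2l // lerDr B0.
Qed.

Section ModularConvergence.
Variable R : realType.
Local Notation mu := (@lebesgue_measure R).
Local Notation h := (@hermite_fun R).
Variables (B : R -> R) (b D : R) (N : nat).
Hypothesis hB : forall q, (N <= q)%N -> intermediate_growth B b D q.
Hypothesis mB : meas (fun t : R => B `|t|).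
Implicit Types (f g : R -> R) (x t s : R).

Let hN := hB (leqnn N).
Let B_ge0 := growth_ge0 hN.
Let B_le s t : 0 <= s -> s <= t -> B s <= B t := @growth_le _ _ _ _ _ s t hN.

Lemma meas_modular f : meas f -> meas (fun x => B `|f x|).
Proof. by move=> mf; exact: measurableT_comp mB mf. Qed.

Lemma L1_modular_bounded T (C : R) f : meas f -> (forall x, `|f x| <= C) ->
  supported T f -> L1 (fun x => B `|f x|).
Proof.
move=> mf fC fT; apply: (@L1_supported _ T (B C)).
- exact: meas_modular.
- by move=> x; rewrite ger0_norm ?B_ge0 // B_le.
- by move=> x /fT ->; rewrite normr0 (growth0 hN).
Qed.

(** The difference [g] is bounded in the two outer power norms and tends to [0]
    in mean square; [growth_interpolate] combines the two facts. *)
Lemma ksum_modular_bounded f (M X : R) (T : nat -> R) : 0 < X -> meas f ->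
  (forall x, `|f x| <= M) -> (forall x, X <= `|x| -> f x = 0) ->
  (\forall n \near \oo, T n ^+ 2 <= n%:R) -> T n @[n --> \oo] --> +oo ->
  forall e, 0 < e -> \forall n \near \oo,
    lebint (fun x => B `|ksum n (T n) f x - f x|) <= e.
Proof.
move=> X0 mf fM fX Tn Too e e0.
have [q q3 Hq] := growth_interpolate hB.
have q0 : (0 < q)%N by apply: ltn_trans q3.
have [Cs Cs0 Hs] := @ksum_bounds R q q3.
have fTX : supported X f.
  by move=> x xX; apply: fX; rewrite leNgt; apply: contra xX; rewrite ltr_norml.
have Lc := L1_conj_power q3 mf fM fTX; have Lq := L1_bounded_supported mf fM fTX q0.
set Ic := lebint (fun x => conj_power q `|f x|) in Hs *.
pose Iq := lebint (fun x => `|f x| ^+ q).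
have cp0 (t : R) : 0 <= t -> 0 <= conj_power q t by exact: conj_power_ge0.
have Ic0 : 0 <= Ic by apply: lebint_ge0 => x; exact: cp0.
have Iq0 : 0 <= Iq by apply: lebint_ge0 => x; exact: exprn_ge0.
have hc := @conj_power_growth R q q3; have [Ka Ka0 HKa] := growth_add hc.
pose E := Ka * (Cs + 1) * Ic + 2 ^+ q * (Cs + 1) * Iq.
have E0 : 0 <= E.
  by rewrite addr_ge0 // mulr_ge0 // mulr_ge0 ?exprn_ge0 ?addr_ge0.
have e1 : 0 < e / 2 / (E + 1) by rewrite !divr_gt0 // ltr_wpDl.
have [C C0 HC] := Hq _ e1.
have e2 : 0 < e / 2 / (C + 1) by rewrite !divr_gt0 // ltr_wpDl.
have [_ /(_ _ e2)[n0 Hn0]] := hermite_cvg_bounded X0 mf fM fX.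
near=> n.
have TX : X <= T n by near: n; move/cvgryPge : Too; apply.
have T0 : 0 < T n by exact: lt_le_trans TX.
have Tnn : T n ^+ 2 <= n%:R by near: n.
have nn0 : (n0 <= n)%N by near: n; exact: nbhs_infty_ge.
have fT : supported (T n) f.
  move=> x xT; apply: fTX; apply: contra xT => /andP[x1 x2].
  by rewrite (le_lt_trans _ x1) ?lerN2 // (lt_le_trans x2).
have [bc bq] := Hs n (T n) f M T0 Tnn mf fM fT.
pose g x := ksum n (T n) f x - f x.
have [K HK] := ksum_bounded n (T n) f.
have mK := meas_ksum n (T n) f; have KT := @ksum_supported R n (T n) f.
have mg : meas g by exact: measB.
have gC x : `|g x| <= K + M by rewrite (le_trans (ler_normB _ _)) // lerD.
have gT : supported (T n) g.
  by move=> x xT; rewrite /g (KT x xT) (fT x xT) subrr.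
have Lgc := L1_conj_power q3 mg gC gT.
have Lgq := L1_bounded_supported mg gC gT q0.
have Lg2 := L1_bounded_supported mg gC gT (ltn0Sn 1).
have LKc := L1_conj_power q3 mK HK KT.
have LKq := L1_bounded_supported mK HK KT q0.
have two_pow (u v : R) : 0 <= u -> 0 <= v -> (u + v) ^+ q <= 2 ^+ q * (u ^+ q + v ^+ q).
  wlog uv : u v / u <= v.
    move=> W u0 v0; case: (leP u v) => [|/ltW] uv; first exact: W.
    by rewrite addrC [u ^+ q + _]addrC; exact: W.
  move=> u0 v0; apply: (@le_trans _ _ ((2 * v) ^+ q)).
    by rewrite lerXn2r ?nnegrE ?addr_ge0 ?mulr_ge0 //; lra.
  by rewrite exprMn ler_wpM2l ?exprn_ge0 // lerDr exprn_ge0.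
have gcq : lebint (fun x => conj_power q `|g x|) <= Ka * (Cs + 1) * Ic.
  apply: (@le_trans _ _ (Ka * (lebint (fun x => conj_power q `|ksum n (T n) f x|) + Ic))).
    rewrite /Ic -lebintD // -lebintZ; last exact: L1D.
    apply: lebint_le => //; first by apply: L1Z; exact: L1D.
    move=> x; apply: le_trans (HKa _ _ (normr_ge0 _) (normr_ge0 _)).
    by apply: (growth_le hc) => //; exact: ler_normB.
  by rewrite -mulrA ler_wpM2l // mulrDl mul1r lerD2r.
have gqq : lebint (fun x => `|g x| ^+ q) <= 2 ^+ q * (Cs + 1) * Iq.
  apply: (@le_trans _ _ (2 ^+ q * (lebint (fun x => `|ksum n (T n) f x| ^+ q) + Iq))).
    rewrite /Iq -lebintD // -lebintZ; last exact: L1D.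
    apply: lebint_le => //; first by apply: L1Z; exact: L1D.
    move=> x; apply: le_trans (two_pow _ _ (normr_ge0 _) (normr_ge0 _)).
    by rewrite lerXn2r ?nnegrE ?addr_ge0 // ler_normB.
  by rewrite -mulrA ler_pM2l ?exprn_gt0 // mulrDl mul1r lerD2r.
have g2 : lebint (fun x => `|g x| ^+ 2) <= e / 2 / (C + 1).
  apply: le_trans (Hn0 n nn0); have Gf := supported_gauss_bounded mf fM fT.
  have Gd : gauss_bounded (fun x => f x - hsum n f x).
    by apply: gauss_boundedB => //; exact: gauss_bounded_hsum.
  apply: lebint_le => //; first exact: gauss_boundedM_L1.
  move=> x; rewrite /g /ksum real_normK ?num_real // -expr2.
  case: (boolP (- T n < x < T n)) => xT; last first.
    by rewrite indicE memNset ?mul0r ?fT // ?subrr ?expr0n ?sqr_ge0 //= in_itv /=; exact/negP.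
  by rewrite indicE mem_set ?mul1r -1?sqrrN ?opprB //= in_itv.
apply: (@le_trans _ _ (lebint (fun x => e / 2 / (E + 1) *
    (conj_power q `|g x| + `|g x| ^+ q) + C * `|g x| ^+ 2))).
  apply: lebint_le; first exact: L1_modular_bounded mg gC gT.
    by apply: L1D; [apply: L1Z; exact: L1D|exact: L1Z].
  by move=> x; exact: HC.
rewrite lebintD; [|by apply: L1Z; exact: L1D|exact: L1Z].
rewrite !lebintZ //; last exact: L1D.
rewrite lebintD // [leRHS](splitr e); apply: lerD.
  apply: (@le_trans _ _ (e / 2 / (E + 1) * E)).
    by rewrite ler_pM2l // /E lerD.
  by rewrite mulrAC ler_pdivrMr ?ltr_wpDl // ler_pM2l ?divr_gt0 // lerDl.
apply: (@le_trans _ _ (C * (e / 2 / (C + 1)))); first by rewrite ler_wpM2l.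
by rewrite mulrCA -[leRHS]mulr1 ler_pM2l ?divr_gt0 // ler_pdivrMr ?ltr_wpDl // mul1r lerDl.
Unshelve. all: by end_near. Qed.

End ModularConvergence.

Section ModularLimit.
Variable R : realType.
Local Notation mu := (@lebesgue_measure R).
Variables (B : R -> R) (b D : R) (N : nat).
Hypothesis hB : forall q, (N <= q)%N -> intermediate_growth B b D q.
Hypothesis mB : meas (fun t : R => B `|t|).
Hypothesis B_pos : exists2 t, 0 < t & 0 < B t.
Implicit Types (f g : R -> R) (x t s : R).

Let hN := hB (leqnn N).
Let B_ge0 := growth_ge0 hN.
Let B_le s t : 0 <= s -> s <= t -> B s <= B t := @growth_le _ _ _ _ _ s t hN.

Lemma L1_modularZ f k : meas f -> L1 (fun x => B `|f x|) -> L1 (fun x => B `|k * f x|).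
Proof.
move=> mf Lf; have [C C0 HC] := growth_dilate hN (normr_ge0 k).
apply: (L1_le (g := fun x => C * B `|f x|)); last exact: L1Z.
- by apply: meas_modular => //; apply: measM => //; exact: meas_cst.
- by move=> x; rewrite ger0_norm ?B_ge0 // normrM HC.
Qed.

Lemma L1_modularB f g : meas f -> meas g ->
  L1 (fun x => B `|f x|) -> L1 (fun x => B `|g x|) -> L1 (fun x => B `|f x - g x|).
Proof.
move=> mf mg Lf Lg; have [C C0 HC] := growth_add hN.
apply: (L1_le (g := fun x => C * (B `|f x| + B `|g x|))); last by apply: L1Z; exact: L1D.
- by apply: meas_modular => //; exact: measB.
- move=> x; rewrite ger0_norm ?B_ge0 //; apply: le_trans (HC _ _ (normr_ge0 _) (normr_ge0 _)).
  by apply: B_le => //; exact: ler_normB.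
Qed.

(** From a point where [B] is positive on, [B] grows at least linearly; so a
    finite modular forces local integrability. *)
Lemma L1_modular_truncate f T : meas f -> L1 (fun x => B `|f x|) ->
  L1 (fun x => f x * \1_(`]- T, T[%classic : set R) x).
Proof.
move=> mf Lf; have [t0 t00 Bt0] := B_pos.
have LI : L1 (\1_(`]- T, T[%classic : set R)).
  by apply: L1_indic; [exact: measurable_itvT|exact: mu_itvT].
apply: (L1_le (g := fun x => t0 * \1_(`]- T, T[%classic : set R) x + t0 / B t0 * B `|f x|)).
- by apply: measM => //; exact: L1_meas LI.
- move=> x; rewrite indicE; case: (_ \in _); last first.
    by rewrite !mulr0 normr0 add0r mulr_ge0 ?B_ge0 // divr_ge0 // ltW.
  rewrite !mulr1; case: (leP `|f x| t0) => ft.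
    by rewrite ler_wpDr // mulr_ge0 ?B_ge0 // divr_ge0 // ltW.
  have f0 : 0 < `|f x| by exact: lt_trans ft.
  rewrite ler_wpDl ?(ltW t00) //.
  have := growth_ratio hN t00 (ltW ft); rewrite ler_pdivlMr // => H.
  by rewrite mulrAC ler_pdivlMr // mulrC -ler_pdivrMl // mulrA [_^-1 * _]mulrC.
- by apply: L1D; exact: L1Z.
Qed.

(** Dominated convergence, [f] being cut off in height and in space. *)
Lemma modular_dense f : meas f -> L1 (fun x => B `|f x|) -> forall e, 0 < e ->
  exists f1 M, [/\ 0 < M, meas f1, (forall x, `|f1 x| <= M),
    (forall x, M <= `|x| -> f1 x = 0)
    & L1 (fun x => B `|f x - f1 x|) /\ lebint (fun x => B `|f x - f1 x|) <= e].
Proof.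
move=> mf Lf e e0.
pose E (m : nat) : set R := [set x | (m%:R < `|f x|)%R] `|` [set x | (m%:R < `|x|)%R].
have mE m : measurable (E m).
  by apply: measurableU; apply: measurable_superlevel;
    [exact: meas_norm|exact: (meas_norm (@measurable_id _ _ _))].
pose f2 m x := f x * \1_(E m) x.
have mf2 m : meas (f2 m) by apply: measM => //; exact: meas_indic.
have EP m x : (x \in E m) = (m%:R < `|f x|) || (m%:R < `|x|).
  by apply/idP/idP => [/set_mem[]/= ->|/orP[]h]; rewrite ?orbT // inE; [left|right].
have Bf2 m x : `|B `|f2 m x| | <= B `|f x|.
  rewrite ger0_norm ?B_ge0 // /f2 indicE; case: (_ \in _); rewrite ?mulr1 //.
  by rewrite mulr0 normr0 (growth0 hN) B_ge0.
have cvg : {ae mu, forall x, B `|f2 m x| @[m --> \oo] --> (0 : R)}.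
  apply: aeW => x; apply: cvg_near_cst; near=> m.
  rewrite /f2 indicE EP; suff -> : (m%:R < `|f x|) || (m%:R < `|x|) = false.
    by rewrite mulr0 normr0 (growth0 hN).
  apply/negbTE; rewrite negb_or -!leNgt; apply/andP; split.
    by near: m; apply: filterS (nbhs_infty_ger `|f x|).
  by near: m; apply: filterS (nbhs_infty_ger `|x|).
have := lebint_dominated (fun m => meas_modular mB (mf2 m)) (meas_cst 0) Lf Bf2 cvg.
rewrite lebint0 => /cvgrPdist_le/(_ _ e0)[m _ Hm].
have {Hm} := Hm m.+1 (leqnSn m); rewrite sub0r normrN ger0_norm; last first.
  by apply: lebint_ge0 => x; exact: B_ge0.
(* Support in [|x| <= m.+1], hence [0] from [m.+2] on. *)
move=> He; exists (fun x => f x - f2 m.+1 x), m.+2%:R.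
have fE : (fun x => B `|f x - (f x - f2 m.+1 x)|) = fun x => B `|f2 m.+1 x|.
  by apply/funext => x; rewrite subKr.
rewrite fE; split => //; last split=> //.
- exact: measB.
- move=> x; rewrite /f2 indicE EP; case: leP => fx; last by rewrite mulr1 subrr normr0.
  case: (_ < _); first by rewrite mulr1 subrr normr0.
  by rewrite mulr0 subr0 (le_trans fx) // ler_nat.
- move=> x xm; rewrite /f2 indicE EP [X in _ || X](lt_le_trans _ xm) ?ltr_nat //.
  by rewrite orbT mulr1 subrr.
- exact: (L1_le (meas_modular mB (mf2 _)) (Bf2 _)).
Unshelve. all: by end_near. Qed.

Lemma ksumZ n T a f : L1 f -> forall x, ksum n T (fun x => a * f x) x = a * ksum n T f x.
Proof.
move=> Lf x; rewrite /ksum mulrCA; congr (_ * _).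
rewrite /hsum mulr_sumr; apply: eq_bigr => k _; rewrite mulrA; congr (_ * _).
rewrite /ip -lebintZ; last exact: L1_mul_hermite.
by congr lebint; apply/funext => y; rewrite mulrA.
Qed.

(** Interpolation between the weak type (1, 1) and the strong type [(q, q)],
    applied to [2 f] so that the division by [2] in the modular disappears. *)
Lemma ksum_modular_bound : exists2 C, 0 <= C & forall n T f, 0 < T -> T ^+ 2 <= n%:R ->
  L1 f -> supported T f -> L1 (fun x => B `|f x|) ->
  lebint (fun x => B `|ksum n T f x|) <= C * lebint (fun x => B `|f x|).
Proof.
pose q := (N + 3)%N; have q3 : (2 < q)%N by rewrite /q addn3.
have hq := hB (leq_addr 3 N : (N <= q)%N).
have [Cs Cs0 Hs] := @ksum_bounds R q q3.
have [C2 C20 H2] := growth_dilate hN (ler0n R 2).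
pose Cm := 2 * D * 128 + 2 * D ^+ 2 * Cs.
have D0 := growth_D_gt0 hN.
have Cm0 : 0 <= Cm by rewrite addr_ge0 // mulr_ge0 // mulr_ge0 // ?exprn_ge0 // ltW.
exists (Cm * C2) => [|n T f T0 Tn Lf fT LB]; first exact: mulr_ge0.
have mf := L1_meas Lf.
have WS : weak_strong (ksum n T) T 128 Cs q.
  by apply: weak_strong_ksum => // g M mg gM gT; case: (Hs n T g M T0 Tn mg gM gT).
have f2T : supported T (fun x => 2 * f x) by move=> x /fT ->; rewrite mulr0.
have := marcinkiewicz (ltnW (ltnW q3)) WS hq mB (L1Z 2 Lf) f2T (L1_modularZ 2 mf LB).
have -> : (fun x => B (`|ksum n T (fun x => 2 * f x) x| / 2)) = fun x => B `|ksum n T f x|.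
  by apply/funext => x; rewrite ksumZ // normrM (@ger0_norm _ 2) // mulrC mulKf.
move=> H; apply: (le_trans H); rewrite -[leRHS]mulrA ler_wpM2l // -lebintZ //.
apply: lebint_le; [exact: L1_modularZ|exact: L1Z|] => x.
by rewrite normrM (@ger0_norm _ 2) // H2.
Qed.

(** [f = f1 + f2] with [f1] bounded of bounded support and [f2] of small
    modular: the error is the error of [f1], the truncated sum of [f2], and
    [f2]. *)
Lemma ksum_modular_cvg f (T : nat -> R) : meas f -> L1 (fun x => B `|f x|) ->
  (\forall n \near \oo, T n ^+ 2 <= n%:R) -> T n @[n --> \oo] --> +oo ->
  forall e, 0 < e -> \forall n \near \oo,
    let g := fun x => ksum n (T n) (fun y => f y * \1_(`]- T n, T n[%classic : set R) y) x - f x in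
    L1 (fun x => B `|g x|) /\ lebint (fun x => B `|g x|) <= e.
Proof.
move=> mf Lf Tn Too e e0.
have [Ca Ca0 HCa] := growth_add hN; have [Cb Cb0 HCb] := ksum_modular_bound.
have Ca1 : 0 < Ca + 1 by rewrite ltr_wpDl.
have Cb1 : 0 < Cb + 1 by rewrite ltr_wpDl.
pose e1 := e / 2 / (Ca + 1); have e10 : 0 < e1 by rewrite !divr_gt0.
pose e2 := e1 / (Ca + 1) / (Cb + 1); have e20 : 0 < e2 by rewrite !divr_gt0.
have [f1 [M [M0 mf1 f1M f1X [Lf2 If2]]]] := modular_dense mf Lf e20.
have near1 := ksum_modular_bounded hB mB M0 mf1 f1M f1X Tn Too e10.
near=> n; pose chi : R -> R := \1_(`]- T n, T n[%classic : set R).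
rewrite -/chi /=.
have TM : M <= T n by near: n; move/cvgryPge : Too; apply.
have T0 : 0 < T n by exact: lt_le_trans TM.
have Tnn : T n ^+ 2 <= n%:R by near: n.
have chiE x : chi x = (- T n < x < T n)%R%:R.
  by rewrite /chi indicE; congr (nat_of_bool _)%:R; apply/idP/idP; rewrite inE /= in_itv.
have f1T : supported (T n) f1.
  move=> x xT; apply: f1X; rewrite leNgt; apply: contra xT; rewrite ltr_norml => /andP[x1 x2].
  by rewrite (le_lt_trans _ x1) ?lerN2 // (lt_le_trans x2).
have f1chi x : f1 x * chi x = f1 x.
  by rewrite chiE; case: (boolP (_ < _ < _)) => xT; rewrite ?mulr1 // mulr0 f1T.
pose f2 x := (f x - f1 x) * chi x.
have mf2' : meas (fun x => f x - f1 x) by exact: measB.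
have L2 : L1 f2 by exact: L1_modular_truncate.
have L1f1 : L1 f1 by exact: L1_supported f1M f1T.
have f2T : supported (T n) f2 by move=> x xT; rewrite /f2 chiE (negbTE xT) mulr0.
have Bf2 x : B `|f2 x| <= B `|f x - f1 x|.
  by rewrite /f2 chiE; case: (_ < _ < _); rewrite ?mulr1 // mulr0 normr0 (growth0 hN) B_ge0.
have LB2 : L1 (fun x => B `|f2 x|).
  apply: L1_le Lf2; first exact: (meas_modular mB (L1_meas L2)).
  by move=> x; rewrite ger0_norm ?B_ge0.
pose u x := ksum n (T n) f1 x - f1 x; pose v x := ksum n (T n) f2 x; pose w x := f x - f1 x.
have mK g : meas (ksum n (T n) g) by exact: meas_ksum.
have KL g : L1 (fun x => B `|ksum n (T n) g x|).
  have [C HC] := ksum_bounded n (T n) g.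
  exact: (L1_modular_bounded hB mB (mK g) HC (@ksum_supported R n (T n) g)).
have gE x : ksum n (T n) (fun y => f y * chi y) x - f x = u x + (v x - w x).
  have -> : (fun y => f y * chi y) = fun y => f1 y + f2 y.
    by apply/funext => y; rewrite /f2 mulrBl f1chi subrKC.
  by rewrite ksumD // /u /v /w; ring.
have Lu : L1 (fun x => B `|u x|).
  apply: L1_modularB => //; exact: (L1_modular_bounded hB mB mf1 f1M f1T).
have Lv : L1 (fun x => B `|v x|) by exact: KL.
have mg : meas (fun x => ksum n (T n) (fun y => f y * chi y) x - f x) by exact: measB.
have bound x : B `|ksum n (T n) (fun y => f y * chi y) x - f x| <=
    Ca * (B `|u x| + Ca * (B `|v x| + B `|w x|)).
  rewrite gE; apply: (@le_trans _ _ (B (`|u x| + (`|v x| + `|w x|)))).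
    apply: B_le => //; apply: le_trans (ler_normD _ _) _; rewrite lerD2l; exact: ler_normB.
  apply: le_trans (HCa _ _ _ _) _ => //; rewrite ?addr_ge0 // ler_wpM2l // lerD2l.
  exact: HCa.
have Lvw : L1 (fun x => B `|v x| + B `|w x|) by exact: L1D.
have Lb : L1 (fun x => Ca * (B `|u x| + Ca * (B `|v x| + B `|w x|))).
  by apply: L1Z; apply: L1D => //; exact: L1Z.
have Lg : L1 (fun x => B `|ksum n (T n) (fun y => f y * chi y) x - f x|).
  apply: L1_le Lb; first exact: meas_modular.
  by move=> x; rewrite ger0_norm ?B_ge0.
split=> //; apply: le_trans (lebint_le Lg Lb bound) _.
rewrite lebintZ; last by apply: L1D => //; exact: L1Z.
rewrite lebintD //; last exact: L1Z.
rewrite lebintZ // lebintD //.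
have Iu : lebint (fun x => B `|u x|) <= e1 by rewrite /u; near: n; exact: near1.
have Iv : lebint (fun x => B `|v x|) <= Cb * e2.
  apply: le_trans (HCb n (T n) f2 T0 Tnn L2 f2T LB2) _; rewrite ler_wpM2l //.
  exact: le_trans (lebint_le LB2 Lf2 Bf2) If2.
have Ivw : lebint (fun x => B `|v x|) + lebint (fun x => B `|w x|) <= e1 / (Ca + 1).
  apply: (@le_trans _ _ (Cb * e2 + e2)); first exact: lerD.
  by rewrite -[X in _ + X]mul1r -mulrDl /e2 mulrC divfK // gt_eqF.
have Ca2 : Ca * (e1 / (Ca + 1)) <= e1.
  by rewrite mulrCA ger_pMr // ler_pdivrMr // mul1r lerDl.
apply: (@le_trans _ _ (Ca * (e1 + e1))).
  by rewrite ler_wpM2l // lerD // (le_trans _ Ca2) // ler_wpM2l.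
have -> : e = (Ca + 1) * (e1 + e1) by rewrite /e1; field; rewrite gt_eqF.
by rewrite ler_wpM2r ?addr_ge0 ?(ltW e10) // lerDl.
Unshelve. all: by end_near. Qed.

End ModularLimit.

(** * From Lebesgue to Borel measurability *)

Section Completion.
Variable R : realType.
Local Notation mu := (@lebesgue_measure R).
Implicit Types (f g : R -> R) (N E : set R).

Lemma leb_measurable E : measurable E -> measurable (E : set (lebesgueR R)).
Proof. by move=> mE; exact: sub_caratheodory. Qed.

Lemma leb_measurable_fun d (Y : measurableType d) (F : R -> Y) :
  measurable_fun [set: R] F -> measurable_fun [set: lebesgueR R] (F : lebesgueR R -> Y).
Proof.
move=> mF _ E mE; apply: leb_measurable; exact: (mF measurableT).
Qed.

(** The Borel measure is the image of the completed one under the identity. *)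
Lemma integral_leb (F : R -> \bar R) : measurable_fun [set: R] F ->
  (\int[leb R]_x F x = \int[mu]_x F x)%E.
Proof.
move=> mF; have mid : measurable_fun [set: lebesgueR R] (id : lebesgueR R -> measurableTypeR R).
  exact: (leb_measurable_fun (@measurable_id _ R setT)).
have ge0 (G : R -> \bar R) : measurable_fun [set: R] G -> (forall x, 0 <= G x)%E ->
    (\int[leb R]_x G x = \int[mu]_x G x)%E.
  move=> mG G0.
  have := @ge0_integral_pushforward _ _ (lebesgueR R) (measurableTypeR R) R _ mid (leb R) setT
    G measurableT mG (fun x _ => G0 x).
  by rewrite preimage_setT /= => <-.
rewrite integralE [RHS]integralE; congr (_ - _)%E; apply: ge0 => //.
- exact: measurable_funepos.
- exact: measurable_funeneg.
Qed.

Lemma integral_leb_ae (F G : R -> \bar R) N :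
  measurable_fun [set: lebesgueR R] (F : lebesgueR R -> \bar R) ->
  measurable_fun [set: R] G -> measurable N -> mu N = 0%E -> (forall x, ~ N x -> F x = G x) ->
  (\int[leb R]_x F x = \int[mu]_x G x)%E.
Proof.
move=> mF mG mN N0 FG; rewrite -integral_leb //.
apply: ae_eq_integral; [exact: measurableT|exact: mF|exact: leb_measurable_fun|].
exists N; split => //; first exact: leb_measurable.
by move=> x /= nFG; apply: contrapT => Nx; apply: nFG => _; exact: FG.
Qed.

(** The values of [f] are redefined on the union of the exceptional sets of the
    superlevel sets at rational heights. *)
Lemma lebesgue_measurable_borel f : lebesgue_measurable_fun f ->
  exists g N, [/\ meas g, measurable N, mu N = 0%E & forall x, ~ N x -> f x = g x].
Proof.
move=> mf.
have sets (r : rat) : exists E M : set R, [/\ measurable E, measurable M, mu M = 0%E &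
    forall x, ~ M x -> E x <-> (ratr r < f x)%R].
  have := mf measurableT _ (measurable_itv `]ratr r, +oo[).
  rewrite setTI -completed_caratheodory_measurable g_sigma_completed_algebra_genE.
  move=> [E mE [M' [M [mM M0 MM]] EM]]; exists E, M; split => // x nMx.
  have : (E `|` M') x <-> (f @^-1` `]ratr r, +oo[) x by rewrite EM.
  rewrite /= in_itv /= andbT => <-; split; [by left|by case=> // /MM].
have /choice[E /choice[M EM]] := sets.
pose N := \bigcup_r M r.
have mN : measurable N by apply: bigcupT_measurable_rat => r; case: (EM r).
have N0 : mu N = 0%E.
  apply/measure_negligible => //.
  have [u uK] : exists u : nat -> option rat, forall r, exists k, u k = Some r.
    by exists unpickle => r; exists (pickle r); exact: pickleK.
  have -> : N = \bigcup_k (if u k is Some r then M r else set0).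
    apply/seteqP; split => x.
      by move=> [r _ Mx]; have [k uk] := uK r; exists k => //; rewrite uk.
    by move=> [k _]; case: (u k) => // r Mx; exists r.
  apply: negligible_bigcup => k; case: (u k) => [r|]; last exact: negligible_set0.
  by have [_ mM M0 _] := EM r; exists (M r); split.
exists (fun x => f x * \1_(~` N) x), N; split => //; last first.
  by move=> x Nx; rewrite indicE mem_set ?mulr1.
apply: (measurability _ (RGenOInfty.measurableE R)).
move=> _ [_ [t ->] <-]; rewrite setTI.
have NE x : ~ N x -> forall r, E r x <-> (ratr r < f x)%R.
  by move=> Nx r; have [_ _ _] := EM r; apply => Mx; apply: Nx; exists r.
have fN x : f x * \1_(~` N) x = if pselect (N x) then 0 else f x.
  rewrite indicE; case: pselect => Nx /=; first by rewrite memNset ?mulr0 //= => /(_ Nx).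
  by rewrite mem_set // mulr1.
have mE r : measurable (E r) by case: (EM r).
move: N mN N0 NE fN => {EM sets} N mN _ NE fN.
pose F := \bigcup_r (if (t < ratr r)%R then E r `\` N else set0).
suff -> : (fun x => f x * \1_(~` N) x) @^-1` `]t, +oo[ = F `|` (if (t < 0)%R then N else set0).
  apply: measurableU; last by case: ifP.
  apply: bigcupT_measurable_rat => r; case: ifP => // _.
  by apply: measurableD.
apply/seteqP; split => x.
  rewrite /preimage /mkset /= in_itv /= andbT fN; case: pselect => Nx /=.
    by move=> t0; right; rewrite t0.
  move=> /rat_in_itvoo[r]; rewrite in_itv /= => /andP[tr rf].
  by left; exists r => //; rewrite tr; split => //; apply/NE.
rewrite /preimage /mkset /= in_itv /= andbT fN; case=> [[r _]|].
  by case: ifP => // tr [Ex Nx]; case: pselect => //= _; apply: lt_trans tr _; apply/NE.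
by case: ifP => // t0 Nx; case: pselect.
Qed.

End Completion.

Theorem corollary1p4 (R : realType) (A : R -> \bar R) (T : nat -> R)
    (hA : young_function A) (hD : Delta2 A) (hN : nabla2 A)
    (T_mono : forall m n : nat, (1 <= m)%N -> (m <= n)%N -> T m <= T n)
    (T_gt0 : forall n : nat, (1 <= n)%N -> 0 < T n)
    (T_oo : T n @[n --> \oo] --> +oo)
    (T_o : T =o_\oo (fun n : nat => n%:R `^ 34^-1 : R)) :
  forall f : R -> R, orlicz_space A f -> forall lambda : R, 0 < lambda ->
    (\int[leb R]_x
      A (lambda * `|chi (T n) x * hermite_sum n (f \* chi (T n)) x - f x|)%R)%E
      @[n --> \oo] --> 0%E.
Proof.
move=> f [mf [c c0 Hc]] l l0.
have [b [D [N0 hB]]] := young_fine_growth hA hD hN.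
pose a := young_fine A.
have mB : meas (fun t => a `|t|) := meas_young hA hD.
have B_pos := young_fine_pos hA hD.
have AE t : A `|t| = (a `|t|)%:E by exact: young_fineK.
have [g [N [mg mN muN fg]]] := lebesgue_measurable_borel mf.
have mla (F : R -> R) : lebesgue_measurable_fun F ->
    measurable_fun [set: lebesgueR R] (fun x => (a `|F x|)%:E : \bar R).
  by move=> mF; apply/measurable_EFinP; exact: (measurableT_comp mB mF).
have mcst (k : R) : lebesgue_measurable_fun (fun=> k) by exact: measurable_cst.
have scale (k : R) (y : R) : 0 < k -> k * `|y| = `|k * y|.
  by move=> k0; rewrite normrM gtr0_norm.
have Lc : L1 (fun x => a `|c * g x|).
  have mcg : meas (fun x => c * g x) by apply: measM => //; exact: meas_cst.
  apply/integrableP; split; first by apply/measurable_EFinP; exact: meas_modular.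
  have mag : measurable_fun [set: R] (fun x => (a `|c * g x|)%:E : \bar R).
    by apply/measurable_EFinP; exact: meas_modular.
  have maf : measurable_fun [set: lebesgueR R] (fun x => A (c * `|f x|) : \bar R).
    under eq_fun do rewrite scale // AE.
    by apply: mla; apply: (measurable_funM (mcst c)); exact: mf.
  have E x : ~ N x -> A (c * `|f x|) = (a `|c * g x|)%:E.
    by move=> Nx; rewrite scale // AE fg.
  move: Hc; rewrite (integral_leb_ae maf mag mN muN E).
  by under [X in (X < _)%E -> _]eq_integral do
    rewrite -[(_)%:E]gee0_abs ?lee_fin ?young_fine_ge0 //.
have mkg k : meas (fun x => k * g x) by apply: measM => //; exact: meas_cst.
have Lk k : L1 (fun x => a `|k * g x|).
  have := L1_modularZ hB mB (k / c) (mkg c) Lc; congr L1.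
  by apply/funext => x; rewrite mulrA divfK // gt_eqF.
have Lg : L1 (fun x => a `|g x|).
  by have := Lk 1; congr L1; apply/funext => x; rewrite mul1r.
have Tn : \forall n \near \oo, T n ^+ 2 <= n%:R.
  have := (eqoP _ _ _).1 T_o _ ltr01; move=> H; near=> n.
  have n1 : (1 <= n)%N by near: n; exact: nbhs_infty_ge.
  have : `|T n| <= 1 * `|n%:R `^ 34^-1 : R| by near: n.
  rewrite mul1r (gtr0_norm (T_gt0 n n1)) ger0_norm ?powR_ge0 // => H1.
  apply: (@le_trans _ _ ((n%:R `^ 34^-1) ^+ 2)).
    by rewrite lerXn2r ?nnegrE ?powR_ge0 ?(ltW (T_gt0 n n1)).
  rewrite -powR_mulrn ?powR_ge0 // -powRrM -[leRHS]powRr1 //.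
  by rewrite ler_powR ?ler1n //; lra.
(* By linearity the factor lambda is moved into the function. *)
have cvg := ksum_modular_cvg hB mB B_pos (mkg l) (Lk l) Tn T_oo.
have hE (k : nat) : @hermite R k = @hermite_fun R k.
  by rewrite hermite_fun.unlock.
pose G n x := ksum n (T n) (fun y => l * g y * \1_(`]- T n, T n[%classic : set R) y) x - l * g x.
have GE n x : ~ N x ->
    l * `|chi (T n) x * hermite_sum n (f \* chi (T n)) x - f x| = `|G n x|.
  move=> Nx; rewrite scale // /G fg //; congr (`| _ |).
  have Lchi := L1_modular_truncate hB B_pos (T n) mg Lg.
  have -> : (fun y => l * g y * \1_(`]- T n, T n[%classic : set R) y) =
      fun y => l * (g y * \1_(`]- T n, T n[%classic : set R) y).
    by apply/funext => y; rewrite mulrA.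
  rewrite ksumZ // mulrBr; congr (_ - _); congr (_ * _); rewrite /ksum; congr (_ * _).
  apply: eq_bigr => k _; rewrite hE; congr (_ * _).
  rewrite /hermite_coef /ip lebint.unlock /Rintegral; congr fine.
  have mchi := leb_measurable_fun (meas_indic (measurable_itv `]- T n, T n[)).
  have mh := leb_measurable_fun (@meas_hermite R k).
  apply: (integral_leb_ae _ _ mN muN).
  - apply/measurable_EFinP; rewrite hE.
    exact: measurable_funM (measurable_funM mf mchi) mh.
  - apply/measurable_EFinP; exact: measM (L1_meas Lchi) (@meas_hermite R k).
  - by move=> y Ny /=; rewrite fg // hE.
have mG n : meas (G n) by apply: measB => //; exact: meas_ksum.
have IE n : L1 (fun x => a `|G n x|) ->
    (\int[leb R]_x A (l * `|chi (T n) x * hermite_sum n (f \* chi (T n)) x - f x|)%R)%E =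
    (lebint (fun x => a `|G n x|))%:E.
  move=> LG; rewrite -EFin_lebint //.
  have mchi := leb_measurable_fun (meas_indic (measurable_itv `]- T n, T n[)).
  have mS : meas (hermite_sum n (f \* chi (T n))).
    by apply: meas_sum => k; apply: measM; [exact: meas_cst|rewrite hE; exact: meas_hermite].
  have mg1 : lebesgue_measurable_fun
      (fun x => chi (T n) x * hermite_sum n (f \* chi (T n)) x - f x).
    exact: measurable_funB (measurable_funM mchi (leb_measurable_fun mS)) mf.
  have maf := mla _ (measurable_funM (mcst l) mg1).
  have maG : measurable_fun [set: R] (fun x => (a `|G n x|)%:E : \bar R).
    by apply/measurable_EFinP; exact: meas_modular.
  under eq_integral do rewrite scale // AE.
  apply: (integral_leb_ae maf maG mN muN) => x Nx.
  by rewrite -(GE n x Nx) scale.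
have ucvg : lebint (fun x => a `|G n x|) @[n --> \oo] --> (0 : R).
  apply/cvgrPdist_le => e e0; near=> n.
  rewrite sub0r normrN ger0_norm; last first.
    by apply: lebint_ge0 => x; exact: young_fine_ge0.
  suff [] : L1 (fun x => a `|G n x|) /\ lebint (fun x => a `|G n x|) <= e by [].
  rewrite /G; near: n; exact: cvg.
have : (lebint (fun x => a `|G n x|))%:E @[n --> \oo] --> (0 : R)%:E.
  by apply: cvg_EFin => //; exact: nearW.
apply: cvg_trans; apply: near_eq_cvg; near=> n.
rewrite IE //.
suff [] : L1 (fun x => a `|G n x|) /\ lebint (fun x => a `|G n x|) <= 1 by [].
rewrite /G; near: n; exact: (cvg 1 ltr01).
Unshelve. all: by end_near. Qed.
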